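(* Let $\alpha>0$, $\beta=2/\alpha$, and let $m\ge2$ be a fixed integer. Set $$a_n=\frac{m-\alpha-1}{2}n+\frac{\alpha}{2m}n^2,\qquad b_n=\frac{n}{2m},\qquad v=\frac14(m-1)(m\beta+2).$$ For each $n$, let $\kappa$ be chosen according to $P_{n,m}^{\alpha}$ or, alternatively, according to $Q_{n,m}^{\alpha}$. Then, in either case, as $n\to\infty$, $\frac{\lambda_\kappa-a_n}{b_n}$ converges weakly to the Gamma distribution with probability density function $$h(x)=\frac{1}{\Gamma(v)(2/\beta)^v}\,x^{v-1}e^{-\beta x/2},\qquad x\ge0.$$
   Context: A partition $\kappa\vdash n$ is a non-increasing sequence of positive integers with sum $n$; its length is its number of (positive) parts. $\mathcal{P}_n(m)$ is the set of partitions of $n$ with length at most $m$, and $\mathcal{P}_n'(m)$ is the set of partitions of $n$ with length exactly $m$. A partition of length at most $m$ is written $\kappa=(k_1,\dots,k_m)$ with $k_1\ge\cdots\ge k_m\ge 0$ (padded with zeros if necessary). $\kappa'$ denotes the transpose (conjugate) partition, with parts $k_i'$, and $a(\kappa)=\sum_{i\ge1}(i-1)k_i=\sum_{i\ge1}\binom{k_i'}{2}$. The eigenvalue associated with $\kappa$ (of the Laplace–Beltrami operator in $m$ variables with parameter $\alpha$) is $$\lambda_\kappa=n(m-1)+a(\kappa')\alpha-a(\kappa).$$ Restricted Jack measures with parameter $\alpha$: for a partition $\kappa$, with products over the boxes $(i,j)$ of its Young diagram ($1\le j\le k_i$), put $$c_\kappa(\alpha)=\prod_{(i,j)\in\kappa}\big(\alpha(k_i-j)+(k_j'-i)+1\big),\qquad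 c_\kappa'(\alpha)=\prod_{(i,j)\in\kappa}\big(\alpha(k_i-j)+(k_j'-i)+\alpha\big).$$ $P_{n,m}^{\alpha}$ is the probability measure on $\mathcal{P}_n(m)$ with $$P_{n,m}^\alpha(\kappa)=\frac{1}{C_{n,m}(\alpha)}\cdot\frac{1}{c_\kappa(\alpha)c_\kappa'(\alpha)},\qquad C_{n,m}(\alpha)=\sum_{\mu\in\mathcal{P}_n(m)}\frac{1}{c_\mu(\alpha)c_\mu'(\alpha)}.$$ $Q_{n,m}^\alpha$ is the probability measure defined in the same way with $\mathcal{P}_n(m)$ replaced by $\mathcal{P}_n'(m)$ (including in the normalizing constant). *)

(* Defs.v *)
From HB Require Import structures.
From mathcomp Require Import all_boot all_order all_algebra.
From mathcomp Require Import all_classical all_reals all_analysis.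

Set Implicit Arguments.
Unset Strict Implicit.
Unset Printing Implicit Defensive.

Import Order.TTheory GRing.Theory Num.Theory.
Import numFieldNormedType.Exports.

Local Open Scope classical_set_scope.
Local Open Scope ring_scope.

(* A partition is a non-increasing sequence of naturals; trailing zeros are
   allowed, and none of the functions below depends on them. *)
Section Partitions.
Local Open Scope nat_scope.
Implicit Types (k : seq nat) (i j n m : nat).

(* Parts are indexed from 1. *)
Definition part k i : nat := nth 0 k i.-1.

Definition plength k : nat := count (ltn 0) k.

(* The j-th part of the transpose is #{i | k_i >= j}, for 1 <= j <= k_1. *)
Definition conj_part k : seq nat :=
  mkseq (fun j => count (leq j.+1) k) (head 0 k).

Definition a_stat k : nat := \sum_(1 <= i < (size k).+1) i.-1 * part k i.

(* A partition of n with at most m parts, padded with zeros to length m; each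
   part is at most n. *)
Definition padded n m := (m.-tuple 'I_n.+1)%type.

Definition parts n m (k : padded n m) : seq nat := [seq val x | x <- k].

Definition partitions_le n m : {set padded n m} :=
  [set k : padded n m | sorted geq (parts k) && (sumn (parts k) == n)].

Definition partitions_eq n m : {set padded n m} :=
  [set k in partitions_le n m | plength (parts k) == m].

End Partitions.

Section JackMeasures.
Context {R : realType}.
Implicit Types (alpha : R) (k : seq nat) (n m : nat).

Definition jack_c alpha k : R :=
  \prod_(1 <= i < (size k).+1) \prod_(1 <= j < (part k i).+1)
    (alpha * (part k i - j)%:R + (part (conj_part k) j - i)%:R + 1).

Definition jack_c' alpha k : R :=
  \prod_(1 <= i < (size k).+1) \prod_(1 <= j < (part k i).+1)
    (alpha * (part k i - j)%:R + (part (conj_part k) j - i)%:R + alpha).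

Definition jack_weight alpha k : R := (jack_c alpha k * jack_c' alpha k)^-1.

Definition jack_pmf alpha n m (S : {set padded n m}) (k : padded n m) : R :=
  if k \in S then
    jack_weight alpha (parts k) / \sum_(mu in S) jack_weight alpha (parts mu)
  else 0.

Definition jackP alpha n m : padded n m -> R :=
  jack_pmf alpha (partitions_le n m).

(* For n < m there is no partition of n of length m, and jackQ is zero. *)
Definition jackQ alpha n m : padded n m -> R :=
  jack_pmf alpha (partitions_eq n m).

Definition jack_eigenvalue alpha n m k : R :=
  n%:R * (m%:R - 1) + (a_stat (conj_part k))%:R * alpha - (a_stat k)%:R.

End JackMeasures.

Section WeakConvergence.
Context {R : realType}.

(* measurableTypeR R is R with its Borel sigma-algebra, the measurable type on
   which lebesgue_measure lives. *)
Local Notation borelR := (measurableTypeR R).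

(* The law of X(t) when t has probability mass function p. *)
Definition law (T : finType) (p : T -> R) (X : T -> R) :
    set borelR -> \bar R :=
  fun A => (\sum_(t : T) (p t)%:E * \d_(X t : borelR) A)%E.

Definition weak_cvg (mu_ : nat -> set borelR -> \bar R)
    (mu : set borelR -> \bar R) :=
  forall f : R -> R, continuous f -> bounded_fun f ->
    (\int[mu_ n]_x (f x)%:E)%E @[n --> \oo] --> (\int[mu]_x (f x)%:E)%E.

Definition Gamma (s : R) : R :=
  \int[lebesgue_measure]_(t in `[0, +oo[) (t `^ (s - 1) * expR (- t)).

(* The Gamma distribution with shape v and scale s. *)
Definition gamma_pdf (v s : R) : R -> R :=
  (fun x => (Gamma v * s `^ v)^-1 * x `^ (v - 1) * expR (- x / s))
    \_ `[0, +oo[.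

Definition gamma_prob (v s : R) : set borelR -> \bar R :=
  fun A => (\int[lebesgue_measure]_(x in A) (gamma_pdf v s x)%:E)%E.

End WeakConvergence.

(* Main.v *)
From HB Require Import structures.
Require Import Defs.
From mathcomp Require Import all_boot all_order all_algebra.
From mathcomp Require Import all_classical all_reals all_analysis.
From mathcomp Require Import measurable_realfun.
From mathcomp Require Import ring lra zify.
Import Order.TTheory GRing.Theory Num.Theory.
Import numFieldNormedType.Exports.
Local Open Scope ring_scope.

(** The statistic is, up to a vanishing shift, a multiple of the spread
    Y = sum of (L_i - mean L)^2  of the shifted rows  L_i = alpha k_i + (m - i),
    because moving a box into row i changes the eigenvalue by L_i ([eigenvalueE]).
    The law of Y is found by Stein's method for a reversible Markov chain, with
    neither Stirling asymptotics nor a multi-dimensional integral.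

    Reversibility.  The two hook products telescope along rows, so adding a box
    to row j of nu multiplies its weight w by an explicit rational function of L
    ([hook_prod_incr]).  In symmetric form, for kappa = nu + e_j,
      w(nu) u_j(nu) = w(kappa) v_j(kappa) q(L_j(kappa)),
    where u_j and v_j are the products over r <> j of 1 + 1/(L_j - L_r) and of
    1 - 1/(L_j - L_r), and q(x) = x (x + 1 - alpha) ([detailed_balance]).  Moves
    that leave the set of partitions have rate zero.  Hence removing a box from
    row j at rate v_j q(L_j) and putting it back into row i with weight u_i is a
    chain for which the restricted Jack measure is stationary
    ([chain_stationary]).

    One move.  Partial fractions make the sums of u_i p(L_i) and v_j p(L_j), for
    p of degree at most 2, symmetric polynomials in L
    ([pfrac_sum0], [pfrac_sum1], [pfrac_sum2]).  A move changes Y by 2 alpha times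
    a jump L_i - L_j, and the first two conditional moments of the jump are, up to
    lower order, functions of Y and of the size n of the partition:
      drift  =  alpha^2/m (m-1)(alpha+m) n^2 - 2 alpha n Y + error,
      mean square  =  2 alpha^2/m n^2 Y + error
    ([drift_approx], [diffusion_approx]).  The drift also has an exact upper
    bound, which pulls Y back at rate alpha n ([drift_upper]); stationarity tested
    on Y and on Y^2 then gives E Y = O(n) and E Y^2 = O(n^2) ([moment_bounds]), so
    the errors are negligible in mean.

    Laplace transform.  Put W = m Y / (alpha n).  Stationarity tested on
    exp (- t W) becomes, with v the shape parameter,
      (1 + alpha t) E[W exp (- t W)] = alpha v E[exp (- t W)] + O(n^(-1/2))
    ([stein_laplace]).  This is a linear differential equation in t for the
    Laplace transform, whose solution (1 + alpha t)^(- v) is the Laplace transform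
    of the Gamma law ([laplace_mean_cvg], [gamma_laplaceE]).  Convergence of
    Laplace transforms gives weak convergence by Bernstein approximation in the
    variable exp (- e (x + 1)) ([laplace_weak]).

    Partitions with exactly m parts.  Their measure is the first one conditioned
    on k_m > 0, and k_m = 0 forces Y to be at least of order n^2, an event of
    probability O(1/n) by Markov's inequality ([jackP_jackQ_close]). *)

(** * Partial-fraction sums *)

Section PartialFractions.
Context {F : fieldType}.
Implicit Types (th x y z : F) (s : seq F).

(** The residue, up to the factor [th], of the product over [y] of
    [1 + th / (z - y)] at the simple pole [z = x].  Lists rather than ordinals make
    the induction on the number of poles immediate. *)
Definition pfrac th x s : F := \prod_(y <- s | y != x) (1 + th / (x - y)).

Lemma pfrac_cons th x y s :
  pfrac th x (y :: s) = (if y == x then 1 else 1 + th / (x - y)) * pfrac th x s.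
Proof. by rewrite /pfrac big_cons; case: eqP => //=; rewrite mul1r. Qed.

Lemma pfrac_sum_cons th y s (g : F -> F) : y \notin s ->
  \sum_(x <- y :: s) pfrac th x (y :: s) * g x =
  pfrac th y s * g y
  + \sum_(x <- s) pfrac th x s * (1 + th / (x - y)) * g x.
Proof.
move=> yNs; rewrite big_cons pfrac_cons eqxx mul1r; congr (_ + _).
rewrite !big_seq; apply: eq_bigr => x xs; rewrite pfrac_cons.
by case: eqP => [yx|_]; [rewrite yx xs in yNs | rewrite (mulrC (1 + _))].
Qed.

Lemma pfrac_notin th y s : y \notin s ->
  pfrac th y s = \prod_(x <- s) (1 + th / (y - x)).
Proof.
move=> yNs; rewrite /pfrac big_seq_cond [RHS]big_seq_cond; apply: eq_bigl => x.
rewrite andbT; case xs: (x \in s) => //=.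
by apply: contraNneq yNs => <-.
Qed.

(** The new factor [1 + th / (z - y)] splits every old pole term
    into one at [x] and one at [y], and the terms at [y] collect into the old
    identity evaluated at [z = y]. *)
Lemma partial_fractions th z s : uniq s -> z \notin s ->
  \prod_(y <- s) (1 + th / (z - y)) =
  1 + th * \sum_(x <- s) pfrac th x s / (z - x).
Proof.
elim: s z => [|y s IH] z; first by rewrite !big_nil mulr0 addr0.
move=> /= /andP[yNs us]; rewrite inE negb_or => /andP[zy zNs].
have pz : pfrac th y s = 1 + th * \sum_(x <- s) pfrac th x s / (y - x).
  by rewrite -IH // pfrac_notin.
rewrite (@pfrac_sum_cons _ _ _ (fun x => (z - x)^-1)) // big_cons IH // pz.
have zy0 : z - y != 0 by rewrite subr_eq0.
rewrite mulrDr !mulrDl !mul1r !mulrDr addrA.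
have -> : \sum_(x <- s) pfrac th x s * (1 + th / (x - y)) / (z - x) =
  \sum_(x <- s) pfrac th x s / (z - x)
  + th / (z - y) * (\sum_(x <- s) pfrac th x s / (z - x) -
               \sum_(x <- s) pfrac th x s / (y - x)).
  rewrite -sumrB mulr_sumr -big_split /= !big_seq; apply: eq_bigr => x xs.
  have zx0 : z - x != 0 by rewrite subr_eq0; apply: contraNneq zNs => ->.
  have yx0 : y - x != 0 by rewrite subr_eq0; apply: contraNneq yNs => ->.
  have xy0 : x - y != 0 by rewrite -opprB oppr_eq0.
  by field; rewrite zx0 yx0 xy0 zy0.
by field.
Qed.

(** Evaluating the residue at the new pole [y] by partial
    fractions replaces the singular terms by divided differences [d] of [g], which
    for a polynomial [g] have smaller degree.  This drives the computation of the
    moments below. *)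
Lemma pfrac_moment_cons th y s (g d : F -> F) : uniq s -> y \notin s ->
    (forall x, x != y -> g x - g y = (x - y) * d x) ->
  \sum_(x <- y :: s) pfrac th x (y :: s) * g x =
  \sum_(x <- s) pfrac th x s * g x + g y + th * \sum_(x <- s) pfrac th x s * d x.
Proof.
move=> us yNs gd; rewrite pfrac_sum_cons // pfrac_notin // partial_fractions //.
have -> : \sum_(x <- s) pfrac th x s * (1 + th / (x - y)) * g x =
  \sum_(x <- s) pfrac th x s * g x + th * \sum_(x <- s) pfrac th x s * d x
  - th * (\sum_(x <- s) pfrac th x s / (y - x)) * g y.
  rewrite -mulrA mulr_suml !mulr_sumr -big_split -sumrB /= !big_seq.
  apply: eq_bigr => x xs.
  have xy : x != y by apply: contraNneq yNs => <-.
  have xy0 : x - y != 0 by rewrite subr_eq0.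
  have yx0 : y - x != 0 by rewrite -opprB oppr_eq0.
  have -> : d x = (g x - g y) / (x - y) by rewrite gd // mulrC mulKf.
  by field; rewrite xy0 yx0.
by ring.
Qed.

Lemma pfrac_sum0 th s : uniq s -> \sum_(x <- s) pfrac th x s = (size s)%:R.
Proof.
elim: s => [|y s IH /= /andP[yNs us]]; first by rewrite big_nil.
have := @pfrac_moment_cons th y s (fun=> 1) (fun=> 0) us yNs.
rewrite -!mulr_suml mulr0 mulr0 addr0 !mulr1 => -> //.
  by rewrite IH // -natr1.
by move=> x _; rewrite mulr0 subrr.
Qed.

Lemma pfrac_sum1 th s : uniq s ->
  \sum_(x <- s) pfrac th x s * x =
  \sum_(x <- s) x + th * 'C(size s, 2)%:R.
Proof.
elim: s => [|y s IH /= /andP[yNs us]]; first by rewrite !big_nil mulr0 addr0.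
rewrite (@pfrac_moment_cons th y s id (fun=> 1)) // => [|x _]; last by rewrite mulr1.
by rewrite IH // -mulr_suml mulr1 pfrac_sum0 // big_cons binS bin1 natrD; ring.
Qed.

Lemma pfrac_sum2 th s : uniq s ->
  \sum_(x <- s) pfrac th x s * x ^+ 2 =
  \sum_(x <- s) x ^+ 2 + th * ((size s)%:R - 1) * \sum_(x <- s) x
  + th ^+ 2 * 'C(size s, 3)%:R.
Proof.
elim: s => [|y s IH /= /andP[yNs us]].
  by rewrite !big_nil !mulr0 !addr0.
rewrite (@pfrac_moment_cons th y s (fun x => x ^+ 2) (fun x => x + y)) // => [|x _]; last by ring.
under [X in th * X]eq_bigr do rewrite mulrDr.
rewrite big_split /= -mulr_suml pfrac_sum0 // pfrac_sum1 // IH //.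
by rewrite !big_cons binS natrD -natr1; ring.
Qed.
End PartialFractions.

(** * Hook products and one added box *)

Section Hooks.
Context {R : realType} (alpha : R) (m : nat).
Hypothesis alpha_gt0 : 0 < alpha.
Implicit Types (tau : R) (K : 'I_m -> nat).

Let alpha_ge0 : 0 <= alpha. Proof. exact: ltW. Qed.

Let alx_ge0 x : 0 <= alpha * x%:R. Proof. by rewrite mulr_ge0 // ltW. Qed.

(** The factors of a row of length [x] when every leg is zero. *)
Definition hook_row tau (x : nat) : R := \prod_(0 <= a < x) (alpha * a%:R + tau).

(** The correction that a lower row of length [y], [s] rows down, makes
    to the hooks of a row of length [x]: it raises by one the legs of the first [y]
    boxes. *)
Definition hook_pair tau (x y s : nat) : R :=
  \prod_(1 <= b < y.+1) ((alpha * (x%:R - b%:R) + s%:R + tau) /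
                         (alpha * (x%:R - b%:R) + s%:R - 1 + tau)).

(** A closed form of both hook products, [tau = 1] and [tau = alpha],
    in which a change of one row is visible. *)
Definition hook_prod tau K : R :=
  \prod_(i < m) (hook_row tau (K i) *
    \prod_(r < m | (i < r)%N) hook_pair tau (K i) (K r) (r - i)).

(** In these coordinates differences of rows absorb the leg lengths, and
    the last row of length zero sits at the origin. *)
Definition shifted K (i : 'I_m) : R := alpha * (K i)%:R + (m%:R - i%:R - 1).

(** Shapes are functions on ['I_m], so that rows can be changed one at a
    time without rebuilding a sequence. *)
Definition is_part K := forall i r : 'I_m, (i <= r)%N -> (K r <= K i)%N.

Definition incr K (j : 'I_m) : 'I_m -> nat :=
  fun i => if i == j then (K i).+1 else K i.

Lemma hook_pair_den tau x b s : 0 < tau -> (b <= x)%N -> (0 < s)%N ->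
  0 < alpha * (x%:R - b%:R) + s%:R - 1 + tau.
Proof.
move=> t0 bx s0; have : 0 <= alpha * (x%:R - b%:R).
  by rewrite mulr_ge0 ?alpha_ge0 // subr_ge0 ler_nat.
have : (1 : R) <= s%:R by rewrite ler1n.
lra.
Qed.

Lemma hook_pair_right tau x y s :
  hook_pair tau x y.+1 s = hook_pair tau x y s *
    ((alpha * (x%:R - y%:R) + s%:R + tau - alpha) /
     (alpha * (x%:R - y%:R) + s%:R - 1 + tau - alpha)).
Proof.
rewrite /hook_pair big_nat_recr //=; congr (_ * (_ / _)); rewrite -natr1; ring.
Qed.

(** Lengthening the upper row shifts the index of the product by
    one, so only its first and last factors remain. *)
Lemma hook_pair_left tau x y s : 0 < tau -> (y <= x)%N -> (0 < s)%N ->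
  hook_pair tau x.+1 y s = hook_pair tau x y s *
    ((alpha * x%:R + s%:R + tau) / (alpha * x%:R + s%:R - 1 + tau)) *
    ((alpha * (x%:R - y%:R) + s%:R - 1 + tau) /
     (alpha * (x%:R - y%:R) + s%:R + tau)).
Proof.
move=> t0 yx s0; elim: y yx => [|y IH] yx.
  rewrite /hook_pair !big_geq // mul1r subr0.
  have := hook_pair_den _ _ _ _ t0 (leq0n x) s0.
  rewrite subr0 => h; field; lra.
rewrite [LHS]big_nat_recr //= -/(hook_pair _ _ _ _) IH; last exact: ltnW.
rewrite [hook_pair tau x y.+1 s]big_nat_recr //= -/(hook_pair _ _ _ _).
have h0 := hook_pair_den _ _ _ _ t0 (leq0n x) s0.
have h1 := hook_pair_den _ _ _ _ t0 yx s0.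
have h2 := hook_pair_den _ _ _ _ t0 (ltnW yx) s0.
rewrite subr0 -!natr1 in h0 h1 h2 *; field; lra.
Qed.

Lemma hook_pair_gt0 tau x y s : 0 < tau -> (y <= x)%N -> (0 < s)%N ->
  0 < hook_pair tau x y s.
Proof.
move=> t0 yx s0; rewrite /hook_pair big_nat_cond prodr_gt0 // => b.
case/andP=> /andP[_ by_] _; rewrite ltnS in by_.
have := hook_pair_den _ _ _ _ t0 (leq_trans by_ yx) s0.
by move=> h; rewrite divr_gt0 //; lra.
Qed.

(** A product over pairs whose factors are trivial away from [j] is
    a product over the partners of [j]; adding a box to row [j] is this case. *)
Lemma prod_pairs_at (j : 'I_m) (f : 'I_m -> 'I_m -> R) :
  (forall i r : 'I_m, i != j -> r != j -> f i r = 1) ->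
  \prod_(i < m) \prod_(r < m | (i < r)%N) f i r =
  \prod_(r < m | r != j) (if (j < r)%N then f j r else f r j).
Proof.
move=> f1; rewrite (bigD1 j) //= [RHS](bigID (fun r : 'I_m => (j < r)%N)) /=.
have -> : \prod_(i < m | i != j) \prod_(r < m | (i < r)%N) f i r =
   \prod_(i < m | (i != j) && ~~ (j < i)%N) f i j.
  rewrite [LHS](bigID (fun i : 'I_m => (j < i)%N)) /= big1 ?mul1r.
    apply: eq_bigr => i /andP[ij ji]; rewrite (bigD1 j) /=; last first.
      by rewrite ltn_neqAle leqNgt ji andbT.
    by rewrite big1 ?mulr1 // => r /andP[_ rj]; exact: f1.
  move=> i /andP[ij ji]; rewrite big1 // => r ir; apply: f1 => //.
  by apply: contraTneq ir => ->; rewrite -leqNgt ltnW.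
congr (_ * _).
  rewrite [LHS](eq_bigl (fun r : 'I_m => (r != j) && (j < r)%N)); last first.
    move=> r; case: (ltnP j r) => jr; rewrite ?andbF ?andbT //.
    by rewrite -val_eqE /= gtn_eqF.
  by apply: eq_bigr => r /andP[_ ->].
by apply: eq_bigr => r /andP[_ /negbTE ->].
Qed.

(** The first factors left by [hook_pair_left] for all rows below
    [j] telescope: this is where the number [m] of rows enters the weight. *)
Lemma telescope_shift (x : nat) tau (j : 'I_m) : 0 < tau ->
  \prod_(r < m | (j < r)%N) ((alpha * x%:R + (r - j)%:R + tau) /
     (alpha * x%:R + (r - j)%:R - 1 + tau)) =
  (alpha * x%:R + (m%:R - j%:R - 1) + tau) / (alpha * x%:R + tau).
Proof.
move=> t0.
pose f (r : nat) : R := alpha * x%:R + (r%:R - j%:R - 1) + tau.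
have f0 r : (j < r)%N -> f r != 0.
  move=> jr; rewrite gt_eqF // /f.
  have := alx_ge0 x.
  have : j%:R + 1 <= r%:R :> R by rewrite natr1 ler_nat.
  lra.
transitivity (\prod_(j.+1 <= r < m) (f r.+1 / f r)).
  rewrite (big_nat_widenl _ 0) // big_mkord /=; apply: eq_bigr => r jr.
  rewrite /f natrB ?(ltnW jr) // -natr1; congr (_ / _); ring.
case: (leqP m j.+1) => jm.
  have mj : m%:R = j%:R + 1 :> R.
    by rewrite natr1; congr (_%:R); apply/eqP; rewrite eqn_leq jm ltn_ord.
  have t1 : alpha * x%:R + tau != 0.
    by rewrite gt_eqF // ltr_wpDl ?alx_ge0.
  by rewrite big_geq // mj (_ : _ + _ + tau = alpha * x%:R + tau) ?divff //; ring.
rewrite telescope_prodf //; last by move=> r /andP[jr _]; apply/f0/ltnW.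
by rewrite /f -natr1; congr (_ / _); ring.
Qed.

Lemma shifted_diff K (i r : 'I_m) :
  shifted K i - shifted K r = alpha * ((K i)%:R - (K r)%:R) + (r%:R - i%:R).
Proof. by rewrite /shifted; ring. Qed.

Lemma incr_id K j : incr K j j = (K j).+1.
Proof. by rewrite /incr eqxx. Qed.

Lemma incr_neq K i j : i != j -> incr K j i = K i.
Proof. by rewrite /incr => /negbTE ->. Qed.

Lemma shifted_ge0 K i : 0 <= shifted K i.
Proof.
rewrite addr_ge0 ?alx_ge0 // -addrA -opprD subr_ge0 natr1 ler_nat.
exact: ltn_ord.
Qed.

(** Only hooks in the row and in the column of the new box change.
    After telescoping, every other row [r] contributes one ratio that depends on
    [L_j - L_r] alone. *)
Lemma hook_prod_incr tau K j : 0 < tau -> is_part K -> is_part (incr K j) ->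
  hook_prod tau (incr K j) = hook_prod tau K * (shifted K j + tau) *
  \prod_(r < m | r != j)
    (let D := shifted K j - shifted K r in
     if (j < r)%N then (D - 1 + tau) / (D + tau)
     else (D + alpha - tau) / (D + alpha + 1 - tau)).
Proof.
move=> t0 pK pK'.
rewrite /hook_prod !big_split /=.
have -> : \prod_(i < m) hook_row tau (incr K j i) =
          \prod_(i < m) hook_row tau (K i) * (alpha * (K j)%:R + tau).
  rewrite (bigD1 j) //= [in RHS](bigD1 j) //= incr_id /hook_row big_nat_recr //=.
  rewrite mulrAC; congr (_ * _ * _); apply: eq_bigr => i ij; by rewrite incr_neq.
pose g (i r : 'I_m) : R := if i == j then
    ((alpha * (K j)%:R + (r - j)%:R + tau) / (alpha * (K j)%:R + (r - j)%:R - 1 + tau)) *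
    ((alpha * ((K j)%:R - (K r)%:R) + (r - j)%:R - 1 + tau) /
     (alpha * ((K j)%:R - (K r)%:R) + (r - j)%:R + tau))
  else if r == j then
   ((alpha * ((K i)%:R - (K j)%:R) + (j - i)%:R + tau - alpha) /
     (alpha * ((K i)%:R - (K j)%:R) + (j - i)%:R - 1 + tau - alpha)) else 1.
have -> : \prod_(i < m) \prod_(r < m | (i < r)%N)
             hook_pair tau (incr K j i) (incr K j r) (r - i) =
   \prod_(i < m) \prod_(r < m | (i < r)%N) hook_pair tau (K i) (K r) (r - i) *
   \prod_(i < m) \prod_(r < m | (i < r)%N) g i r.
  rewrite -big_split /=; apply: eq_bigr => i _.
  rewrite -big_split /=; apply: eq_bigr => r ir.
  have sp : (0 < r - i)%N by rewrite subn_gt0.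
  rewrite /g; case: eqP => [ij|/eqP ij].
    subst i; rewrite incr_id incr_neq; last by rewrite -val_eqE /= gtn_eqF.
    rewrite hook_pair_left ?mulrA //; exact/pK/ltnW.
  rewrite incr_neq //; case: eqP => [rj|/eqP rj].
    by subst r; rewrite incr_id hook_pair_right.
  by rewrite incr_neq // mulr1.
rewrite (@prod_pairs_at j g); last by move=> i r /negbTE ij /negbTE rj; rewrite /g ij rj.
set P1 := \prod_i _; set P2 := \prod_i _.
rewrite mulrACA -!mulrA; do 2 congr (_ * _).
have -> : shifted K j + tau = (alpha * (K j)%:R + tau) *
   \prod_(r < m | (j < r)%N) ((alpha * (K j)%:R + (r - j)%:R + tau) /
     (alpha * (K j)%:R + (r - j)%:R - 1 + tau)).
  rewrite telescope_shift // /shifted [RHS]mulrC divfK // gt_eqF //.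
  by rewrite ltr_wpDl ?alx_ge0.
rewrite -mulrA; congr (_ * _).
rewrite [X in _ = X * _](_ : _ = \prod_(r < m | r != j)
   (if (j < r)%N then ((alpha * (K j)%:R + (r - j)%:R + tau) /
     (alpha * (K j)%:R + (r - j)%:R - 1 + tau)) else 1)); last first.
  rewrite big_mkcond [RHS]big_mkcond; apply: eq_bigr => r _.
  by case: eqP => // ->; rewrite ltnn.
rewrite -big_split; apply: eq_bigr => r rj /=; rewrite /g eqxx (negbTE rj).
rewrite shifted_diff.
case: ltnP => jr; first by rewrite natrB ?(ltnW jr) //; congr (_ * (_ / _)); ring.
have {}jr : (r < j)%N by rewrite ltn_neqAle jr andbT.
have h0 : 0 < alpha * ((K r)%:R - (K j).+1%:R) + (j - r)%:R - 1 + tau.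
  apply: hook_pair_den; rewrite ?subn_gt0 //.
  by have := pK' r j (ltnW jr); rewrite incr_id incr_neq.
rewrite mul1r natrB ?(ltnW jr) // -natr1 in h0 *.
by field; lra.
Qed.

End Hooks.

(** * Detailed balance *)

Ltac nonzero :=
  repeat (apply/andP; split);
  first [by apply: lt0r_neq0; lra | by apply: ltr0_neq0; lra].

Section Balance.
Context {R : realType} (alpha : R) (m : nat).
Hypothesis alpha_gt0 : 0 < alpha.
Implicit Types (tau : R) (K : 'I_m -> nat) (x : 'I_m -> R).
Local Notation L := (shifted alpha m).

(** With [th = 1] and [th = -1] these are the weights of adding and of
    removing a box in row [j], which have polynomial moments by partial
    fractions. *)
Definition pweight (th : R) x (j : 'I_m) : R :=
  \prod_(r < m | r != j) (1 + th / (x j - x r)).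

Definition quad (x : R) : R := x * (x + 1 - alpha).

Definition partition_weight K : R := (hook_prod alpha m 1 K * hook_prod alpha m alpha K)^-1.

Definition unit_vec (j : 'I_m) : 'I_m -> R := fun i => (i == j)%:R * alpha.

Lemma unit_vec_id j : unit_vec j j = alpha.
Proof. by rewrite /unit_vec eqxx mul1r. Qed.

Lemma unit_vec_neq j i : i != j -> unit_vec j i = 0.
Proof. by rewrite /unit_vec => /negbTE ->; rewrite mul0r. Qed.

Lemma shifted_gap K (i r : 'I_m) : is_part m K -> (i < r)%N -> 1 <= L K i - L K r.
Proof.
move=> pK ir; rewrite shifted_diff.
have : 0 <= alpha * ((K i)%:R - (K r)%:R).
  by rewrite mulr_ge0 ?(ltW alpha_gt0) // subr_ge0 ler_nat; apply/pK/ltnW.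
have : 1 <= r%:R - i%:R :> R by rewrite lerBrDr addrC natr1 ler_nat.
lra.
Qed.

Lemma shifted_incr K j i : L (incr m K j) i = L K i + unit_vec j i.
Proof.
rewrite /shifted /incr /unit_vec; case: eqP => _; rewrite ?mul0r ?mul1r ?addr0 //.
by rewrite -natr1; ring.
Qed.

Lemma hook_prod_gt0 tau K : 0 < tau -> is_part m K -> 0 < hook_prod alpha m tau K.
Proof.
move=> t0 pK; rewrite prodr_gt0 // => i _; rewrite mulr_gt0 //.
  by rewrite prodr_gt0 // => a _; rewrite ltr_wpDl // mulr_ge0 // ltW.
rewrite prodr_gt0 // => r ir; apply: hook_pair_gt0 => //; last by rewrite subn_gt0.
exact/pK/ltnW.
Qed.

Lemma partition_weight_gt0 K : is_part m K -> 0 < partition_weight K.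
Proof. by move=> pK; rewrite invr_gt0 mulr_gt0 // hook_prod_gt0. Qed.

(** The ratio of [hook_prod_incr] for [tau = 1] times the one for
    [tau = alpha] is exactly the quotient of a removal weight by an addition
    weight, times [quad]; the constants [1] and [alpha] of the two hook
    products combine into [quad]. *)
Lemma detailed_balance K j : is_part m K -> is_part m (incr m K j) ->
  partition_weight (incr m K j) *
    (pweight (-1) (L (incr m K j)) j * quad (L (incr m K j) j)) =
  partition_weight K * pweight 1 (L K) j.
Proof.
move=> pK pK'; rewrite /partition_weight.
have h1 := hook_prod_gt0 _ _ (@ltr01 R) pK.
have ha := hook_prod_gt0 _ _ alpha_gt0 pK.
have h1' := hook_prod_gt0 _ _ (@ltr01 R) pK'.
have ha' := hook_prod_gt0 _ _ alpha_gt0 pK'.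
rewrite (hook_prod_incr alpha m alpha_gt0 1 K j) // in h1' *.
rewrite (hook_prod_incr alpha m alpha_gt0 alpha K j) // in ha' *.
set P1 := \prod_(r < m | r != j) _ in h1' *.
set P2 := \prod_(r < m | r != j) _ in ha' *.
have -> : pweight (-1) (L (incr m K j)) j = P1 * P2 * pweight 1 (L K) j.
  rewrite /P1 /P2 /pweight -!big_split /=; apply: eq_bigr => r rj.
  rewrite !shifted_incr unit_vec_id (unit_vec_neq _ _ rj) addr0.
  case: ltnP => jr.
    have D1 := shifted_gap _ _ _ pK jr.
    by have a0 := alpha_gt0; clear -D1 a0; field; nonzero.
  have {}jr : (r < j)%N by rewrite ltn_neqAle jr andbT.
  have := shifted_gap _ _ _ pK' jr.
  rewrite !shifted_incr unit_vec_id (unit_vec_neq _ _ rj) addr0 => D1.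
  by have a0 := alpha_gt0; clear -D1 a0; field; nonzero.
have p1 : P1 != 0 by apply: contraTneq h1' => ->; rewrite mulr0 ltxx.
have p2 : P2 != 0 by apply: contraTneq ha' => ->; rewrite mulr0 ltxx.
have L0 := shifted_ge0 alpha m alpha_gt0 K j.
rewrite shifted_incr unit_vec_id /quad.
by field; rewrite p1 p2 (gt_eqF h1) (gt_eqF ha) /=; have a0 := alpha_gt0; clear -L0 a0; nonzero.
Qed.

Definition decr K (j : 'I_m) : 'I_m -> nat :=
  fun i => if i == j then (K i).-1 else K i.

(** Adding a box to row [j] leaves the partitions only if row
    [j - 1] has the same length; then the two shifted rows differ by exactly 1 and a
    factor vanishes. *)
Lemma pweight_up_eq0 K j : is_part m K -> ~ is_part m (incr m K j) ->
  pweight 1 (L K) j = 0.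
Proof.
move=> pK npK.
have [/eqP j0|j0] := boolP (j == 0 :> nat)%N.
  exfalso; apply: npK => i r ir; rewrite /incr.
  have [rj|rj] := eqVneq r j; have [ij|ij] := eqVneq i j => //.
  - by rewrite rj ij.
  - by move: ir ij; rewrite rj -val_eqE /=; lia.
  - by rewrite leqW //; exact: pK.
  - exact: pK.
have jm : (j.-1 < m)%N by rewrite (leq_ltn_trans (leq_pred _) (ltn_ord j)).
pose i0 := Ordinal jm.
have i0j : i0 != j by rewrite -val_eqE /=; lia.
have [e|ne] := eqVneq (K i0) (K j).
  rewrite /pweight (bigD1 i0) //= shifted_diff e subrr mulr0 add0r.
  have -> : (j.-1)%:R - j%:R = -1 :> R.
    have {2}-> : nat_of_ord j = j.-1.+1 by lia.
    by rewrite -natr1; ring.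
  by rewrite invrN1 mul1r subrr mul0r.
exfalso; apply: npK => i r ir; rewrite /incr.
have [rj|rj] := eqVneq r j; have [ij|ij] := eqVneq i j => //.
- by rewrite rj ij.
- rewrite rj; have : (K i0 <= K i)%N.
    by apply: pK => /=; move: ir ij; rewrite rj -val_eqE /=; lia.
  by have := pK i0 j (leq_pred _); lia.
- by rewrite leqW //; exact: pK.
- exact: pK.
Qed.

(** Either row [j + 1] has the same length and a factor vanishes,
    or [j] is the last row, it is empty, and [quad] vanishes at the origin. *)
Lemma pweight_down_eq0 K j : is_part m K ->
  ~ ((0 < K j)%N /\ is_part m (decr K j)) ->
  pweight (-1) (L K) j * quad (L K j) = 0.
Proof.
move=> pK npK.
have [jm|jm] := ltnP j.+1 m.
  pose r0 := Ordinal jm.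
  have r0j : r0 != j by rewrite -val_eqE /=; lia.
  have [e|ne] := eqVneq (K r0) (K j).
    rewrite /pweight (bigD1 r0) //= shifted_diff e subrr mulr0 add0r.
    by rewrite -natr1 addrAC subrr add0r divr1 subrr !mul0r.
  have Kr0 : (K r0 < K j)%N by rewrite ltn_neqAle ne pK //= .
  exfalso; apply: npK; split=> [|i r ir]; first by lia.
  rewrite /decr; have [rj|rj] := eqVneq r j; have [ij|ij] := eqVneq i j => //.
  - by rewrite rj ij.
  - by rewrite (leq_trans (leq_pred _)) //; exact: pK.
  - have : (K r <= K r0)%N.
      by apply: pK => /=; move: ir rj; rewrite ij -val_eqE /=; lia.
    by rewrite ij; lia.
  - exact: pK.
have [K0|K0] := posnP (K j).
  have -> : L K j = 0.
    rewrite /shifted K0 mulr0 add0r.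
    have -> : (m%:R : R) = j.+1%:R by congr (_%:R); have := ltn_ord j; lia.
    by rewrite -natr1; ring.
  by rewrite /quad mul0r mulr0.
exfalso; apply: npK; split=> // i r ir; rewrite /decr.
have [rj|rj] := eqVneq r j; have [ij|ij] := eqVneq i j => //.
- by rewrite rj ij.
- by rewrite (leq_trans (leq_pred _)) //; exact: pK.
- by move: ir rj; rewrite ij -val_eqE /=; have := ltn_ord r; lia.
- exact: pK.
Qed.

(** Shifted rows are at distance at least 1, so every factor lies
    between 0 and 2. *)
Lemma pweight_bound th K j : is_part m K -> th = 1 \/ th = -1 ->
  0 <= pweight th (L K) j <= 2 ^+ m.
Proof.
move=> pK th1.
have fac r : r != j -> 0 <= 1 + th / (L K j - L K r) <= 2.
  move=> rj; set D := _ - _.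
  have : `|D^-1| <= 1.
    rewrite normfV invf_le1 /D.
      have [jr|jr] := ltnP j r; first by rewrite (le_trans (shifted_gap _ _ _ pK jr)) ?ler_norm.
      have {}jr : (r < j)%N by rewrite ltn_neqAle jr andbT.
      by rewrite distrC (le_trans (shifted_gap _ _ _ pK jr)) ?ler_norm.
    rewrite normr_gt0; apply/eqP => D0.
    have [jr|jr] := ltnP j r; first by have := shifted_gap _ _ _ pK jr; rewrite D0; lra.
    have {}jr : (r < j)%N by rewrite ltn_neqAle jr andbT.
    by have := shifted_gap _ _ _ pK jr; lra.
  rewrite ler_norml => /andP[d1 d2].
  by case: th1 => ->; rewrite ?mul1r ?mulN1r; lra.
apply/andP; split; first by apply: prodr_ge0 => r /fac /andP[].
rewrite (le_trans (y := \prod_(r < m | r != j) (2 : R))) //.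
  by apply: ler_prod => r /fac.
rewrite prodr_const ler_eXn2l ?ltr1n //.
by rewrite (leq_trans (max_card _)) // card_ord.
Qed.
End Balance.

(** * The chain that moves one box *)

Section Shapes.
Context (m n : nat).
Implicit Types (K : 'I_m -> nat) (k : padded n m).

Definition rows k : 'I_m -> nat := fun i => tnth k i.

Lemma nth_parts k (i : 'I_m) : nth 0%N (parts k) i = rows k i.
Proof.
rewrite /parts /rows (tnth_nth ord0) (nth_map ord0) // size_tuple.
exact: ltn_ord.
Qed.

Lemma sorted_parts k : sorted geq (parts k) <-> is_part m (rows k).
Proof.
split=> [s i r ir|p].
  rewrite -!nth_parts.
  have := @sorted_leq_nth _ geq (fun b a c => fun h1 h2 => leq_trans h2 h1) leqnn 0%N _ s i r.
  by rewrite !inE size_map size_tuple; apply.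
apply/(sortedP 0%N) => i; rewrite size_map size_tuple => im.
by have := p (Ordinal (ltnW im)) (Ordinal im) (leqnSn i); rewrite -!nth_parts.
Qed.

Lemma sumn_parts k : sumn (parts k) = (\sum_(i < m) rows k i)%N.
Proof. by rewrite sumnE /parts big_map big_tuple. Qed.

Lemma partitions_leP k :
  reflect (is_part m (rows k) /\ (\sum_(i < m) rows k i = n)%N)
          (k \in partitions_le n m).
Proof.
rewrite inE sumn_parts; apply: (iffP andP) => -[p s]; split.
- exact/sorted_parts.
- exact/eqP.
- exact/sorted_parts.
- exact/eqP.
Qed.

(** Rows longer than [n] are truncated to zero by [inord]; the lemmas
    below exclude that case through the size of the partition. *)
Definition with_rows K : padded n m := [tuple inord (K i) | i < m].

Lemma rows_with_rows K : (forall i, (K i <= n)%N) -> rows (with_rows K) = K.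
Proof. by move=> Kn; apply/funext => i; rewrite /rows tnth_mktuple inordK ?ltnS. Qed.

Lemma with_rowsK k : with_rows (rows k) = k.
Proof. by apply: eq_from_tnth => i; rewrite tnth_mktuple inord_val. Qed.

Lemma rows_le k i : (rows k i <= n)%N.
Proof. by rewrite /rows -ltnS. Qed.

Definition add_box j k := with_rows (incr m (rows k) j).
Definition del_box j k := with_rows (decr m (rows k) j).

Lemma rows_del_box j k : rows (del_box j k) = decr m (rows k) j.
Proof.
apply: rows_with_rows => i; rewrite /decr; have := rows_le k i.
by case: eqP => // _; lia.
Qed.

Lemma rows_add_box j k : (rows k j < n)%N -> rows (add_box j k) = incr m (rows k) j.
Proof.
move=> kn; apply: rows_with_rows => i; rewrite /incr; have := rows_le k i.
by case: eqP => // ->.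
Qed.

Lemma decrK K j : (0 < K j)%N -> incr m (decr m K j) j = K.
Proof.
move=> k0; apply/funext => i; rewrite /incr /decr.
by case: eqP => // ->; rewrite prednK.
Qed.

Lemma incrK K j : decr m (incr m K j) j = K.
Proof. by apply/funext => i; rewrite /incr /decr; case: eqP. Qed.

Lemma del_boxK j k : (0 < rows k j)%N -> add_box j (del_box j k) = k.
Proof. by move=> k0; rewrite /add_box rows_del_box decrK // with_rowsK. Qed.

Lemma add_boxK j k : (rows k j < n)%N -> del_box j (add_box j k) = k.
Proof. by move=> kn; rewrite /del_box rows_add_box // incrK with_rowsK. Qed.

Lemma sum_incr K j : (\sum_(i < m) incr m K j i = (\sum_(i < m) K i).+1)%N.
Proof.
rewrite (bigD1 j) //= [in RHS](bigD1 j) //= incr_id addSn; congr (_ + _).+1.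
by apply: eq_bigr => i ij; rewrite incr_neq.
Qed.

End Shapes.

Section Chain.
Context {R : realType} (alpha : R) (m n : nat).
Hypothesis alpha_gt0 : 0 < alpha.
Implicit Types (K : 'I_m -> nat) (k : padded n m).
Local Notation L := (shifted alpha m).
Local Notation rows := (rows m n).
Local Notation add_box := (add_box m n).
Local Notation del_box := (del_box m n).

(** The chain first removes a box from row [j] at this rate. *)
Definition down_rate K j : R := pweight m (-1) (L K) j * quad alpha (L K j).

(** Partitions of [n - 1], stored in the type of padded
    partitions of [n] so that both steps of the chain stay in one finite type. *)
Definition smaller_partition k : bool :=
  sorted geq (parts k) && (sumn (parts k) == n.-1).

Lemma smaller_partitionP k :
  reflect (is_part m (rows k) /\ (\sum_(i < m) rows k i = n.-1)%N) (smaller_partition k).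
Proof.
rewrite /smaller_partition sumn_parts; apply: (iffP andP) => -[p s]; split.
- exact/sorted_parts.
- exact/eqP.
- exact/sorted_parts.
- exact/eqP.
Qed.

(** Detailed balance summed over all shapes: the bijection between
    partitions of [n] with a removable box in row [j] and partitions of [n - 1] with
    an addable one, all other terms being zero. *)
Lemma down_sum j (G : padded n m -> R) : (0 < n)%N ->
  \sum_(k in partitions_le n m)
     partition_weight alpha m (rows k) * down_rate (rows k) j * G (del_box j k) =
  \sum_(k | smaller_partition k)
     partition_weight alpha m (rows k) * pweight m 1 (L (rows k)) j * G k.
Proof.
move=> n0.
pose good k := (0 < rows k j)%N && sorted geq (parts (del_box j k)).
rewrite [LHS](bigID good) /= addrC big1 ?add0r; last first.
  move=> k /andP[/partitions_leP[p _] g].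
  rewrite /down_rate pweight_down_eq0 ?mulr0 ?mul0r // => -[k0 pd].
  case/negP: g; rewrite /good k0; apply/sorted_parts.
  by rewrite rows_del_box.
pose up k := (rows k j < n)%N && sorted geq (parts (add_box j k)).
rewrite [RHS](bigID up) /= [X in _ + X]big1 ?addr0; last first.
  move=> k /andP[/smaller_partitionP[p s] g].
  rewrite pweight_up_eq0 ?mulr0 ?mul0r // => pu.
  have kn : (rows k j < n)%N.
    apply: (@leq_ltn_trans n.-1); last by rewrite prednK.
    by rewrite -s (bigD1 j) //= leq_addr.
  case/negP: g; rewrite /up kn; apply/sorted_parts.
  by rewrite rows_add_box.
rewrite (reindex_onto (add_box j) (del_box j)) /=; last first.
  by move=> k /andP[_ /andP[k0 _]]; rewrite del_boxK.
apply: eq_big => [k|k].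
  apply/idP/idP.
    case/andP=> /andP[/partitions_leP[p s] /andP[k0 g]] /eqP e.
    have kn : (rows k j < n)%N.
      rewrite ltn_neqAle rows_le andbT; apply: contraTneq k0 => kn.
      by rewrite /add_box {1}/rows tnth_mktuple incr_id kn /inord /insubd insubF //= ltnn.
    move: p s g; rewrite rows_add_box // sum_incr add_boxK // => p s g.
    rewrite /up kn; apply/andP; split.
      by apply/smaller_partitionP; split; [exact/sorted_parts|rewrite -[X in _ = X.-1]s].
    by apply/sorted_parts; rewrite rows_add_box.
  case/andP=> /smaller_partitionP[p s] /andP[kn g].
  rewrite add_boxK // eqxx andbT; apply/andP; split.
    apply/partitions_leP; split; first exact/sorted_parts.
    by rewrite rows_add_box // sum_incr s prednK.
  rewrite /good rows_add_box // incr_id add_boxK //.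
  by apply/sorted_parts.
case/andP=> /andP[/partitions_leP[p s] /andP[k0 g]] /eqP e.
have kn : (rows k j < n)%N.
  rewrite ltn_neqAle rows_le andbT; apply: contraTneq k0 => kn.
  by rewrite /add_box {1}/rows tnth_mktuple incr_id kn /inord /insubd insubF //= ltnn.
rewrite add_boxK // rows_add_box // /down_rate detailed_balance //.
  by apply/sorted_parts; rewrite -(add_boxK m n j k kn).
by rewrite -rows_add_box.
Qed.

(** After [down_sum] the sum runs over the intermediate partition
    of [n - 1], where the two choices of rows are symmetric and the increment of [F]
    is antisymmetric. *)
Lemma chain_stationary (F : padded n m -> R) : (0 < n)%N ->
  \sum_(k in partitions_le n m) partition_weight alpha m (rows k) *
    \sum_(j < m) down_rate (rows k) j *
    \sum_(i < m) pweight m 1 (L (rows (del_box j k))) i *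
       (F (add_box i (del_box j k)) - F k) = 0.
Proof.
move=> n0.
pose G j k := \sum_(i < m) pweight m 1 (L (rows k)) i * (F (add_box i k) - F (add_box j k)).
transitivity (\sum_(j < m) \sum_(k in partitions_le n m)
     partition_weight alpha m (rows k) * down_rate (rows k) j * G j (del_box j k)).
  rewrite exchange_big /=; apply: eq_bigr => k /partitions_leP[pk _].
  rewrite mulr_sumr; apply: eq_bigr => j _; rewrite mulrA /G.
  have [k0|k0] := posnP (rows k j).
    by rewrite /down_rate pweight_down_eq0 ?mulr0 ?mul0r // k0 => -[].
  by rewrite del_boxK.
rewrite (eq_bigr _ (fun j _ => down_sum j (G j) n0)).
rewrite exchange_big /= big1 // => k _.
under eq_bigr do rewrite -mulrA.
rewrite -mulr_sumr /G; set s := \sum_(j < m) _.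
(* Exchanging the names of the two rows changes the sign of the sum. *)
suff : s = - s by move=> ss; rewrite (_ : s = 0) ?mulr0 //; lra.
rewrite /s; under eq_bigr do rewrite mulr_sumr.
rewrite [RHS](_ : _ = - \sum_(i < m) \sum_(j < m)
   pweight m 1 (L (rows k)) i * (pweight m 1 (L (rows k)) j * (F (add_box j k) - F (add_box i k)))).
  rewrite [in RHS]exchange_big -sumrN; apply: eq_bigr => j _.
  by rewrite -sumrN; apply: eq_bigr => i _; ring.
by congr (- _); apply: eq_bigr => i _; rewrite mulr_sumr.
Qed.

End Chain.

(** * Weights and eigenvalues of padded partitions *)

Section PaddedPartitions.
Context {R : realType} (alpha : R) (m n : nat).
Hypothesis alpha_gt0 : 0 < alpha.
Implicit Types (K : 'I_m -> nat) (k : padded n m).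
Local Notation L := (shifted alpha m).

Definition col K (b : nat) : nat := #|[set r : 'I_m | (b <= K r)%N]|.

Lemma card_ord_lt (c : nat) : (c <= m)%N -> #|[set r : 'I_m | (r < c)%N]| = c.
Proof.
move=> cm; rewrite -sum1_card.
under eq_bigl => r do rewrite inE.
by rewrite (big_ord_narrow cm) /= sum1_card card_ord.
Qed.

Lemma colP K b (r : 'I_m) : is_part m K -> (b <= K r)%N = (r < col K b)%N.
Proof.
move=> p; apply/idP/idP => [br|].
  rewrite -(card_ord_lt r.+1) ?ltn_ord //; apply/subset_leq_card/fintype.subsetP => s.
  by rewrite !inE ltnS => sr; rewrite (leq_trans br) // p.
apply: contraLR; rewrite -leqNgt -ltnNge => Kb.
rewrite -(card_ord_lt r) ?(ltnW (ltn_ord r)) //; apply/subset_leq_card/fintype.subsetP => s.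
by rewrite !inE => bs; rewrite ltnNge; apply: contraL bs => rs; rewrite -ltnNge (leq_ltn_trans _ Kb) // p.
Qed.

Lemma part_parts k (i : 'I_m) : part (parts k) i.+1 = rows m n k i.
Proof. exact: nth_parts. Qed.

Lemma rows_le_head k (i : 'I_m) : is_part m (rows m n k) ->
  (rows m n k i <= head 0 (parts k))%N.
Proof.
move=> p; rewrite -nth0.
have m0 : (0 < m)%N by rewrite (leq_ltn_trans _ (ltn_ord i)).
by rewrite (nth_parts m n k (Ordinal m0)); apply: p.
Qed.

Lemma count_parts k b : count (leq b) (parts k) = col (rows m n k) b.
Proof.
rewrite /parts count_map -sum1_count big_tuple /col -sum1_card.
by apply: eq_bigl => r; rewrite inE.
Qed.

Lemma part_conj k (i : 'I_m) b : is_part m (rows m n k) -> (b < rows m n k i)%N ->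
  part (conj_part (parts k)) b.+1 = col (rows m n k) b.+1.
Proof.
move=> p bi; rewrite /part /conj_part nth_mkseq ?count_parts //=.
exact: (leq_trans bi (rows_le_head _ _ p)).
Qed.

Definition box_prod tau (k : seq nat) : R :=
  \prod_(1 <= i < (size k).+1) \prod_(1 <= j < (part k i).+1)
    (alpha * (part k i - j)%:R + (part (conj_part k) j - i)%:R + tau).

Lemma hook_row_rev tau x :
  hook_row alpha tau x = \prod_(1 <= b < x.+1) (alpha * (x%:R - b%:R) + tau).
Proof.
rewrite big_add1 /= /hook_row big_nat_rev /=; apply: eq_big_nat => b /andP[_ bx].
by rewrite add0n natrB.
Qed.

(** The corrections of the rows that reach below a given box
    telescope to the leg of that box. *)
Lemma leg_telescope (c : nat) (y : R) tau (i : 'I_m) : 0 <= y -> 0 < tau ->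
  (i < c)%N -> (c <= m)%N ->
  (y + tau) * \prod_(r < m | (i < r)%N && (r < c)%N)
     ((y + (r - i)%:R + tau) / (y + (r - i)%:R - 1 + tau)) =
  y + (c - i.+1)%:R + tau.
Proof.
move=> y0 t0 ic cm.
rewrite (big_ord_narrow_cond cm) /=.
have := telescope_shift 1 c ltr01 0 (y + tau) (Ordinal ic).
rewrite !mul1r !add0r /= => /(_ (ltr_wpDl y0 t0)) E.
rewrite [X in _ * X](_ : _ = (c%:R - i%:R - 1 + (y + tau)) / (y + tau)).
  rewrite natrB // -natr1 mulrC divfK ?gt_eqF ?ltr_wpDl //; ring.
rewrite -E; apply: eq_bigr => r _; congr (_ / _); ring.
Qed.

(** Exchanging the product over boxes of a row with the product over
    lower rows turns legs into the pair corrections. *)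
Lemma box_prodE tau k : 0 < tau -> is_part m (rows m n k) ->
  box_prod tau (parts k) = hook_prod alpha m tau (rows m n k).
Proof.
move=> t0 p; rewrite /box_prod big_add1 /= size_map size_tuple big_mkord.
set K := rows m n k in p *.
apply: eq_bigr => i _; rewrite part_parts -/K hook_row_rev.
have -> : \prod_(r < m | (i < r)%N) hook_pair alpha tau (K i) (K r) (r - i) =
  \prod_(1 <= b < (K i).+1) \prod_(r < m | (i < r)%N && (r < col K b)%N)
    ((alpha * ((K i)%:R - b%:R) + (r - i)%:R + tau) /
     (alpha * ((K i)%:R - b%:R) + (r - i)%:R - 1 + tau)).
  rewrite [RHS](exchange_big_dep (fun r : 'I_m => (i < r)%N)) /=; last first.
    by move=> b r _ /andP[].
  apply: eq_bigr => r ir; rewrite /hook_pair ir /=.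
  rewrite [LHS](big_nat_widen _ _ (K i).+1) ?ltnS; last exact/p/ltnW.
  by apply: eq_bigl => b /=; rewrite ltnS colP.
rewrite -big_split /=; apply: eq_big_nat => b /andP[b1]; rewrite ltnS => bi.
rewrite leg_telescope //.
- by case: b b1 bi => // b _ bi; rewrite natrB // (part_conj k i).
- by rewrite mulr_ge0 ?(ltW alpha_gt0) // subr_ge0 ler_nat.
- by rewrite -colP.
- by rewrite (leq_trans (max_card _)) // card_ord.
Qed.

Lemma jack_weightE k : is_part m (rows m n k) ->
  jack_weight alpha (parts k) = partition_weight alpha m (rows m n k).
Proof. by move=> p; rewrite /partition_weight -!box_prodE. Qed.

Lemma sum_iota (x : nat) : 2 * (\sum_(0 <= b < x) b)%:R = x%:R * (x%:R - 1) :> R.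
Proof.
elim: x => [|x IH]; first by rewrite big_geq // mul0r mulr0.
by rewrite big_nat_recr //= natrD mulrDr IH -natr1; ring.
Qed.

Lemma a_stat_parts k : a_stat (parts k) = (\sum_(i < m) i * rows m n k i)%N.
Proof.
rewrite /a_stat big_add1 /= size_map size_tuple big_mkord.
by apply: eq_bigr => i _; rewrite part_parts.
Qed.

Lemma a_stat_conj k : is_part m (rows m n k) ->
  a_stat (conj_part (parts k)) = (\sum_(i < m) \sum_(0 <= b < rows m n k i) b)%N.
Proof.
move=> p; rewrite /a_stat big_add1 /= size_mkseq.
transitivity (\sum_(0 <= b < head 0 (parts k)) \sum_(i < m | b < rows m n k i) b)%N.
  apply: eq_big_nat => b /andP[_ bh]; rewrite sum_nat_const mulnC; congr (_ * _)%N.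
  rewrite /part nth_mkseq // count_parts /col; apply: eq_card => r.
  by rewrite inE.
rewrite (exchange_big_dep xpredT) //=; apply: eq_bigr => i _.
by rewrite [RHS](big_nat_widen _ _ (head 0 (parts k))) ?rows_le_head.
Qed.

Definition mean (x : 'I_m -> R) : R := (\sum_i x i) / m%:R.

(** The sum of squared deviations; unlike the sum of squares it does not
    grow deterministically with [n]. *)
Definition spread (x : 'I_m -> R) : R := \sum_i (x i - mean x) ^+ 2.

Lemma spreadE (x : 'I_m -> R) : (0 < m)%N ->
  spread x = \sum_i x i ^+ 2 - (\sum_i x i) ^+ 2 / m%:R.
Proof.
move=> m0; have mr : m%:R != 0 :> R by rewrite pnatr_eq0 -lt0n.
transitivity (\sum_i (x i ^+ 2 - 2 * mean x * x i + mean x ^+ 2)).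
  by apply: eq_bigr => i _; ring.
rewrite big_split /= sumrB sumr_const card_ord -mulr_sumr -mulr_natr /mean.
by field.
Qed.

Lemma sum_shifted K :
  \sum_i L K i = alpha * (\sum_i K i)%N%:R + \sum_(i < m) (m%:R - i%:R - 1).
Proof. by rewrite big_split /= -mulr_sumr natr_sum. Qed.

Lemma sum_rho : 2 * \sum_(i < m) (m%:R - i%:R - 1) = m%:R * (m%:R - 1) :> R.
Proof.
rewrite -sum_iota; congr (_ * _); rewrite big_mkord natr_sum (reindex_inj rev_ord_inj) /=.
by apply: eq_bigr => i _; rewrite natrB // -natr1; ring.
Qed.

(** Both sides are polynomials in the power sums of the shifted rows;
    the centring and the scaling of the statistic remove exactly the part that
    depends on [n] only.  The last term is the value at the empty shape. *)
Lemma eigenvalueE k : k \in partitions_le n m -> (0 < n)%N -> (0 < m)%N ->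
  (jack_eigenvalue alpha n m (parts k) -
    ((m%:R - alpha - 1) / 2 * n%:R + alpha / (2 * m%:R) * n%:R ^+ 2)) /
  (n%:R / (2 * m%:R)) =
  m%:R / (alpha * n%:R) * spread (L (rows m n k))
  - m%:R / (alpha * n%:R) * spread (L (fun=> 0%N)).
Proof.
move=> /partitions_leP[p s] n0 m0.
rewrite -mulrBr !spreadE //.
have mr : m%:R != 0 :> R by rewrite pnatr_eq0 -lt0n.
have nr : n%:R != 0 :> R by rewrite pnatr_eq0 -lt0n.
have ar : alpha != 0 by rewrite gt_eqF.
rewrite !sum_shifted s /= big1_eq mulr0 add0r.
have E2 : 2 * alpha * jack_eigenvalue alpha n m (parts k) =
   \sum_i L (rows m n k) i ^+ 2 - \sum_i L (fun=> 0%N) i ^+ 2 - alpha ^+ 2 * n%:R.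
  rewrite /jack_eigenvalue a_stat_parts a_stat_conj //.
  have -> : n%:R = \sum_i (rows m n k i)%:R :> R by rewrite -natr_sum s.
  rewrite !natr_sum.
  rewrite mulrBr mulrDr !mulr_suml !mulr_sumr -big_split -!sumrB /=.
  apply: eq_bigr => i _; rewrite /shifted mulr0 natrM.
  have := sum_iota (rows m n k i); set S := (\sum_(_ <= _ < _) _)%N%:R => SE.
  have -> : S = (rows m n k i)%:R * ((rows m n k i)%:R - 1) / 2 by rewrite -SE; field.
  by field.
have E1 : \sum_(i < m) (m%:R - i%:R - 1) = m%:R * (m%:R - 1) / 2 :> R.
  by rewrite -sum_rho; field.
have {E2}-> : jack_eigenvalue alpha n m (parts k) = (\sum_i L (rows m n k) i ^+ 2 - \sum_i L (fun=> 0%N) i ^+ 2 - alpha ^+ 2 * n%:R) / (2 * alpha).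
  by rewrite -E2; field.
rewrite E1; field; by rewrite ar mr nr.
Qed.

End PaddedPartitions.

(** * Conditional moments of one move *)

Section LagrangeFun.
Context {R : realType} (m : nat).
Implicit Types (x : 'I_m -> R) (th c : R).

Lemma pweight_pfrac th x j : injective x ->
  pweight m th x j = pfrac th (x j) [seq x i | i <- enum 'I_m].
Proof.
move=> xi; rewrite /pfrac big_map /pweight big_enum_cond.
by apply: eq_bigl => r; rewrite (inj_eq xi).
Qed.

Lemma uniq_values x : injective x -> uniq [seq x i | i <- enum 'I_m].
Proof. by move=> xi; rewrite map_inj_uniq // enum_uniq. Qed.

Lemma pweight_sum (g : R -> R) th x : injective x ->
  \sum_j pweight m th x j * g (x j) =
  \sum_(y <- [seq x i | i <- enum 'I_m]) pfrac th y [seq x i | i <- enum 'I_m] * g y.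
Proof.
move=> xi; rewrite big_map big_enum.
by apply: eq_bigr => j _; rewrite pweight_pfrac.
Qed.

Lemma pweight_sum0 th x : injective x -> \sum_j pweight m th x j = m%:R.
Proof.
move=> xi; transitivity (\sum_j pweight m th x j * 1).
  by apply: eq_bigr => j _; rewrite mulr1.
rewrite (pweight_sum (fun=> 1)) // -mulr_suml mulr1 pfrac_sum0 ?uniq_values //.
by rewrite size_map size_enum_ord.
Qed.

Lemma pweight_sum1 th x : injective x ->
  \sum_j pweight m th x j * x j = \sum_j x j + th * 'C(m, 2)%:R.
Proof.
move=> xi; rewrite (pweight_sum id) // pfrac_sum1 ?uniq_values //.
by rewrite size_map size_enum_ord big_map big_enum.
Qed.

Lemma pweight_sum2 th x : injective x ->
  \sum_j pweight m th x j * x j ^+ 2 =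
  \sum_j x j ^+ 2 + th * (m%:R - 1) * \sum_j x j + th ^+ 2 * 'C(m, 3)%:R.
Proof.
move=> xi; rewrite (pweight_sum (fun y => y ^+ 2)) // pfrac_sum2 ?uniq_values //.
by rewrite size_map size_enum_ord (big_map x xpredT (fun y => y ^+ 2)) (big_map x xpredT id) !big_enum.
Qed.

Lemma pweight_shift th c x j : pweight m th (fun i => x i - c) j = pweight m th x j.
Proof. by apply: eq_bigr => r _; rewrite opprB addrA subrK. Qed.

Lemma shift_inj c x : injective x -> injective (fun i => x i - c).
Proof. by move=> xi i j /addIr /xi. Qed.
End LagrangeFun.

Section Estimates.
Context {R : realType} (alpha : R) (m : nat).
Hypothesis alpha_gt0 : 0 < alpha.
Hypothesis m_gt0 : (0 < m)%N.
Local Notation L := (shifted alpha m).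
Local Notation C2 := ('C(m, 2)%:R : R).
Local Notation C3 := ('C(m, 3)%:R : R).
Implicit Type K : 'I_m -> nat.

Definition deviation K j : R := L K j - mean m (L K).
Definition row_spread K : R := spread m (L K).

(** Moving a box from row [j] to row [i] changes the eigenvalue by this
    difference, taken in the shape that lacks the box; it is zero for [i = j]. *)
Definition row_jump K j i : R := L (decr m K j) i - L (decr m K j) j.
Definition up_rate K j i : R := pweight m 1 (L (decr m K j)) i.
Definition down_weight K j : R := pweight m (-1) (L K) j.

Lemma m_neq0 : m%:R != 0 :> R.
Proof. by rewrite pnatr_eq0 -lt0n. Qed.

Lemma bin2R : C2 = m%:R * (m%:R - 1) / 2.
Proof.
rewrite -sum_iota mulrC mulKf ?pnatr_eq0 //; congr (_%:R).
by rewrite -bin2_sum.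
Qed.

Lemma shifted_inj K : is_part m K -> injective (L K).
Proof.
move=> p i r e; apply/eqP; rewrite -val_eqE /=; apply: contra_eqT e => ne.
have [ir|ri] : (i < r)%N \/ (r < i)%N by move: ne; lia.
  by have := shifted_gap alpha m alpha_gt0 K _ _ p ir; case: eqP => // ->; lra.
by have := shifted_gap alpha m alpha_gt0 K _ _ p ri; case: eqP => // ->; lra.
Qed.

Lemma shifted_decr K j i : (0 < K j)%N ->
  L (decr m K j) i = L K i - unit_vec alpha m j i.
Proof.
by move=> Kj; rewrite -[in RHS](decrK m K j Kj) shifted_incr // addrK.
Qed.

Lemma sum_dev K : \sum_j deviation K j = 0.
Proof.
rewrite /deviation sumrB sumr_const card_ord -[mean _ _ *+ _]mulr_natr /mean divfK ?subrr //.
exact: m_neq0.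
Qed.

Lemma sum_dev2 K : \sum_j deviation K j ^+ 2 = row_spread K.
Proof. by []. Qed.

Lemma down_sum0 K : is_part m K -> \sum_j down_weight K j = m%:R.
Proof. by move=> p; apply: pweight_sum0; apply: shifted_inj. Qed.

(** Centring makes the power sum vanish, so only the correction of order
    1 survives. *)
Lemma down_sum1 K : is_part m K -> \sum_j down_weight K j * deviation K j = - C2.
Proof.
move=> p; have xi := shift_inj m (mean m (L K)) _ (shifted_inj K p).
transitivity (\sum_j pweight m (-1) (deviation K) j * deviation K j).
  by apply: eq_bigr => j _; rewrite /down_weight -(pweight_shift m _ (mean m (L K)) (L K)).
by rewrite pweight_sum1 // sum_dev add0r mulN1r.
Qed.

Lemma down_sum2 K : is_part m K -> \sum_j down_weight K j * deviation K j ^+ 2 = row_spread K + C3.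
Proof.
move=> p; have xi := shift_inj m (mean m (L K)) _ (shifted_inj K p).
transitivity (\sum_j pweight m (-1) (deviation K) j * deviation K j ^+ 2).
  by apply: eq_bigr => j _; rewrite /down_weight -(pweight_shift m _ (mean m (L K)) (L K)).
by rewrite pweight_sum2 // sum_dev mulr0 addr0 sqrrN expr1n mul1r.
Qed.

Section UpSums.
Variables (K : 'I_m -> nat) (j : 'I_m).
Hypotheses (Kj : (0 < K j)%N) (pd : is_part m (decr m K j)).
Let y i := L (decr m K j) i - mean m (L K).

Let yE i : y i = deviation K i - unit_vec alpha m j i.
Proof. by rewrite /y shifted_decr // /deviation; ring. Qed.

Let sum_unit (f : 'I_m -> R) : \sum_i f i * unit_vec alpha m j i = f j * alpha.
Proof.
rewrite (bigD1 j) //= unit_vec_id big1 ?addr0 // => i ij.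
by rewrite unit_vec_neq // mulr0.
Qed.

Let sum_y : \sum_i y i = - alpha.
Proof.
under eq_bigr do rewrite yE -[unit_vec _ _ _ _]mul1r.
by rewrite sumrB sum_dev (sum_unit (fun=> 1)) mul1r sub0r.
Qed.

Let sum_y2 : \sum_i y i ^+ 2 = row_spread K - 2 * alpha * deviation K j + alpha ^+ 2.
Proof.
transitivity (\sum_i (deviation K i ^+ 2 - (2 * deviation K i - unit_vec alpha m j i) * unit_vec alpha m j i)).
  by apply: eq_bigr => i _; rewrite yE; ring.
rewrite sumrB sum_dev2 (sum_unit (fun i => 2 * deviation K i - unit_vec alpha m j i)) unit_vec_id.
ring.
Qed.

Let y_inj : injective y. Proof. exact/shift_inj/shifted_inj. Qed.
Let upE i : up_rate K j i = pweight m 1 y i.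
Proof. by rewrite /y pweight_shift. Qed.
Let jumpE i : row_jump K j i = y i - (deviation K j - alpha).
Proof.
have -> : deviation K j - alpha = y j by rewrite yE unit_vec_id.
by rewrite /row_jump /y; ring.
Qed.

(** The mean jump depends only on the row that lost the box; this is the
    reason for removing before adding. *)
Lemma up_sum1 : \sum_i up_rate K j i * row_jump K j i =
  alpha * (m%:R - 1) + C2 - m%:R * deviation K j.
Proof.
under eq_bigr do rewrite upE jumpE mulrBr.
by rewrite sumrB -mulr_suml pweight_sum0 // pweight_sum1 // sum_y; ring.
Qed.

Lemma up_sum2 : \sum_i up_rate K j i * row_jump K j i ^+ 2 =
  row_spread K + m%:R * deviation K j ^+ 2 +
  (alpha ^+ 2 - alpha * (m%:R - 1) + C3 + 2 * alpha * (C2 - alpha) + m%:R * alpha ^+ 2) +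
  (- 2 * C2 - 2 * m%:R * alpha) * deviation K j.
Proof.
transitivity (\sum_i (pweight m 1 y i * y i ^+ 2
   - 2 * (deviation K j - alpha) * (pweight m 1 y i * y i)
   + (deviation K j - alpha) ^+ 2 * pweight m 1 y i)).
  by apply: eq_bigr => i _; rewrite upE jumpE; ring.
rewrite big_split sumrB /= -!mulr_sumr pweight_sum0 // pweight_sum1 // pweight_sum2 //.
by rewrite sum_y sum_y2; ring.
Qed.

(** The sum of the shifted rows is preserved, so only the sum of
    squares changes. *)
Lemma spread_move i : row_spread (incr m (decr m K j) i) = row_spread K + 2 * alpha * row_jump K j i.
Proof.
have sumL (f : 'I_m -> nat) r : \sum_s L (incr m f r) s = \sum_s L f s + alpha.
  by rewrite !sum_shifted sum_incr -natr1; ring.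
have sum2L (f : 'I_m -> nat) r :
    \sum_s L (incr m f r) s ^+ 2 = \sum_s L f s ^+ 2 + 2 * alpha * L f r + alpha ^+ 2.
  rewrite (bigD1 r) //= [in RHS](bigD1 r) //= shifted_incr unit_vec_id.
  rewrite (eq_bigr (fun s => L f s ^+ 2)); first by ring.
  by move=> s sr; rewrite shifted_incr unit_vec_neq // addr0.
rewrite /row_spread !spreadE // -{3 4}(decrK m K j Kj) !sumL !sum2L /row_jump.
by ring.
Qed.
End UpSums.
End Estimates.

(** * Deterministic bounds on rates and jumps *)

Section Bounds.
Context {R : realType} (alpha : R) (m : nat).
Hypothesis alpha_gt0 : 0 < alpha.
Hypothesis m_gt0 : (0 < m)%N.
Local Notation L := (shifted alpha m).
Local Notation C2 := ('C(m, 2)%:R : R).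
Local Notation C3 := ('C(m, 3)%:R : R).
Implicit Type K : 'I_m -> nat.
Local Notation dev := (deviation alpha m).
Local Notation Y := (row_spread alpha m).
Local Notation rate := (down_rate alpha m).
Local Notation up := (up_rate alpha m).
Local Notation jump := (row_jump alpha m).
Local Notation down_w := (down_weight alpha m).

(** [chain_drift], [chain_diffusion] and [chain_cubic] are the mean, the
    mean square and the mean absolute cube of the jump under the rates of the
    chain. *)
Definition chain_drift K : R := \sum_j rate K j * \sum_i up K j i * jump K j i.
Definition chain_diffusion K : R := \sum_j rate K j * \sum_i up K j i * jump K j i ^+ 2.
Definition chain_cubic K : R := \sum_j rate K j * \sum_i up K j i * `|jump K j i| ^+ 3.

(** A bound for every deviation that is also at least the square root
    of [n]; all error terms below are powers of it, which saves a separate treatment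
    of typical and atypical shapes. *)
Definition fluct_scale K : R := Num.sqrt (Y K + (\sum_i K i)%N%:R).

Lemma row_spread_ge0 K : 0 <= Y K.
Proof. by apply: sumr_ge0 => i _; exact: sqr_ge0. Qed.

(** At a nonempty row [quad] is nonnegative; at an empty row its sign
    depends on [alpha], but there the rate is zero. *)
Lemma rate_cases K j : is_part m K ->
  rate K j = 0 \/ [/\ (0 < K j)%N, is_part m (decr m K j) & 0 <= quad alpha (L K j)].
Proof.
move=> p; have a0 := alpha_gt0.
have [[Kj pd]|ng] := EM ((0 < K j)%N /\ is_part m (decr m K j)); last first.
  by left; apply: pweight_down_eq0.
right; split=> //; have : alpha <= L K j.
  rewrite /shifted.
  have : 1 <= (K j)%:R :> R by rewrite ler1n.
  have : (j%:R + 1 <= m%:R :> R) by rewrite natr1 ler_nat.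
  by move=> h1 h2; nra.
by move=> h; rewrite /quad mulr_ge0 //; lra.
Qed.

Lemma drift_eq K : is_part m K ->
  chain_drift K = \sum_j rate K j * (alpha * (m%:R - 1) + C2 - m%:R * dev K j).
Proof.
move=> p; apply: eq_bigr => j _.
have [->|[Kj pd _]] := rate_cases K j p; first by rewrite !mul0r.
by rewrite up_sum1.
Qed.

(** [tau0] and [tau1] collect the lower-order terms of [up_sum2]. *)
Definition tau0 : R :=
  alpha ^+ 2 - alpha * (m%:R - 1) + C3 + 2 * alpha * (C2 - alpha) + m%:R * alpha ^+ 2.
Definition tau1 : R := - 2 * C2 - 2 * m%:R * alpha.

Lemma diffusion_eq K : is_part m K ->
  chain_diffusion K = \sum_j rate K j * (Y K + m%:R * dev K j ^+ 2 + tau0 + tau1 * dev K j).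
Proof.
move=> p; apply: eq_bigr => j _.
have [->|[Kj pd _]] := rate_cases K j p; first by rewrite !mul0r.
by rewrite up_sum2.
Qed.

Section OneShape.
Variables (n : nat) (K : 'I_m -> nat).
Hypotheses (n_gt0 : (0 < n)%N) (pK : is_part m K) (sK : (\sum_i K i = n)%N).

Let N1 : 1 <= n%:R :> R. Proof. by rewrite ler1n. Qed.
Let M1 : 1 <= m%:R :> R. Proof. by rewrite ler1n. Qed.

Lemma meanE : mean m (L K) = alpha / m%:R * n%:R + (m%:R - 1) / 2.
Proof.
rewrite /mean sum_shifted sK.
have -> : \sum_(i < m) (m%:R - i%:R - 1) = m%:R * (m%:R - 1) / 2 :> R.
  by rewrite -sum_rho; field.
by field; apply: m_neq0.
Qed.

Lemma L_le j : L K j <= (alpha + m%:R) * n%:R.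
Proof.
have a0 := alpha_gt0; have n1 := N1; have m1 := M1.
rewrite /shifted.
have h1 : (K j)%:R <= n%:R :> R by rewrite ler_nat -sK (bigD1 j) //= leq_addr.
have : 0 <= j%:R :> R by [].
have : alpha * (K j)%:R <= alpha * n%:R by rewrite ler_wpM2l // ltW.
have : m%:R * 1 <= m%:R * n%:R :> R by rewrite ler_wpM2l.
lra.
Qed.

Lemma mean_bounds : 0 <= mean m (L K) <= (alpha + m%:R) * n%:R.
Proof.
apply/andP; split.
  by rewrite divr_ge0 // sumr_ge0 // => i _; exact: shifted_ge0.
rewrite /mean ler_pdivrMr ?ltr0n //.
apply: le_trans; first by apply: ler_sum => j _; exact: L_le.
by rewrite sumr_const card_ord -[leLHS]mulr_natr.
Qed.

Lemma dev_le_n j : `|dev K j| <= (alpha + m%:R) * n%:R.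
Proof.
have := mean_bounds; have := L_le j; have := shifted_ge0 alpha m alpha_gt0 K j.
rewrite /deviation ler_norml; lra.
Qed.

Lemma scale2 : fluct_scale K ^+ 2 = Y K + n%:R.
Proof. by rewrite sqr_sqrtr ?sK // addr_ge0 // row_spread_ge0. Qed.

Lemma scale_ge1 : 1 <= fluct_scale K.
Proof.
rewrite /fluct_scale -[leLHS]sqrtr1 ler_sqrt sK; last by rewrite addr_ge0 // row_spread_ge0.
by rewrite (le_trans N1) // lerDr row_spread_ge0.
Qed.

Lemma dev_le_scale j : `|dev K j| <= fluct_scale K.
Proof.
rewrite -sqrtr_sqr /fluct_scale ler_sqrt ?addr_ge0 ?row_spread_ge0 //.
rewrite -sum_dev2 (bigD1 j) //= -addrA lerDl addr_ge0 // sumr_ge0 // => i _.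
exact: sqr_ge0.
Qed.

Lemma rate_bounds j :
  0 <= rate K j <= 2 ^+ m * ((alpha + m%:R) * (alpha + m%:R + 1)) * n%:R ^+ 2.
Proof.
have a0 := alpha_gt0; have n1 := N1; have m1 := M1.
have B0 : 0 <= (alpha + m%:R) * (alpha + m%:R + 1) * n%:R ^+ 2.
  by rewrite !mulr_ge0 //; lra.
rewrite -mulrA.
have [->|[_ _ q0]] := rate_cases K j pK; first by rewrite lexx mulr_ge0.
have /andP[v0 v1] : 0 <= down_w K j <= 2 ^+ m.
  by apply: pweight_bound => //; right.
rewrite /down_rate mulr_ge0 //= ler_pM //.
have := shifted_ge0 alpha m alpha_gt0 K j; have := L_le j.
rewrite /quad in q0 *; move: q0; move: (L K j) => l q0 l1 l0.
by nra.
Qed.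

Lemma up_bounds j i : rate K j = 0 \/ 0 <= up K j i <= 2 ^+ m.
Proof.
have [->|[Kj pd _]] := rate_cases K j pK; first by left.
by right; apply: pweight_bound => //; left.
Qed.

Lemma jump_bounds j i : rate K j = 0 \/
  (`|jump K j i| <= 2 * (1 + alpha) * fluct_scale K /\
   `|jump K j i| <= 2 * (alpha + m%:R + alpha) * n%:R).
Proof.
have a0 := alpha_gt0; have n1 := N1; have m1 := M1.
have [->|[Kj pd _]] := rate_cases K j pK; first by left.
right.
have -> : jump K j i = dev K i - dev K j + (alpha - unit_vec alpha m j i).
  by rewrite /row_jump /deviation !shifted_decr // unit_vec_id; ring.
have u : `|alpha - unit_vec alpha m j i| <= alpha.
  rewrite /unit_vec; case: eqP => _; rewrite ?mul1r ?mul0r ?subrr ?subr0 ?normr0 ?ger0_norm //; exact: ltW.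
have := scale_ge1; have := dev_le_scale i; have := dev_le_scale j.
have := dev_le_n i; have := dev_le_n j.
have := ler_normD (dev K i - dev K j) (alpha - unit_vec alpha m j i).
have := ler_normB (dev K i) (dev K j).
move: (`|dev K i|) (`|dev K j|) => di dj h1 h2 h3 h4 h5 h6 h7.
split; nra.
Qed.

End OneShape.
End Bounds.

(** * Drift of the spread *)

Section Drift.
Context {R : realType} (alpha : R) (m : nat).
Hypothesis alpha_gt0 : 0 < alpha.
Hypothesis m_gt0 : (0 < m)%N.
Local Notation L := (shifted alpha m).
Local Notation C2 := ('C(m, 2)%:R : R).
Local Notation C3 := ('C(m, 3)%:R : R).
Implicit Type K : 'I_m -> nat.
Local Notation dev := (deviation alpha m).
Local Notation Y := (row_spread alpha m).
Local Notation down_w := (down_weight alpha m).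
Local Notation drift := (chain_drift alpha m).
Local Notation scale := (fluct_scale alpha m).

Let a : R := alpha / m%:R.
Let e : R := (m%:R - 1) / 2.
Let d : R := 2 * e + 1 - alpha.
Let c2 : R := alpha * (m%:R - 1) + C2.

Lemma quad_dev n K j : (\sum_i K i = n)%N ->
  quad alpha (L K j) = (a * n%:R + e) * (a * n%:R + e + 1 - alpha)
    + (2 * a * n%:R + d) * dev K j + dev K j ^+ 2.
Proof.
move=> s; have := meanE alpha m m_gt0 n K s.
rewrite /deviation /quad -/a -/e => ->; rewrite /d; ring.
Qed.

Lemma down_weight_bounds K j : is_part m K -> 0 <= down_w K j <= 2 ^+ m.
Proof. by move=> p; apply: pweight_bound => //; right. Qed.

Lemma down_cubic_bound n K : (0 < n)%N -> is_part m K -> (\sum_i K i = n)%N ->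
  `|\sum_j down_w K j * dev K j ^+ 3| <= m%:R * 2 ^+ m * scale K ^+ 3.
Proof.
move=> n0 p s; apply: le_trans (ler_norm_sum _ _ _) _.
have -> : m%:R * 2 ^+ m * scale K ^+ 3 = \sum_(j < m) 2 ^+ m * scale K ^+ 3.
  by rewrite sumr_const card_ord -mulrA -[RHS]mulr_natl.
apply: ler_sum => j _; have /andP[w0 w1] := down_weight_bounds _ j p.
rewrite normrM ger0_norm // ler_pM // normrX lerXn2r ?nnegrE //.
  by rewrite sqrtr_ge0.
exact: dev_le_scale.
Qed.

(** Removal weights integrate cubic polynomials of the deviation exactly
    except for the cubic moment, which has no closed form in [Y]. *)
Lemma cubic_sum K f0 f1 f2 f3 : is_part m K ->
  \sum_j down_w K j * (f0 + f1 * dev K j + f2 * dev K j ^+ 2 + f3 * dev K j ^+ 3) =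
  f0 * m%:R - f1 * C2 + f2 * (Y K + C3) + f3 * \sum_j down_w K j * dev K j ^+ 3.
Proof.
move=> p; rewrite -(down_sum2 alpha m alpha_gt0 m_gt0) //.
rewrite -(down_sum0 alpha m alpha_gt0 m_gt0 K p).
rewrite -[C2]opprK -(down_sum1 alpha m alpha_gt0 m_gt0 K p).
rewrite mulrN opprK !mulr_sumr -!big_split /=; apply: eq_bigr => j _; ring.
Qed.

Let q0 (n : nat) : R := (a * n%:R + e) * (a * n%:R + e + 1 - alpha).
Let q1 (n : nat) : R := 2 * a * n%:R + d.

Lemma drift_expand n K : is_part m K -> (\sum_i K i = n)%N ->
  drift K = c2 * q0 n * m%:R - (c2 * q1 n - m%:R * q0 n) * C2
    + (c2 - m%:R * q1 n) * (Y K + C3)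
    - m%:R * \sum_j down_w K j * dev K j ^+ 3.
Proof.
move=> p s; rewrite drift_eq // -/c2.
rewrite -(mulNr m%:R (\sum_j _)) -cubic_sum //; apply: eq_bigr => j _.
rewrite /down_rate -/(down_weight _ _ _ _) (quad_dev n) // -/(q0 n) -/(q1 n); ring.
Qed.

Let k0 : R := m%:R * (c2 + C2) * e * (e + 1 - alpha)
  - (c2 * C2 + m%:R * C3) * d + c2 * C3.
Let k1 : R := m%:R * (c2 + C2) * a * d - 2 * a * (c2 * C2 + m%:R * C3).
Let k2 : R := c2 - m%:R * d.

(** The terms of order [n^2] and [n Y] are the announced ones; what is
    left is affine in [n] and [Y], plus the cubic moment. *)
Lemma drift_decomp n K : is_part m K -> (\sum_i K i = n)%N ->
  drift K - (alpha ^+ 2 / m%:R * ((m%:R - 1) * (alpha + m%:R)) * n%:R ^+ 2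
             - 2 * alpha * n%:R * Y K) =
  k0 + k1 * n%:R + k2 * Y K - m%:R * \sum_j down_w K j * dev K j ^+ 3.
Proof.
move=> p s; rewrite (drift_expand n) //.
have -> : (m%:R - 1) * (alpha + m%:R) = c2 + C2 by rewrite /c2 bin2R; field.
have m0 := m_neq0 m m_gt0 : m%:R != 0 :> R.
by rewrite /q0 /q1 /k0 /k1 /k2 /d /a; field.
Qed.

Lemma drift_approx : exists2 C : R, 0 <= C & forall n K, (0 < n)%N ->
  is_part m K -> (\sum_i K i = n)%N ->
  `|drift K - (alpha ^+ 2 / m%:R * ((m%:R - 1) * (alpha + m%:R)) * n%:R ^+ 2
               - 2 * alpha * n%:R * Y K)| <= C * scale K ^+ 3.
Proof.
exists (`|k0| + `|k1| + `|k2| + m%:R * (m%:R * 2 ^+ m)).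
  by rewrite !addr_ge0 // !mulr_ge0 // exprn_ge0.
move=> n K n0 p s; rewrite drift_decomp //.
have r1 := scale_ge1 alpha m n K n0 s.
have r2 := scale2 alpha m n K s.
have Y0 := row_spread_ge0 alpha m K.
have N0 : 0 <= n%:R :> R by [].
have S3 := down_cubic_bound n K n0 p s.
have r23 : scale K ^+ 2 <= scale K ^+ 3 by rewrite ler_weXn2l.
have r13 : 1 <= scale K ^+ 3 by rewrite exprn_ege1.
apply: le_trans (ler_normB _ _) _; rewrite [leRHS]mulrDl; apply: lerD; last first.
  by rewrite normrM ger0_norm // -mulrA ler_wpM2l.
apply: le_trans (ler_normD _ _) _; rewrite [leRHS]mulrDl; apply: lerD; last first.
  by rewrite normrM [`|Y K|]ger0_norm // ler_wpM2l //; lra.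
apply: le_trans (ler_normD _ _) _; rewrite [leRHS]mulrDl; apply: lerD; last first.
  by rewrite normrM [`|n%:R|]ger0_norm // ler_wpM2l //; lra.
by rewrite ler_peMr.
Qed.

(** The cubic moment cannot be neglected for atypical shapes, but it has
    a sign: a deviation is at least minus the mean, so the cubic term takes away at
    most half of the restoring force [2 alpha n Y]. *)
Lemma drift_upper : exists C k : R, [/\ 0 <= C, 0 <= k & forall n K, (0 < n)%N ->
  is_part m K -> (\sum_i K i = n)%N ->
  drift K <= C * n%:R ^+ 2 + k * Y K - alpha * n%:R * Y K].
Proof.
pose h0 : R := m%:R * (c2 + C2) * e * (e + 1 - alpha) - c2 * C2 * d
  + (c2 - m%:R * (e + 1 - alpha)) * C3.
pose h1 : R := m%:R * (c2 + C2) * a * d - 2 * a * c2 * C2 - alpha * C3.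
pose h2 : R := m%:R * (c2 + C2) * a ^+ 2.
pose h3 : R := c2 - m%:R * (e + 1 - alpha).
exists (`|h0| + `|h1| + `|h2|), `|h3|; split; rewrite ?addr_ge0 //.
move=> n K n0 p s.
have Y0 := row_spread_ge0 alpha m K.
have N1 : 1 <= n%:R :> R by rewrite ler1n.
have N2 : n%:R <= n%:R ^+ 2 :> R by rewrite -[leLHS]expr1 ler_weXn2l.
(* Shifted rows are nonnegative, so a deviation is at least minus the mean. *)
have tail : (a * n%:R + e + 1 - alpha) * (Y K + C3) <=
    q1 n * (Y K + C3) + \sum_j down_w K j * dev K j ^+ 3.
  have -> : q1 n * (Y K + C3) + \sum_j down_w K j * dev K j ^+ 3 =
     \sum_j down_w K j * (dev K j ^+ 2 * (q1 n + dev K j)).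
    rewrite -(down_sum2 alpha m alpha_gt0 m_gt0) // mulr_sumr -big_split /=.
    by apply: eq_bigr => j _; ring.
  rewrite -(down_sum2 alpha m alpha_gt0 m_gt0) // mulr_sumr ler_sum // => j _.
  have /andP[w0 _] := down_weight_bounds _ j p.
  rewrite mulrCA ler_wpM2l // mulrC ler_wpM2l ?sqr_ge0 //.
  have := shifted_ge0 alpha m alpha_gt0 K j.
  have := meanE alpha m m_gt0 n K s; rewrite /deviation -/a -/e => ->.
  by rewrite /q1 /d; lra.
have -> : drift K = c2 * q0 n * m%:R - (c2 * q1 n - m%:R * q0 n) * C2
    + c2 * (Y K + C3)
    - m%:R * (q1 n * (Y K + C3) + \sum_j down_w K j * dev K j ^+ 3).
  by rewrite (drift_expand n) //; ring.
have {}tail := ler_wpM2l (ler0n R m) tail.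
have E : c2 * q0 n * m%:R - (c2 * q1 n - m%:R * q0 n) * C2
    + c2 * (Y K + C3) - m%:R * ((a * n%:R + e + 1 - alpha) * (Y K + C3)) =
    h0 + h1 * n%:R + h2 * n%:R ^+ 2 + h3 * Y K - alpha * n%:R * Y K.
  have m0 := m_neq0 m m_gt0 : m%:R != 0 :> R.
  by rewrite /q0 /q1 /h0 /h1 /h2 /h3 /d /a; field.
have b0 : h0 <= `|h0| * n%:R ^+ 2.
  by rewrite (le_trans (ler_norm _)) // ler_peMr // exprn_ege1.
have b1 : h1 * n%:R <= `|h1| * n%:R ^+ 2 by rewrite (le_trans (ler_norm _)) // normrM [`|n%:R|]ger0_norm // ler_wpM2l.
have b2 : h2 * n%:R ^+ 2 <= `|h2| * n%:R ^+ 2 by rewrite ler_wpM2r ?ler_norm.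
have b3 : h3 * Y K <= `|h3| * Y K by rewrite ler_wpM2r ?ler_norm.
apply: (le_trans (lerB (lexx _) tail)); rewrite E.
clearbody h0 h1 h2 h3; lra.
Qed.
End Drift.

(** * Quadratic and cubic variation of the spread *)

Section Variation.
Context {R : realType} (alpha : R) (m : nat).
Hypothesis alpha_gt0 : 0 < alpha.
Hypothesis m_gt0 : (0 < m)%N.
Local Notation L := (shifted alpha m).
Local Notation C2 := ('C(m, 2)%:R : R).
Local Notation C3 := ('C(m, 3)%:R : R).
Implicit Type K : 'I_m -> nat.
Local Notation dev := (deviation alpha m).
Local Notation Y := (row_spread alpha m).
Local Notation rate := (down_rate alpha m).
Local Notation up := (up_rate alpha m).
Local Notation jump := (row_jump alpha m).
Local Notation down_w := (down_weight alpha m).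
Local Notation diffusion := (chain_diffusion alpha m).
Local Notation cubic := (chain_cubic alpha m).
Local Notation scale := (fluct_scale alpha m).
Local Notation tau0 := (tau0 alpha m).
Local Notation tau1 := (tau1 alpha m).

Let a : R := alpha / m%:R.
Let e : R := (m%:R - 1) / 2.
Let d : R := 2 * e + 1 - alpha.

(** The mean square of a jump from row [j], from [up_sum2]. *)
Definition mean_square_jump K j : R := Y K + m%:R * dev K j ^+ 2 + tau0 + tau1 * dev K j.

Let CT : R := 1 + m%:R + `|tau0| + `|tau1|.
Let Cg : R := `|a * d| + `|e * (e + 1 - alpha)| + `|2 * a| + `|d| + (alpha + m%:R).
Let Cr : R := 2 ^+ m * ((alpha + m%:R) * (alpha + m%:R + 1)).

Lemma mean_square_jump_bound n K j : (0 < n)%N -> is_part m K -> (\sum_i K i = n)%N ->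
  `|mean_square_jump K j| <= CT * scale K ^+ 2.
Proof.
move=> n0 p s.
have r1 := scale_ge1 alpha m n K n0 s.
have r2 := scale2 alpha m n K s.
have z1 := dev_le_scale alpha m K j.
have Y0 := row_spread_ge0 alpha m K.
have N0 : 0 <= n%:R :> R by [].
have r12 : scale K <= scale K ^+ 2 by rewrite -[leLHS]expr1 ler_weXn2l.
have r02 : 1 <= scale K ^+ 2 by rewrite exprn_ege1.
rewrite /CT /mean_square_jump.
apply: le_trans (ler_normD _ _) _; rewrite [leRHS]mulrDl; apply: lerD; last first.
  by rewrite normrM ler_wpM2l // (le_trans z1).
apply: le_trans (ler_normD _ _) _; rewrite [leRHS]mulrDl; apply: lerD; last by rewrite ler_peMr.
apply: le_trans (ler_normD _ _) _; rewrite [leRHS]mulrDl; apply: lerD.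
  by rewrite ger0_norm //; lra.
rewrite normrM [`|m%:R|]ger0_norm // ler_wpM2l // normrX.
by rewrite lerXn2r ?nnegrE //; lra.
Qed.

(** In typical shapes every row is [n / m] up to the fluctuation scale, so
    [quad] is constant to leading order. *)
Lemma quad_err n K j : (0 < n)%N -> is_part m K -> (\sum_i K i = n)%N ->
  `|quad alpha (L K j) - a ^+ 2 * n%:R ^+ 2| <= Cg * (n%:R * scale K).
Proof.
move=> n0 p s.
have r1 := scale_ge1 alpha m n K n0 s.
have z1 := dev_le_scale alpha m K j.
have z2 := dev_le_n alpha m alpha_gt0 m_gt0 n K n0 s j.
have N1 : 1 <= n%:R :> R by rewrite ler1n.
have nr : n%:R <= n%:R * scale K by rewrite ler_peMr.
have rn : scale K <= n%:R * scale K by rewrite ler_peMl //; lra.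
rewrite (quad_dev alpha m m_gt0 n) // -/a -/e -/d.
rewrite [X in `|X|](_ : _ = a * d * n%:R + e * (e + 1 - alpha)
  + 2 * a * (n%:R * dev K j) + d * dev K j + dev K j * dev K j); last first.
  by rewrite /d; ring.
rewrite /Cg; clearbody a d e.
apply: le_trans (ler_normD _ _) _; rewrite [leRHS]mulrDl; apply: lerD; last first.
  by rewrite normrM mulrA ler_pM.
apply: le_trans (ler_normD _ _) _; rewrite [leRHS]mulrDl; apply: lerD; last first.
  by rewrite normrM ler_wpM2l // (le_trans z1).
apply: le_trans (ler_normD _ _) _; rewrite [leRHS]mulrDl; apply: lerD; last first.
  by rewrite normrM ler_wpM2l // normrM ger0_norm // ler_wpM2l.
apply: le_trans (ler_normD _ _) _; rewrite [leRHS]mulrDl; apply: lerD; last first.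
  by rewrite ler_peMr // (le_trans N1).
by rewrite normrM [`|n%:R|]ger0_norm // ler_wpM2l.
Qed.

Lemma diffusion_approx : exists2 C : R, 0 <= C & forall n K, (0 < n)%N ->
  is_part m K -> (\sum_i K i = n)%N ->
  `|diffusion K - 2 * alpha ^+ 2 / m%:R * n%:R ^+ 2 * Y K| <=
    C * (n%:R * scale K ^+ 3).
Proof.
pose t : R := tau0 * m%:R - tau1 * C2 + m%:R * C3.
have CT0 : 0 <= CT by rewrite !addr_ge0.
have Cg0 : 0 <= Cg by rewrite !addr_ge0 // ltW.
exists (a ^+ 2 * `|t| + m%:R * (2 ^+ m * (Cg * CT))).
  apply: addr_ge0; first by rewrite mulr_ge0 ?sqr_ge0.
  by rewrite !mulr_ge0 ?exprn_ge0.
move=> n K n0 p s.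
have r1 := scale_ge1 alpha m n K n0 s.
have r2 := scale2 alpha m n K s.
have Y0 := row_spread_ge0 alpha m K.
have N0 : 0 <= n%:R :> R by [].
have m0 := m_neq0 m m_gt0 : m%:R != 0 :> R.
have -> : diffusion K - 2 * alpha ^+ 2 / m%:R * n%:R ^+ 2 * Y K =
   a ^+ 2 * n%:R ^+ 2 * t + \sum_j down_w K j *
     ((quad alpha (L K j) - a ^+ 2 * n%:R ^+ 2) * mean_square_jump K j).
  rewrite diffusion_eq //.
  rewrite (eq_bigr (fun j => a ^+ 2 * n%:R ^+ 2 * (down_w K j * mean_square_jump K j) +
     down_w K j * ((quad alpha (L K j) - a ^+ 2 * n%:R ^+ 2) * mean_square_jump K j))); last first.
    by move=> j _; rewrite /down_rate -/(down_weight _ _ _ _) -/(mean_square_jump K j); ring.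
  rewrite big_split /= -mulr_sumr.
  rewrite (eq_bigr (fun j => down_w K j * ((Y K + tau0) + tau1 * dev K j + m%:R * dev K j ^+ 2 + 0 * dev K j ^+ 3))); last first.
    by move=> j _; rewrite /mean_square_jump; ring.
  rewrite (cubic_sum alpha m alpha_gt0 m_gt0) // /t /a.
  set S := \sum_j _; set S' := \sum_j _; by field.
apply: le_trans (ler_normD _ _) _; rewrite [leRHS]mulrDl; apply: lerD.
  rewrite normrM ger0_norm; last by rewrite mulr_ge0 ?sqr_ge0.
  rewrite mulrAC; apply: (ler_wpM2l (mulr_ge0 (sqr_ge0 _) (normr_ge0 _))).
  rewrite expr2 ler_wpM2l //.
  apply: (@le_trans _ _ (scale K ^+ 2)); first by lra.
  by rewrite ler_weXn2l.
apply: le_trans (ler_norm_sum _ _ _) _.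
have -> : m%:R * (2 ^+ m * (Cg * CT)) * (n%:R * scale K ^+ 3) =
   \sum_(j < m) 2 ^+ m * ((Cg * (n%:R * scale K)) * (CT * scale K ^+ 2)).
  by rewrite sumr_const card_ord -[RHS]mulr_natl; ring.
apply: ler_sum => j _; have /andP[w0 w1] := down_weight_bounds alpha m alpha_gt0 _ j p.
rewrite !normrM [`|down_w K j|]ger0_norm // ler_pM ?mulr_ge0 //.
by rewrite ler_pM // ?quad_err ?(@mean_square_jump_bound n).
Qed.

Lemma diffusion_upper : exists2 C : R, 0 <= C & forall n K, (0 < n)%N ->
  is_part m K -> (\sum_i K i = n)%N ->
  diffusion K <= C * (n%:R ^+ 2 * scale K ^+ 2).
Proof.
have CT0 : 0 <= CT by rewrite !addr_ge0.
have Cr0 : 0 <= Cr.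
  by have a0 := ltW alpha_gt0; rewrite !mulr_ge0 ?exprn_ge0 ?addr_ge0 ?addr_ge0.
exists (m%:R * (Cr * CT)); first by apply/mulr_ge0/mulr_ge0.
move=> n K n0 p s; rewrite diffusion_eq //.
have -> : m%:R * (Cr * CT) * (n%:R ^+ 2 * scale K ^+ 2) =
   \sum_(j < m) (Cr * n%:R ^+ 2) * (CT * scale K ^+ 2).
  by rewrite sumr_const card_ord -[RHS]mulr_natl; ring.
apply: ler_sum => j _.
have /andP[w0 w1] := rate_bounds alpha m alpha_gt0 m_gt0 n K n0 p s j.
apply: (@le_trans _ _ (rate K j * `|mean_square_jump K j|)).
  by rewrite ler_wpM2l // ler_norm.
by rewrite ler_pM // (@mean_square_jump_bound n).
Qed.

Lemma cubic_upper : exists2 C : R, 0 <= C & forall n K, (0 < n)%N ->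
  is_part m K -> (\sum_i K i = n)%N ->
  cubic K <= C * (n%:R ^+ 2 * scale K ^+ 3).
Proof.
have a0 := ltW alpha_gt0.
have Cr0 : 0 <= Cr by rewrite !mulr_ge0 ?exprn_ge0 ?addr_ge0 ?addr_ge0.
exists (m%:R * (Cr * (m%:R * (2 ^+ m * (2 * (1 + alpha)) ^+ 3)))).
  apply/mulr_ge0/mulr_ge0 => //; apply/mulr_ge0/mulr_ge0; rewrite ?exprn_ge0 //.
  by rewrite mulr_ge0 ?addr_ge0.
move=> n K n0 p s.
have -> : m%:R * (Cr * (m%:R * (2 ^+ m * (2 * (1 + alpha)) ^+ 3))) * (n%:R ^+ 2 * scale K ^+ 3)
  = \sum_(j < m) (Cr * n%:R ^+ 2) * (m%:R * (2 ^+ m * (2 * (1 + alpha) * scale K) ^+ 3)).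
  by rewrite sumr_const card_ord -[RHS]mulr_natl; ring.
have r0 : 0 <= scale K by exact: sqrtr_ge0.
apply: ler_sum => j _.
have /andP[w0 w1] := rate_bounds alpha m alpha_gt0 m_gt0 n K n0 p s j.
have RHS0 : 0 <= Cr * n%:R ^+ 2 * (m%:R * (2 ^+ m * (2 * (1 + alpha) * scale K) ^+ 3)).
  by rewrite !(mulr_ge0, exprn_ge0, addr_ge0).
have [->|rj] := eqVneq (rate K j) 0; first by rewrite mul0r.
have up01 i : 0 <= up K j i <= 2 ^+ m.
  by have [r|//] := up_bounds alpha m alpha_gt0 K p j i; rewrite r eqxx in rj.
have jb i : `|jump K j i| <= 2 * (1 + alpha) * scale K.
  have [r|[]//] := jump_bounds alpha m alpha_gt0 m_gt0 n K n0 p s j i.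
  by rewrite r eqxx in rj.
rewrite ler_pM //.
  by apply: sumr_ge0 => i _; have /andP[u0 _] := up01 i; rewrite mulr_ge0 ?exprn_ge0.
have -> : m%:R * (2 ^+ m * (2 * (1 + alpha) * scale K) ^+ 3) =
   \sum_(i < m) 2 ^+ m * (2 * (1 + alpha) * scale K) ^+ 3.
  by rewrite sumr_const card_ord -[RHS]mulr_natl.
apply: ler_sum => i _; have /andP[u0 u1] := up01 i.
by rewrite ler_pM ?exprn_ge0 // lerXn2r ?nnegrE ?(le_trans _ (jb i)).
Qed.
End Variation.

(** * Moments of the spread in equilibrium *)

Section Moments.
Context {R : realType} (alpha : R) (m : nat).
Hypothesis alpha_gt0 : 0 < alpha.
Hypothesis m_gt0 : (0 < m)%N.
Implicit Types (K : 'I_m -> nat) (n : nat) (f g : ('I_m -> nat) -> R).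
Local Notation Y := (row_spread alpha m).
Local Notation rate := (down_rate alpha m).
Local Notation up := (up_rate alpha m).
Local Notation jump := (row_jump alpha m).
Local Notation drift := (chain_drift alpha m).
Local Notation diffusion := (chain_diffusion alpha m).
Local Notation scale := (fluct_scale alpha m).

Definition partition_fun n : R :=
  \sum_(k in partitions_le n m) partition_weight alpha m (rows m n k).

Definition expect n f : R :=
  \sum_(k in partitions_le n m)
    partition_weight alpha m (rows m n k) / partition_fun n * f (rows m n k).

(** The one-row partition is always present. *)
Lemma partition_fun_gt0 n : 0 < partition_fun n.
Proof.
pose K (i : 'I_m) : nat := if i == Ordinal m_gt0 then n else 0%N.
have rK : rows m n (with_rows m n K) = K.
  by apply: rows_with_rows => i; rewrite /K; case: eqP.
rewrite /partition_fun (bigD1 (with_rows m n K)) /=; last first.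
  apply/partitions_leP; rewrite rK; split.
    move=> i r; rewrite /K; case: (r =P _) => [->|//]; rewrite leqn0 => /eqP i0.
    by case: (i =P _) => // -[]; apply/val_inj.
  by rewrite (bigD1 (Ordinal m_gt0)) //= /K eqxx big1 ?addn0 // => i /negbTE ->.
rewrite ltr_pwDl //.
  apply: partition_weight_gt0 => //; rewrite rK => i r; rewrite /K.
  case: (r =P _) => [->|//]; rewrite leqn0 => /eqP i0.
  by case: (i =P _) => // -[]; apply/val_inj.
apply: sumr_ge0 => k /andP[/partitions_leP[p _] _]; exact/ltW/partition_weight_gt0.
Qed.

Lemma prob_ge0 n k : k \in partitions_le n m ->
  0 <= partition_weight alpha m (rows m n k) / partition_fun n.
Proof.
move=> /partitions_leP[p _].
by rewrite divr_ge0 // ltW // ?partition_weight_gt0 // partition_fun_gt0.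
Qed.

Lemma ExD n f g : expect n (fun K => f K + g K) = expect n f + expect n g.
Proof. by rewrite /expect -big_split /=; apply: eq_bigr => k _; rewrite mulrDr. Qed.

Lemma ExZ n c f : expect n (fun K => c * f K) = c * expect n f.
Proof. by rewrite /expect mulr_sumr; apply: eq_bigr => k _; rewrite mulrCA. Qed.

Lemma Ex1 n c : expect n (fun=> c) = c.
Proof.
rewrite /expect -mulr_suml -mulr_suml -/(partition_fun n) divff ?mul1r //.
by rewrite gt_eqF // partition_fun_gt0.
Qed.

Lemma Ex_le n f g :
  (forall K, is_part m K -> (\sum_i K i = n)%N -> f K <= g K) -> expect n f <= expect n g.
Proof.
move=> fg; apply: ler_sum => k kS; rewrite ler_wpM2l ?prob_ge0 //.
by move/partitions_leP: kS => [p s]; exact: fg.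
Qed.

Lemma Ex_eq n f g :
  (forall K, is_part m K -> (\sum_i K i = n)%N -> f K = g K) -> expect n f = expect n g.
Proof.
move=> fg; apply: eq_bigr => k /partitions_leP[p s]; by rewrite fg.
Qed.

Lemma Ex_ge0 n f :
  (forall K, is_part m K -> (\sum_i K i = n)%N -> 0 <= f K) -> 0 <= expect n f.
Proof. by move=> f0; rewrite -(Ex1 n 0); exact: Ex_le. Qed.

Lemma Ex_norm n f : `|expect n f| <= expect n (fun K => `|f K|).
Proof.
apply: le_trans (ler_norm_sum _ _ _) _; apply: ler_sum => k kS.
by rewrite normrM ger0_norm ?prob_ge0.
Qed.

(** The generator of the chain applied to a function of the spread. *)
Definition generator (F : R -> R) K : R :=
  \sum_j rate K j * \sum_i up K j i * (F (Y K + 2 * alpha * jump K j i) - F (Y K)).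

Lemma stationary n (F : R -> R) : (0 < n)%N -> expect n (generator F) = 0.
Proof.
move=> n0.
have := chain_stationary alpha m n alpha_gt0 (fun k => F (Y (rows m n k))) n0.
move=> h; rewrite /expect -[RHS](mulr0 (partition_fun n)^-1) -{}[in RHS]h mulr_sumr.
apply: eq_bigr => k /partitions_leP[p s].
rewrite mulrAC mulrC; congr (_ * (_ * _)); apply: eq_bigr => j _.
have [->|[Kj pd _]] := rate_cases alpha m alpha_gt0 (rows m n k) j p.
  by rewrite !mul0r.
congr (_ * _); rewrite rows_del_box; apply: eq_bigr => i _.
congr (_ * (_ - _)); congr F.
rewrite rows_add_box; last first.
  have : ((\sum_i decr m (rows m n k) j i).+1 = n)%N.
    by rewrite -(sum_incr _ _ j) decrK // s.
  by rewrite rows_del_box (bigD1 i) //= => e; rewrite -[X in (_ < X)%N]e ltnS leq_addr.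
by rewrite rows_del_box spread_move.
Qed.

(** Stationarity tested on the spread itself. *)
Lemma Ex_drift n : (0 < n)%N -> expect n drift = 0.
Proof.
move=> n0; have := stationary _ id n0.
rewrite (_ : generator id = fun K => (2 * alpha) * drift K); last first.
  apply/funext => K; rewrite /chain_drift mulr_sumr; apply: eq_bigr => j _.
  rewrite !mulr_sumr; apply: eq_bigr => i _; ring.
by rewrite ExZ => /eqP; rewrite mulf_eq0 mulf_eq0 pnatr_eq0 /= (gt_eqF alpha_gt0) => /eqP.
Qed.

(** Stationarity tested on the square of the spread. *)
Lemma Ex_drift_Y n : (0 < n)%N ->
  expect n (fun K => Y K * drift K) + alpha * expect n diffusion = 0.
Proof.
move=> n0; have := stationary _ (fun y => y ^+ 2) n0.
rewrite (_ : generator _ = fun K => (4 * alpha) * (Y K * drift K + alpha * diffusion K)); last first.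
  apply/funext => K; rewrite /chain_drift /chain_diffusion !mulr_sumr -big_split /= mulr_sumr.
  apply: eq_bigr => j _.
  rewrite !mulr_sumr -big_split mulr_sumr; apply: eq_bigr => i _ /=; ring.
rewrite ExZ ExD ExZ => /eqP.
by rewrite mulf_eq0 mulf_eq0 pnatr_eq0 /= (gt_eqF alpha_gt0) => /eqP.
Qed.

(** The drift bound turns [Ex_drift] into a bound for the mean, and
    [Ex_drift_Y] together with that into one for the second moment. *)
Lemma moment_bounds : exists C : R, exists N : nat, [/\ 0 <= C, (0 < N)%N &
  forall n, (N <= n)%N -> expect n Y <= C * n%:R /\
    expect n (fun K => scale K ^+ 4) <= C * n%:R ^+ 2].
Proof.
have [C [k [C0 k0 hdrift]]] := drift_upper alpha m alpha_gt0 m_gt0.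
have [C' C'0 hdiff] := diffusion_upper alpha m alpha_gt0 m_gt0.
have a0 := alpha_gt0.
(* Beyond this N the correction k is at most half of the restoring force. *)
pose N := (Num.truncn (2 * k / alpha)).+1.
have hN n : (N <= n)%N -> alpha * n%:R / 2 <= alpha * n%:R - k.
  move=> Nn; have : 2 * k / alpha < n%:R.
    apply: lt_le_trans (truncnS_gt _) _; by rewrite ler_nat.
  rewrite ltr_pdivrMr //; lra.
pose C1 := 2 * C / alpha.
have C10 : 0 <= C1 by rewrite divr_ge0 ?mulr_ge0 // ltW.
have Y1 n : (N <= n)%N -> expect n Y <= C1 * n%:R.
  move=> Nn; have n0 : (0 < n)%N by exact: leq_trans Nn.
  have : expect n drift <= expect n (fun K => C * n%:R ^+ 2 + (k - alpha * n%:R) * Y K).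
    by apply: Ex_le => K p s; rewrite (le_trans (hdrift n K n0 p s)) //; lra.
  rewrite Ex_drift // ExD Ex1 ExZ -/(expect n Y) => h.
  have EY0 : 0 <= expect n Y by apply: Ex_ge0 => K _ _; exact: row_spread_ge0.
  have := ler_wpM2r EY0 (hN _ Nn).
  have nr : 0 < n%:R :> R by rewrite ltr0n.
  have -> : expect n Y <= C1 * n%:R =
      (alpha * n%:R / 2 * expect n Y <= alpha * n%:R / 2 * (C1 * n%:R)).
    by rewrite ler_pM2l // divr_gt0 // mulr_gt0.
  have -> : alpha * n%:R / 2 * (C1 * n%:R) = C * n%:R ^+ 2.
    by rewrite /C1; field; rewrite gt_eqF.
  lra.
pose C2 := 2 / alpha * ((C + alpha * C') * C1 + alpha * C').
have C20 : 0 <= C2.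
  have a1 := ltW a0; have aC : 0 <= alpha * C' by rewrite mulr_ge0.
  by apply: mulr_ge0; [rewrite divr_ge0|apply: addr_ge0 => //; rewrite mulr_ge0 ?addr_ge0].
have Y2 n : (N <= n)%N -> expect n (fun K => Y K ^+ 2) <= C2 * n%:R ^+ 2.
  move=> Nn; have n0 : (0 < n)%N by exact: leq_trans Nn.
  have nr : 0 < n%:R :> R by rewrite ltr0n.
  have h1 : expect n (fun K => Y K * drift K) <=
     expect n (fun K => C * n%:R ^+ 2 * Y K + (k - alpha * n%:R) * Y K ^+ 2).
    apply: Ex_le => K p s; have := ler_wpM2l (row_spread_ge0 alpha m K) (hdrift n K n0 p s).
    by move=> h; rewrite (le_trans h) //; lra.
  have h2 : expect n diffusion <= expect n (fun K => C' * n%:R ^+ 2 * Y K + C' * n%:R ^+ 3).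
    apply: Ex_le => K p s; rewrite (le_trans (hdiff n K n0 p s)) //.
    by rewrite (scale2 alpha m n) //; lra.
  rewrite !ExD !ExZ in h1; rewrite ExD ExZ Ex1 in h2.
  have h3 := Ex_drift_Y n n0.
  have EY0 : 0 <= expect n (fun K => Y K ^+ 2) by apply: Ex_ge0 => K _ _; exact: sqr_ge0.
  have h4 := ler_wpM2r EY0 (hN _ Nn).
  have h5 := Y1 n Nn.
  have h6 : (C + alpha * C') * n%:R ^+ 2 * expect n Y <= (C + alpha * C') * n%:R ^+ 2 * (C1 * n%:R).
    by rewrite ler_wpM2l // mulr_ge0 ?exprn_ge0 // addr_ge0 // mulr_ge0 // ltW.
  have h7 := ler_wpM2l (ltW a0) h2.
  have h8 : alpha * n%:R / 2 * expect n (fun K => Y K ^+ 2) <=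
     alpha * n%:R / 2 * (C2 * n%:R ^+ 2).
    have -> : alpha * n%:R / 2 * (C2 * n%:R ^+ 2) =
       (C + alpha * C') * n%:R ^+ 2 * (C1 * n%:R) + alpha * C' * n%:R ^+ 3.
      by rewrite /C2; field; rewrite gt_eqF.
    move: h1 h3 h4 h6 h7.
    move: (expect n (fun K => Y K * drift K)) (expect n diffusion) (expect n Y) (expect n (fun K => Y K ^+ 2)).
    move=> E1 E2 E3 E4; clear; nra.
  by move: h8; rewrite ler_pM2l // divr_gt0 // mulr_gt0.
exists (C1 + (2 * C2 + 2)), N; split => //; first by rewrite addr_ge0 // addr_ge0 // mulr_ge0.
move=> n Nn; split.
  rewrite (le_trans (Y1 n Nn)) // ler_wpM2r // lerDl addr_ge0 // mulr_ge0 //.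
have n0 : (0 < n)%N by exact: leq_trans Nn.
apply: (@le_trans _ _ (expect n (fun K => 2 * Y K ^+ 2 + 2 * n%:R ^+ 2))).
  apply: Ex_le => K p s.
  have -> : scale K ^+ 4 = (Y K + n%:R) ^+ 2 by rewrite -(scale2 alpha m n) // -exprM.
  by have := sqr_ge0 (Y K - n%:R); lra.
rewrite ExD ExZ Ex1; have := Y2 n Nn; have : 0 <= C1 * n%:R ^+ 2 by rewrite mulr_ge0.
lra.
Qed.

(** The third power of the scale is of order [n^(3/2)] in mean,
    that is, smaller by a factor [sqrt n] than the terms of order [n^2] kept in the
    Stein equation. *)
Lemma moment_three_halves : exists C : R, exists N : nat, [/\ 0 <= C, (0 < N)%N &
  forall n, (N <= n)%N -> expect n (fun K => scale K ^+ 3) <= C * n%:R ^+ 2 / Num.sqrt n%:R].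
Proof.
have [C [N [C0 N0 h]]] := moment_bounds; exists C, N; split=> // n Nn.
have n0 : (0 < n)%N by exact: leq_trans Nn.
have sn : 0 < Num.sqrt n%:R :> R by rewrite sqrtr_gt0 ltr0n.
rewrite ler_pdivlMr // mulrC -ExZ; apply: le_trans (proj2 (h n Nn)).
apply: Ex_le => K p s; rewrite [leRHS]exprS ler_wpM2r ?exprn_ge0 ?sqrtr_ge0 //.
by rewrite /fluct_scale s ler_sqrt ?lerDr ?row_spread_ge0 // addr_ge0 ?row_spread_ge0.
Qed.
End Moments.

Local Open Scope classical_set_scope.
Local Open Scope ring_scope.

(** * Stein equation for the Laplace transform *)

(** The remainder series is dominated termwise by [|x|^3] times the
    exponential series of [|x|]. *)
Lemma expR_taylor2 {R : realType} (x : R) :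
  `|expR x - 1 - x - x ^+ 2 / 2| <= `|x| ^+ 3 * expR `|x|.
Proof.
have cv (y : R) : cvgn (series (exp_coeff y)) by exact: is_cvg_series_exp_coeff.
pose c : R := 1 + x + x ^+ 2 / 2.
have -> : expR x - 1 - x - x ^+ 2 / 2 = limn (series (exp_coeff x) \- cst c).
  rewrite limB //; last exact: is_cvg_cst.
  by rewrite lim_cst // /expR /c; ring.
have cvd : cvgn (series (exp_coeff x) \- cst c).
  by apply: is_cvgB; [exact: cv|exact: is_cvg_cst].
rewrite -lim_norm //; apply: limr_le; first exact: is_cvg_norm.
near=> n.
have n3 : (3 <= n)%N by near: n; exists 3%N.
have -> : n = (3 + (n - 3))%N by rewrite subnKC.
rewrite /= /series /= big_nat_recl // big_nat_recl // big_nat_recl //.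
rewrite /exp_coeff /= expr0 expr1 fact0 !factS fact0 /= divr1.
rewrite (_ : _ - c = \sum_(0 <= i < n - 3) x ^+ i.+3 / i.+3`!%:R); last first.
  by rewrite /c !muln1 divr1; ring.
apply: le_trans (ler_norm_sum _ _ _) _.
apply: (@le_trans _ _ (`|x| ^+ 3 * series (exp_coeff `|x|) (n - 3)%N)).
  rewrite mulr_sumr; apply: ler_sum => i _.
  rewrite normrM normrX normfV [`|_%:R|]ger0_norm // -[i.+3]/(3 + i)%N exprD -mulrA.
  rewrite ler_wpM2l ?exprn_ge0 // /exp_coeff /= ler_wpM2l ?exprn_ge0 //.
  by rewrite lef_pV2 ?posrE ?ltr0n ?fact_gt0 // ler_nat leq_fact //; lia.
rewrite ler_wpM2l ?exprn_ge0 //.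
apply: nondecreasing_cvgn_le; last exact: cv.
by apply: nondecreasing_series => i _ _; rewrite exp_coeff_ge0.
Unshelve. all: end_near. Qed.

Section Stein.
Context {R : realType} (alpha : R) (m : nat).
Hypothesis alpha_gt0 : 0 < alpha.
Hypothesis m_gt0 : (0 < m)%N.
Implicit Types (K : 'I_m -> nat) (n : nat) (t : R).
Local Notation Y := (row_spread alpha m).
Local Notation rate := (down_rate alpha m).
Local Notation up := (up_rate alpha m).
Local Notation jump := (row_jump alpha m).
Local Notation drift := (chain_drift alpha m).
Local Notation diffusion := (chain_diffusion alpha m).
Local Notation cubic := (chain_cubic alpha m).
Local Notation scale := (fluct_scale alpha m).
Local Notation Ex := (expect alpha m).

(** The spread in the scale of the limit law. *)
Definition scaled_spread n K : R := m%:R / (alpha * n%:R) * Y K.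
Definition laplace_mean n t : R := Ex n (fun K => expR (- (t * scaled_spread n K))).

(** Minus the derivative of [laplace_mean] in [t]. *)
Definition laplace_tilted n t : R := Ex n (fun K => scaled_spread n K * expR (- (t * scaled_spread n K))).

Let F n t (y : R) : R := expR (- (t * (m%:R / (alpha * n%:R) * y))).

Lemma generator_exp n t K : (0 < n)%N ->
  generator alpha m (F n t) K = expR (- (t * scaled_spread n K)) *
    \sum_j rate K j * \sum_i up K j i * (expR (- (2 * t * m%:R / n%:R * jump K j i)) - 1).
Proof.
move=> n0; rewrite /generator mulr_sumr; apply: eq_bigr => j _.
rewrite mulrCA; congr (_ * _); rewrite mulr_sumr; apply: eq_bigr => i _.
rewrite mulrCA; congr (_ * _); rewrite [RHS]mulrBr mulr1 /F /scaled_spread -expRD.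
congr (expR _ - _).
have nr : n%:R != 0 :> R by rewrite pnatr_eq0 -lt0n.
have ar : alpha != 0 by rewrite gt_eqF.
by field; rewrite nr ar.
Qed.

Lemma scaled_spread_ge0 n K : 0 <= scaled_spread n K.
Proof. by rewrite mulr_ge0 ?row_spread_ge0 // divr_ge0 // mulr_ge0 // ltW. Qed.

(** The jumps, rescaled, are uniformly bounded, so a second-order
    expansion of the exponential holds with one constant for all shapes. *)
Lemma generator_taylor T : 0 <= T -> exists2 C : R, 0 <= C & forall n t K,
  (0 < n)%N -> 0 < t -> t <= T -> is_part m K -> (\sum_i K i = n)%N ->
  forall h, h = 2 * t * m%:R / n%:R ->
  `|generator alpha m (F n t) K - expR (- (t * scaled_spread n K)) *
     (- h * drift K + h ^+ 2 / 2 * diffusion K)| <= C * h ^+ 3 * cubic K.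
Proof.
move=> T0; pose H : R := 4 * T * m%:R * (2 * alpha + m%:R).
exists (expR H); first exact: expR_ge0.
move=> n t K n0 t0 tT p s h hE.
have nr : 0 < n%:R :> R by rewrite ltr0n.
have h0 : 0 <= h by rewrite hE divr_ge0 ?mulr_ge0 // ltW.
rewrite generator_exp // -hE -mulrBr normrM ger0_norm ?expR_ge0 //.
apply: (@le_trans _ _ (1 * (expR H * h ^+ 3 * cubic K))); last by rewrite mul1r.
apply: ler_pM; [exact: expR_ge0|exact: normr_ge0| |].
  by rewrite -expR0 ler_expR oppr_le0 mulr_ge0 ?scaled_spread_ge0 // ltW.
pose rem (x : R) : R := expR (- (h * x)) - 1 - (- (h * x)) - (- (h * x)) ^+ 2 / 2.
rewrite [X in `|X|](_ : _ =
    \sum_j rate K j * \sum_i up K j i * rem (jump K j i)); last first.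
  rewrite /chain_drift /chain_diffusion !mulr_sumr -big_split -sumrB /=.
  apply: eq_bigr => j _; rewrite !mulr_sumr -big_split -sumrB /=.
  by apply: eq_bigr => i _; rewrite /rem; ring.
rewrite [leRHS](_ : _ =
    \sum_j rate K j * \sum_i up K j i * (expR H * h ^+ 3 * `|jump K j i| ^+ 3)); last first.
  rewrite /chain_cubic mulr_sumr; apply: eq_bigr => j _.
  by rewrite !mulr_sumr; apply: eq_bigr => i _; ring.
apply: le_trans (ler_norm_sum _ _ _) _; apply: ler_sum => j _.
have [r|rj] := eqVneq (rate K j) 0; first by rewrite r !mul0r normr0.
have up0 i : 0 <= up K j i.
  by have [r|/andP[]//] := up_bounds alpha m alpha_gt0 K p j i; rewrite r eqxx in rj.
have jb i : `|jump K j i| <= 2 * (alpha + m%:R + alpha) * n%:R.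
  have [r|[]//] := jump_bounds alpha m alpha_gt0 m_gt0 n K n0 p s j i.
  by rewrite r eqxx in rj.
have r0 : 0 <= rate K j.
  by have /andP[] := rate_bounds alpha m alpha_gt0 m_gt0 n K n0 p s j.
rewrite normrM ger0_norm // ler_wpM2l //.
apply: le_trans (ler_norm_sum _ _ _) _; apply: ler_sum => i _.
rewrite normrM ger0_norm // ler_wpM2l //.
apply: le_trans (expR_taylor2 _) _.
rewrite normrN normrM [`|h|]ger0_norm // exprMn mulrC mulrA.
rewrite ler_wpM2r ?exprn_ge0 // ler_wpM2r ?exprn_ge0 //.
rewrite ler_expR.
apply: (@le_trans _ _ (h * (2 * (alpha + m%:R + alpha) * n%:R))).
  by rewrite ler_wpM2l.
rewrite (_ : h * _ = 4 * t * m%:R * (2 * alpha + m%:R)).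
  rewrite /H ler_wpM2r ?addr_ge0 ?mulr_ge0 ?(ltW alpha_gt0) // ler_wpM2r //.
  by rewrite ler_wpM2l.
by rewrite hE; field; rewrite gt_eqF.
Qed.

(** Stationarity kills the mean of the generator of
    [exp (- t W)], whose leading part is, up to a factor of order [n^2], the
    combination on the left. *)
Lemma stein_laplace T : 0 <= T -> exists C : R, exists N : nat,
  [/\ 0 <= C, (0 < N)%N & forall n t, (N <= n)%N -> 0 < t -> t <= T ->
   `|(m%:R - 1) * (alpha + m%:R) / 2 * laplace_mean n t - (1 + alpha * t) * laplace_tilted n t|
     <= C / Num.sqrt n%:R].
Proof.
move=> T0.
have [Cg Cg0 hg] := generator_taylor T T0.
have [C1 C10 hdrift] := drift_approx alpha m alpha_gt0 m_gt0.
have [C2 C20 hdiff] := diffusion_approx alpha m alpha_gt0 m_gt0.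
have [C3 C30 hthird] := cubic_upper alpha m alpha_gt0 m_gt0.
have [C4 [N [C40 N0 hscale]]] := moment_three_halves alpha m alpha_gt0 m_gt0.
pose D : R := Cg * C3 * (2 * T * m%:R) ^+ 2 + C1 + C2 * (T * m%:R).
have D0 : 0 <= D by rewrite !addr_ge0 // !mulr_ge0 // ?exprn_ge0 // mulr_ge0 // mulr_ge0.
have mr : 0 < m%:R :> R by rewrite ltr0n.
have a0 := alpha_gt0.
exists (D * C4 * m%:R / (2 * alpha ^+ 2)), N; split => //.
  by rewrite divr_ge0 ?mulr_ge0 ?exprn_ge0 // ltW.
move=> n t Nn t0 tT.
have n0 : (0 < n)%N by exact: leq_trans Nn.
have nr : 0 < n%:R :> R by rewrite ltr0n.
pose h : R := 2 * t * m%:R / n%:R.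
have h0 : 0 < h by rewrite divr_gt0 // !mulr_gt0.
pose M K : R := 2 * alpha ^+ 2 * n%:R ^+ 2 / m%:R *
   ((m%:R - 1) * (alpha + m%:R) / 2 - (1 + alpha * t) * scaled_spread n K).
(* The generator, whose mean is zero, cancels the leading terms pointwise. *)
have pw K : is_part m K -> (\sum_i K i = n)%N ->
  `|h * (expR (- (t * scaled_spread n K)) * M K) + generator alpha m (F n t) K| <=
    h * D * scale K ^+ 3.
  move=> p s.
  have r0 : 0 <= scale K ^+ 3 by rewrite exprn_ge0 // sqrtr_ge0.
  set f := expR _.
  have f0 : 0 <= f by exact: expR_ge0.
  have f1 : f <= 1.
    by rewrite -expR0 ler_expR oppr_le0 mulr_ge0 ?scaled_spread_ge0 // ltW.
  have := hg n t K n0 t0 tT p s h erefl; rewrite -/f.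
  have := hdrift n K n0 p s; have := hdiff n K n0 p s; have := hthird n K n0 p s.
  set A := drift K; set B := diffusion K; set S := cubic K; set G := generator _ _ _ _.
  set A0 := (_ * n%:R ^+ 2 - _); set B0 := _ * Y K => hS hB hA hG.
  have -> : h * (f * M K) + G = f * h * (A0 - A) - f * h ^+ 2 / 2 * (B0 - B)
     + (G - f * (- h * A + h ^+ 2 / 2 * B)).
    have -> : M K = A0 - h / 2 * B0.
      by rewrite /M /A0 /B0 /scaled_spread /h; field; rewrite !gt_eqF.
    by field.
  have b1 : `|f * h * (A0 - A)| <= h * C1 * scale K ^+ 3.
    have fh0 : 0 <= f * h by rewrite mulr_ge0 // ltW.
    rewrite normrM ger0_norm // distrC -mulrA ler_pM //.
    by rewrite ler_piMl // ltW.
  have hn : h * n%:R = 2 * T * m%:R * (t / T) \/ True by right.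
  have hn' : h * n%:R <= 2 * T * m%:R.
    rewrite /h divfK ?gt_eqF // ler_wpM2r ?(ltW mr) // ler_wpM2l //.
  have b2 : `|f * h ^+ 2 / 2 * (B0 - B)| <= h * (C2 * (T * m%:R)) * scale K ^+ 3.
    rewrite normrM distrC ger0_norm; last by rewrite !mulr_ge0 // ltW.
    apply: (@le_trans _ _ (1 * h ^+ 2 / 2 * (C2 * (n%:R * scale K ^+ 3)))).
      rewrite ler_pM // ?ler_wpM2r // ?mulr_ge0 // ?ltW // ?exprn_gt0 //.
    have -> : 1 * h ^+ 2 / 2 * (C2 * (n%:R * scale K ^+ 3)) =
       h * (C2 * ((h * n%:R) / 2)) * scale K ^+ 3 by field.
    rewrite ler_wpM2r // ler_wpM2l ?(ltW h0) // ler_wpM2l //; lra.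
  have b3 : `|G - f * (- h * A + h ^+ 2 / 2 * B)| <=
      h * (Cg * C3 * (2 * T * m%:R) ^+ 2) * scale K ^+ 3.
    apply: le_trans hG _.
    apply: (@le_trans _ _ (Cg * h ^+ 3 * (C3 * (n%:R ^+ 2 * scale K ^+ 3)))).
      by rewrite ler_wpM2l // mulr_ge0 // exprn_ge0 // ltW.
    have -> : Cg * h ^+ 3 * (C3 * (n%:R ^+ 2 * scale K ^+ 3)) =
      h * (Cg * C3 * (h * n%:R) ^+ 2) * scale K ^+ 3 by ring.
    rewrite ler_wpM2r // ler_wpM2l ?(ltW h0) // ler_wpM2l ?mulr_ge0 //.
    by rewrite lerXn2r ?nnegrE // ?mulr_ge0 // ?ltW //.
  apply: le_trans (ler_normD _ _) _.
  apply: le_trans (lerD (ler_normB _ _) (lexx _)) _.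
  apply: le_trans (lerD (lerD b1 b2) b3) _.
  by rewrite /D; lra.
have EM : Ex n (fun K => h * (expR (- (t * scaled_spread n K)) * M K) + generator alpha m (F n t) K) =
  h * (2 * alpha ^+ 2 * n%:R ^+ 2 / m%:R) *
   ((m%:R - 1) * (alpha + m%:R) / 2 * laplace_mean n t - (1 + alpha * t) * laplace_tilted n t).
  rewrite ExD stationary // addr0.
  transitivity (Ex n (fun K => h * (2 * alpha ^+ 2 * n%:R ^+ 2 / m%:R) *
      ((m%:R - 1) * (alpha + m%:R) / 2) * expR (- (t * scaled_spread n K)) +
     - (h * (2 * alpha ^+ 2 * n%:R ^+ 2 / m%:R) * (1 + alpha * t)) *
      (scaled_spread n K * expR (- (t * scaled_spread n K))))).
    by apply: Ex_eq => K _ _; rewrite /M; ring.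
  by rewrite ExD !ExZ -/(laplace_mean n t) -/(laplace_tilted n t); ring.
have EB : `|Ex n (fun K => h * (expR (- (t * scaled_spread n K)) * M K) + generator alpha m (F n t) K)|
   <= h * D * (C4 * n%:R ^+ 2 / Num.sqrt n%:R).
  apply: le_trans (Ex_norm _ _ alpha_gt0 m_gt0 _ _) _.
  apply: le_trans (Ex_le _ _ alpha_gt0 m_gt0 _ _ _ pw) _.
  by rewrite ExZ ler_wpM2l ?hscale // mulr_ge0 // ltW.
have g0 : 0 < h * (2 * alpha ^+ 2 * n%:R ^+ 2 / m%:R).
  by rewrite mulr_gt0 // divr_gt0 // !mulr_gt0 ?exprn_gt0.
move: EB; rewrite EM normrM gtr0_norm // -ler_pdivlMl //.
move=> /le_trans; apply; rewrite le_eqVlt; apply/orP; left; apply/eqP.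
have sn : Num.sqrt n%:R != 0 :> R by rewrite gt_eqF // sqrtr_gt0.
by field; rewrite sn !gt_eqF.
Qed.
End Stein.

(** * Limit of the Laplace transforms *)

Lemma is_derive_bigsum {R : realType} (I : Type) (r : seq I) (P : pred I)
    (h : I -> R -> R) (dh : I -> R) (x : R) :
  (forall i, is_derive x 1 (h i) (dh i)) ->
  is_derive x 1 (fun t => \sum_(i <- r | P i) h i t) (\sum_(i <- r | P i) dh i).
Proof.
move=> H.
rewrite (_ : (fun t => _) = \sum_(i <- r | P i) h i); last first.
  by apply/funext => t; rewrite fct_sumE.
by elim/big_ind2 : _ => // [|] *; [exact: is_derive_cst|exact: is_deriveD].
Qed.

Lemma cvg_of_sqrt_bound {R : realType} (u : nat -> R) (l C : R) (N : nat) :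
  0 <= C -> (forall n, (N <= n)%N -> `|u n - l| <= C / Num.sqrt n%:R) ->
  u n @[n --> \oo] --> l.
Proof.
move=> C0 h; apply/cvgrPdist_le => e e0; near=> n.
have Nn : (N <= n)%N by near: n; exists N.
have n0 : (0 < n)%N by near: n; exists 1%N.
rewrite distrC (le_trans (h n Nn)) // ler_pdivrMr ?sqrtr_gt0 ?ltr0n // mulrC.
have Ce0 : 0 <= C / e by rewrite divr_ge0 // ltW.
rewrite -ler_pdivrMr // -(ger0_norm Ce0) -sqrtr_sqr ler_sqrt //.
apply/ltW/(lt_le_trans (truncnS_gt _)); rewrite ler_nat.
near: n; exact: nbhs_infty_ge.
Unshelve. all: end_near. Qed.

Section Laplace.
Context {R : realType} (alpha : R) (m : nat).
Hypothesis alpha_gt0 : 0 < alpha.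
Hypothesis m_gt0 : (0 < m)%N.
Local Notation phi := (laplace_mean alpha m).
Local Notation psi := (laplace_tilted alpha m).
Local Notation W := (scaled_spread alpha m).

(** The shape parameter of the theorem, written without [beta]. *)
Definition gamma_shape : R := (m%:R - 1) * (alpha + m%:R) / (2 * alpha).

Lemma gamma_shape_ge0 : 0 <= gamma_shape.
Proof.
have a0 := alpha_gt0; have : 1 <= m%:R :> R by rewrite ler1n.
by move=> m1; rewrite divr_ge0 ?mulr_ge0 //; lra.
Qed.

Lemma laplace_mean_derive n (t : R) : is_derive t (1:R) (phi n) (- psi n t).
Proof.
have -> : - psi n t = \sum_(k in partitions_le n m)
    partition_weight alpha m (rows m n k) / partition_fun alpha m n *
     (- W n (rows m n k) * expR (- (t * W n (rows m n k)))).
  by rewrite /laplace_tilted /expect -sumrN; apply: eq_bigr => k _; ring.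
apply: is_derive_bigsum => k; set c := _ / _; set w := W n _.
rewrite (_ : (fun t => _) = c \*: (expR \o (- w \*: id))); last first.
  by apply/funext => s; congr (_ * expR _); rewrite /= /GRing.scale /= mulNr mulrC.
apply: is_derive_eq; rewrite /= !scaleNr /GRing.scale /=.
by rewrite mulr1 (mulrC t) (mulrC (expR _)).
Qed.

(** The quotient of the Laplace transform by its conjectured
    limit equals 1 at 0, and by [stein_laplace] its derivative is of order
    [n^(-1/2)]; the mean value theorem concludes. *)
Lemma laplace_mean_error (T : R) : 0 < T -> exists C : R, exists N : nat, 0 <= C /\
  forall n, (N <= n)%N -> `|phi n T - (1 + alpha * T) `^ (- gamma_shape)| <= C / Num.sqrt n%:R.
Proof.
move=> T0; have a0 := alpha_gt0.
have [C [N [C0 N0 h]]] := stein_laplace alpha m alpha_gt0 m_gt0 T (ltW T0).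
have pos (t : R) : 0 <= t -> 0 < 1 + alpha * t.
  by move=> t0; rewrite ltr_pwDl // mulr_ge0 // ltW.
(* Integrating factor of the limiting differential equation. *)
pose G n t : R := phi n t * (1 + alpha * t) `^ gamma_shape.
pose dG n t : R := (1 + alpha * t) `^ (gamma_shape - 1) *
   ((m%:R - 1) * (alpha + m%:R) / 2 * phi n t - (1 + alpha * t) * psi n t).
have derG n (t : R) : 0 <= t -> is_derive t (1 : R) (G n) (dG n t).
  move=> t0.
  have dphi := laplace_mean_derive n t.
  have dlin : is_derive t (1 : R) (fun s : R => 1 + alpha * s) alpha.
    rewrite (_ : (fun s => _) = cst 1 + alpha \*: id); last by apply/funext.
    by apply: is_derive_eq; rewrite add0r /GRing.scale /= mulr1.
  have dpow : is_derive t (1 : R) (fun s : R => (1 + alpha * s) `^ gamma_shape)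
      (gamma_shape * (1 + alpha * t) `^ (gamma_shape - 1) * alpha).
    rewrite (_ : (fun s : R => _) = (@powR R ^~ gamma_shape) \o (fun s : R => 1 + alpha * s)) //.
    apply: is_derive1_comp.
    exact: is_derive1_powR (pos t t0).
  rewrite (_ : G n = phi n * (fun s : R => (1 + alpha * s) `^ gamma_shape)); last by apply/funext.
  apply: is_derive_eq; rewrite /GRing.scale /= /dG.
  have -> : (1 + alpha * t) `^ gamma_shape = (1 + alpha * t) * (1 + alpha * t) `^ (gamma_shape - 1).
    have [s0|s0] := eqVneq gamma_shape 0.
      by rewrite s0 powRr0 sub0r powR_inv1 ?mulfV ?gt_eqF ?pos // ltW // pos.
    by rewrite mulr_powRB1 ?ltW ?pos // lt_def s0 gamma_shape_ge0.
  by rewrite /gamma_shape; field; rewrite gt_eqF.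
pose M : R := (1 + alpha * T) `^ gamma_shape.
exists (T * M * C * (1 + alpha * T) `^ (- gamma_shape)), N; split.
  by rewrite !mulr_ge0 ?powR_ge0 // ltW.
move=> n Nn.
have [c cT Ec] : exists2 c, c \in `]0, T[%R & G n T - G n 0 = dG n c * (T - 0).
  apply: MVT => //; first by move=> x /[!in_itv] /andP[x0 _]; apply/derG/ltW.
  apply: derivable_within_continuous => x /[!in_itv] /andP[x0 _].
  exact: (@ex_derive _ _ _ _ _ _ _ (derG n x x0)).
have G0 : G n 0 = 1.
  rewrite /G mulr0 addr0 powR1 mulr1 /laplace_mean -[RHS](Ex1 alpha m alpha_gt0 m_gt0 n).
  by apply: Ex_eq => K _ _; rewrite mul0r oppr0 expR0.
move: cT; rewrite in_itv /= => /andP[c0 cT].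
have n0 : (0 < n)%N by exact: leq_trans Nn.
have sn : 0 < Num.sqrt n%:R :> R by rewrite sqrtr_gt0 ltr0n.
have GT : `|G n T - 1| <= T * M * (C / Num.sqrt n%:R).
  rewrite -{1}G0 Ec subr0 normrM [`|T|]gtr0_norm // mulrC -mulrA ler_wpM2l ?(ltW T0) //.
  rewrite /dG normrM ger0_norm ?powR_ge0 //; apply: ler_pM => //.
    exact: powR_ge0.
    apply: (@le_trans _ _ ((1 + alpha * c) `^ gamma_shape)).
      by apply: ler_powR; rewrite ?gerBl // lerDl mulr_ge0 // ltW.
    apply: ge0_ler_powR; rewrite ?gamma_shape_ge0 ?nnegrE ?ltW ?pos // ?ltW //.
    by rewrite ltrD2l ltr_pM2l.
  by apply: h => //; apply: ltW.
have p0 := powR_gt0 (- gamma_shape) (pos T (ltW T0)).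
have -> : phi n T - (1 + alpha * T) `^ (- gamma_shape) = (G n T - 1) * (1 + alpha * T) `^ (- gamma_shape).
  rewrite mulrBl mul1r /G -mulrA -powRD ?subrr ?powRr0 ?mulr1 //.
  by rewrite (gt_eqF (pos T (ltW T0))) implybT.
rewrite normrM [X in _ * X]gtr0_norm // [leRHS]mulrAC ler_pM2r //.
by rewrite -[leRHS]mulrA.
Qed.

Lemma laplace_mean_cvg (T : R) : 0 <= T -> phi n T @[n --> \oo] --> (1 + alpha * T) `^ (- gamma_shape).
Proof.
rewrite le_eqVlt => /orP[/eqP <-|T0].
  rewrite mulr0 addr0 powR1 (_ : (fun n => _) = cst 1); first exact: cvg_cst.
  apply/funext => n; rewrite /laplace_mean -[RHS](Ex1 alpha m alpha_gt0 m_gt0 n).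
  by apply: Ex_eq => K _ _; rewrite mul0r oppr0 expR0.
have [C [N [C0 h]]] := laplace_mean_error _ T0.
exact: cvg_of_sqrt_bound C0 h.
Qed.
End Laplace.

(** * Bernstein approximation *)

Section Bernstein.
Context {R : realType}.
Implicit Types (g : nat -> R) (u : R) (N : nat).

(** The recursion on the number of trials of the Bernoulli walk; it
    avoids binomial coefficients in the moment computations. *)
Fixpoint bernstein N g : {poly R} :=
  if N is N'.+1 then
    'X * bernstein N' (fun k => g k.+1) + (1 - 'X) * bernstein N' g
  else (g 0%N)%:P.

Lemma bernsteinS N g u : (bernstein N.+1 g).[u] =
  u * (bernstein N (fun k => g k.+1)).[u] + (1 - u) * (bernstein N g).[u].
Proof. by rewrite /= !hornerE. Qed.

Lemma bernstein_le N g1 g2 u : 0 <= u <= 1 ->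
  (forall k, (k <= N)%N -> g1 k <= g2 k) ->
  (bernstein N g1).[u] <= (bernstein N g2).[u].
Proof.
move=> /andP[u0 u1]; elim: N g1 g2 => [|N IH] g1 g2 g12.
  by rewrite !hornerC g12.
rewrite !bernsteinS lerD // ler_wpM2l ?subr_ge0 //; apply: IH => k kN; apply: g12 => //.
exact: leqW.
Qed.

Lemma bernstein_comb N g1 g2 a b u :
  (bernstein N (fun k => a * g1 k + b * g2 k)).[u] =
  a * (bernstein N g1).[u] + b * (bernstein N g2).[u].
Proof.
elim: N g1 g2 => [|N IH] g1 g2; first by rewrite !hornerC.
by rewrite !bernsteinS !IH; ring.
Qed.

Lemma bernstein_cst N c u : (bernstein N (fun=> c)).[u] = c.
Proof. by elim: N => [|N IH]; rewrite ?hornerC // bernsteinS IH; ring. Qed.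

(** The second moment of a binomial variable about an arbitrary
    centre [c]; a free centre is what makes the induction work. *)
Lemma bernstein_var N c u :
  (bernstein N (fun k => (k%:R - c) ^+ 2)).[u] = N%:R * (u * (1 - u)) + (N%:R * u - c) ^+ 2.
Proof.
elim: N c => [|N IH] c; first by rewrite hornerC; ring.
rewrite bernsteinS IH (_ : (fun k => _) = fun k => (k%:R - (c - 1)) ^+ 2).
  by rewrite IH -natr1; ring.
by apply/funext => k; rewrite -natr1; ring.
Qed.

(** Heine's theorem, in a form in which only one of the points is
    confined to the unit interval. *)
Lemma unif_cont01 (h : R -> R) (eta : R) : continuous h -> 0 < eta ->
  exists2 d : R, 0 < d & forall x y, 0 <= x <= 1 -> `|x - y| < d -> `|h x - h y| < eta.
Proof.
move=> ch e0.
pose P (d x : R) := forall y, `|x - y| < d -> `|h x - h y| < eta.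
have cpt : compact `[0 : R, 1] by exact: segment_compact.
have loc (x : R) : `[0, 1]%classic x -> \forall x' \near x & i \near 0^'+, P i x'.
  move=> _; have e20 : 0 < eta / 2 by rewrite divr_gt0.
  have /cvgrPdist_lt/(_ _ e20) := ch x.
  move=> /nbhs_ballP[r /= r0 hr].
  exists (ball x (r / 2), [set d | d < r / 2]); first split => /=.
  - by apply: nbhsx_ballx; rewrite divr_gt0.
  - by apply: nbhs_right_lt; rewrite divr_gt0.
  move=> [x' d] /= [bx dr] y xy.
  have h1 : `|h x - h x'| < eta / 2.
    by apply: hr; rewrite /ball /= in bx *; lra.
  have h2 : `|h x - h y| < eta / 2.
    apply: hr; rewrite /ball /= in bx *.
    by have := ler_distD x' x y; lra.
  by have := ler_distD (h x) (h x') (h y); rewrite (distrC (h x') (h x)); lra.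
have H := (compact_near_coveringP _).1 cpt R (0^'+) P _ loc.
have [d [d0 Hd]] : exists d : R, 0 < d /\ `[0, 1]%classic `<=` P d.
  have : \forall d \near 0^'+, 0 < d /\ `[0, 1]%classic `<=` P d.
    near=> d; split; first by near: d; exact: nbhs_right_gt.
    by near: d; exact: H.
  by move=> /filter_ex.
by exists d => // x y x01; apply: Hd; rewrite /= in_itv.
Unshelve. all: end_near. Qed.

(** Chebyshev's inequality for the binomial law: values of [h] at
    distance less than [d] are close, the others have small total weight. *)
Lemma bernstein_approx (h : R -> R) (M eta : R) : continuous h ->
  (forall u, 0 <= u <= 1 -> `|h u| <= M) -> 0 < eta ->
  exists p : {poly R}, forall u, 0 <= u <= 1 -> `|p.[u] - h u| <= eta.
Proof.
move=> ch hM e0.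
have e20 : 0 < eta / 2 by rewrite divr_gt0.
have [d d0 hd] := unif_cont01 h (eta / 2) ch e20.
have M0 : 0 <= M.
  by have := hM 0; rewrite lexx ler01 => /(_ isT); apply: le_trans.
pose N := (Num.truncn (4 * M / (d ^+ 2 * eta))).+1.
have Nr : 0 < N%:R :> R by rewrite ltr0n.
have d20 : 0 < d ^+ 2 by rewrite exprn_gt0.
have NM : 2 * M / (d ^+ 2 * N%:R) <= eta / 2.
  have := truncnS_gt (4 * M / (d ^+ 2 * eta)); rewrite -/N.
  rewrite ltr_pdivrMr ?mulr_gt0 // ler_pdivrMr ?mulr_gt0 //; lra.
exists (bernstein N (fun k => h (k%:R / N%:R))) => u u01.
have pt (k : nat) : (k <= N)%N ->
   `|h (k%:R / N%:R) - h u| <= eta / 2 * 1 + 2 * M / (d ^+ 2 * N%:R ^+ 2) * (k%:R - N%:R * u) ^+ 2.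
  move=> kN; have k01 : 0 <= (k%:R / N%:R : R) <= 1.
    by rewrite divr_ge0 //= ler_pdivrMr // mul1r ler_nat.
  have E : 2 * M / (d ^+ 2 * N%:R ^+ 2) * (k%:R - N%:R * u) ^+ 2 =
      2 * M / d ^+ 2 * `|k%:R / N%:R - u| ^+ 2.
    by rewrite real_normK ?num_real //; field; rewrite (gt_eqF Nr) (gt_eqF d0).
  have [kd|kd] := ltP `|k%:R / N%:R - u| d.
    apply: (@le_trans _ _ (eta / 2)); first by apply: ltW; apply: hd.
    by rewrite mulr1 lerDl E mulr_ge0 ?sqr_ge0 // divr_ge0 ?mulr_ge0 // ltW.
  apply: (@le_trans _ _ (2 * M)).
    by have := ler_normB (h (k%:R / N%:R)) (h u); have := hM _ k01; have := hM _ u01; lra.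
  rewrite E -[leLHS]add0r lerD ?mulr1 ?(ltW e20) // mulrAC ler_pdivlMr //.
  by rewrite ler_wpM2l ?mulr_ge0 // lerXn2r ?nnegrE // ltW.
have bound (s : R) : `|s| = 1 -> s * (bernstein N (fun k => h (k%:R / N%:R))).[u] - s * h u <= eta.
  move=> s1; have := @bernstein_le N (fun k => s * h (k%:R / N%:R) + (- s * h u) * 1)
     (fun k => eta / 2 * 1 + 2 * M / (d ^+ 2 * N%:R ^+ 2) * (k%:R - N%:R * u) ^+ 2) u u01.
  rewrite !bernstein_comb !bernstein_cst bernstein_var subrr expr0n addr0 !mulr1 => H.
  have {H}: s * (bernstein N (fun k => h (k%:R / N%:R))).[u] + - s * h u <=
    eta / 2 + 2 * M / (d ^+ 2 * N%:R ^+ 2) * (N%:R * (u * (1 - u))).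
    apply: H => k kN; rewrite mulNr -mulrBr.
    by rewrite (le_trans (ler_norm _)) // normrM s1 mul1r -[eta / 2]mulr1 pt.
  have -> : 2 * M / (d ^+ 2 * N%:R ^+ 2) * (N%:R * (u * (1 - u))) =
     2 * M / (d ^+ 2 * N%:R) * (u * (1 - u)).
    by field; rewrite (gt_eqF Nr) (gt_eqF d0).
  have : 2 * M / (d ^+ 2 * N%:R) * (u * (1 - u)) <= 2 * M / (d ^+ 2 * N%:R) * 1.
    rewrite ler_wpM2l ?divr_ge0 ?mulr_ge0 // ?ltW //.
    by move/andP: u01 => [u0 u1]; nra.
  lra.
rewrite ler_norml; have := bound 1 (normr1 _); have := bound (-1) (normrN1 _); lra.
Qed.
End Bernstein.

(** * From Laplace transforms to weak convergence *)

Section LaplaceWeak.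
Context {R : realType}.
Implicit Types (f g : R -> R) (I J : (R -> R) -> R) (e x d M eta : R).

(** The statistic is only asymptotically nonnegative, so test functions
    are controlled from -1 on rather than from 0 on. *)
Definition right_bounded f :=
  continuous f /\ exists M : R, forall x, -1 <= x -> `|f x| <= M.

(** What is common to finite sums against a probability vector
    on points at least -1 and to the integral against the Gamma law. *)
Definition expectation_on I := [/\ I (fun=> 1) = 1,
  forall a b f g, right_bounded f -> right_bounded g ->
    I (fun x => a * f x + b * g x) = a * I f + b * I g &
  forall f g, right_bounded f -> right_bounded g ->
    (forall x, -1 <= x -> f x <= g x) -> I f <= I g].

(** The shift by 1 keeps the values in the unit interval, where Bernstein
    polynomials converge, as soon as [x] is at least -1. *)
Definition lap (e : R) (x : R) : R := expR (- (e * (x + 1))).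

Lemma right_bounded_cst c : right_bounded (fun=> c).
Proof. by split; [exact: cst_continuous|exists `|c|]. Qed.

Lemma right_bounded_comb a b f g : right_bounded f -> right_bounded g ->
  right_bounded (fun x => a * f x + b * g x).
Proof.
move=> [cf [M fM]] [cg [M' gM]]; split.
  by move=> x; apply: cvgD; apply: cvgM; (exact: cvg_cst || exact: cf || exact: cg).
exists (`|a| * M + `|b| * M') => x x1.
by rewrite (le_trans (ler_normD _ _)) // !normrM lerD // ler_wpM2l ?fM ?gM.
Qed.

Lemma right_bounded_mul f g : right_bounded f -> right_bounded g ->
  right_bounded (fun x => f x * g x).
Proof.
move=> [cf [M fM]] [cg [M' gM]]; split.
  by move=> x; apply: cvgM; [exact: cf|exact: cg].
by exists (M * M') => x x1; rewrite normrM ler_pM ?fM ?gM.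
Qed.

Lemma lap_gt0 e x : 0 < lap e x. Proof. exact: expR_gt0. Qed.

Lemma lap_le1 e x : 0 < e -> -1 <= x -> lap e x <= 1.
Proof.
move=> e0 x1; rewrite -expR0 ler_expR oppr_le0 mulr_ge0 ?(ltW e0) //; lra.
Qed.

Lemma right_bounded_lap e : 0 < e -> right_bounded (lap e).
Proof.
move=> e0; split.
  move=> x; apply: continuous_comp; last exact: continuous_expR.
  apply: cvgN; apply: cvgM; first exact: cvg_cst.
  by apply: cvgD; [exact: cvg_id|exact: cvg_cst].
exists 1 => x x1; by rewrite ger0_norm ?lap_le1 // ltW // lap_gt0.
Qed.

Lemma lapX e k x : lap e x ^+ k = lap (k%:R * e) x.
Proof. by rewrite -expRM_natl; congr expR; ring. Qed.

Lemma right_bounded_ext f g : f =1 g -> right_bounded f -> right_bounded g.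
Proof. by move=> /funext ->. Qed.

Lemma right_bounded_lapX e k : 0 < e -> right_bounded (fun x => lap e x ^+ k).
Proof.
move=> e0; elim: k => [|k IH]; first exact: right_bounded_cst.
apply: (right_bounded_ext _ _ (fun x => esym (exprS (lap e x) k))).
by apply: right_bounded_mul => //; exact: right_bounded_lap.
Qed.

Lemma right_bounded_poly e (p : {poly R}) : 0 < e -> right_bounded (fun x => p.[lap e x]).
Proof.
move=> e0; elim/poly_ind: p => [|p c IH].
  by apply: (right_bounded_ext _ _ (fun x => esym (horner0 _))); exact: right_bounded_cst.
apply: (@right_bounded_ext (fun x => 1 * (p.[lap e x] * lap e x) + c * 1)) => [x|].
  by rewrite hornerMXaddC; ring.
apply: right_bounded_comb; last exact: right_bounded_cst.
by apply: right_bounded_mul => //; exact: right_bounded_lap.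
Qed.

Variables (I_ : nat -> (R -> R) -> R) (J : (R -> R) -> R).
Hypotheses (I_exp : forall n, expectation_on (I_ n)) (J_exp : expectation_on J).
Hypothesis lap_cvg : forall e, 0 < e -> I_ n (lap e) @[n --> \oo] --> J (lap e).
Hypothesis J_lap : forall eta, 0 < eta -> exists2 e, 0 < e & 1 - eta <= J (lap e).

Let lapX_cvg e k : 0 < e ->
  I_ n (fun x => lap e x ^+ k) @[n --> \oo] --> J (fun x => lap e x ^+ k).
Proof.
move=> e0; case: k => [|k].
  under eq_fun do under [fun x => _]eq_fun do rewrite expr0.
  under [fun x => lap _ _ ^+ _]eq_fun do rewrite expr0.
  have [-> _ _] := J_exp; rewrite (_ : (fun n => _) = cst 1); first exact: cvg_cst.
  by apply/funext => n; have [] := I_exp n.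
rewrite (_ : (fun x => lap e x ^+ k.+1) = lap (k.+1%:R * e)); last first.
  by apply/funext => x; rewrite lapX.
by apply: lap_cvg; rewrite mulr_gt0.
Qed.

Let poly_cvg e (p : {poly R}) k : 0 < e ->
  I_ n (fun x => lap e x ^+ k * p.[lap e x]) @[n --> \oo] -->
  J (fun x => lap e x ^+ k * p.[lap e x]).
Proof.
move=> e0; elim/poly_ind: p k => [|p c IH] k.
  rewrite (_ : (fun x => lap e x ^+ k * _.[_]) = (fun x => 0 * 1 + 0 * 1)); last first.
    by apply/funext => x; rewrite horner0; ring.
  have E I : expectation_on I -> I (fun x => 0 * 1 + 0 * 1) = 0.
    move=> [_ lin _].
    by rewrite (lin 0 0 (fun=> 1) (fun=> 1)) ?mul0r ?addr0 //; exact: right_bounded_cst.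
  rewrite E // (_ : (fun n => _) = cst 0); first exact: cvg_cst.
  by apply/funext => n; rewrite E.
pose f x := lap e x ^+ k.+1 * p.[lap e x]; pose g x := lap e x ^+ k.
have rf : right_bounded f.
  by apply: right_bounded_mul; [exact: right_bounded_lapX|exact: right_bounded_poly].
have rg : right_bounded g by exact: right_bounded_lapX.
rewrite (_ : (fun x => lap e x ^+ k * _.[_]) = (fun x => 1 * f x + c * g x)); last first.
  by apply/funext => x; rewrite hornerMXaddC /f /g exprS; ring.
have [_ -> // _] := J_exp.
rewrite (_ : (fun n => _) = (fun n => 1 * I_ n f + c * I_ n g)); last first.
  by apply/funext => n; have [_ -> // _] := I_exp n.
apply: cvgD; apply: cvgM; (try exact: cvg_cst); first exact: IH.
exact: lapX_cvg.
Qed.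

Let tilt_error I e f M : 0 < e -> expectation_on I -> right_bounded f ->
  (forall x, -1 <= x -> `|f x| <= M) ->
  `|I f - I (fun x => lap e x * f x)| <= M * (1 - I (lap e)).
Proof.
move=> e0 [I1 lin mono] rf fM.
have rl := right_bounded_lap _ e0; have r1 := right_bounded_cst 1.
have rlf := right_bounded_mul _ _ rl rf.
have -> : M * (1 - I (lap e)) = I (fun x => M * 1 + (- M) * lap e x).
  by rewrite lin // I1; ring.
have -> : I f - I (fun x => lap e x * f x) = I (fun x => 1 * f x + (-1) * (lap e x * f x)).
  by rewrite lin //; ring.
have rb := right_bounded_comb M (- M) _ _ r1 rl.
have rc := right_bounded_comb 1 (-1) _ _ rf rlf.
have key x : -1 <= x -> `|1 * f x + (-1) * (lap e x * f x)| <= M * 1 + (- M) * lap e x.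
  move=> x1; have l1 := lap_le1 _ _ e0 x1.
  have -> : 1 * f x + -1 * (lap e x * f x) = (1 - lap e x) * f x by ring.
  have -> : M * 1 + - M * lap e x = (1 - lap e x) * M by ring.
  by rewrite normrM ger0_norm ?subr_ge0 // ler_wpM2l ?subr_ge0 // fM.
rewrite ler_norml; apply/andP; split; last first.
  by apply: mono => // x /key; apply: le_trans; exact: ler_norm.
rewrite -[X in - X]mul1r -mulNr -[leLHS]addr0 -[X in _ + X](mul0r (I (fun=> 1))) -lin //.
apply: mono => //; first exact: right_bounded_comb.
by move=> x /key; rewrite ler_norml => /andP[+ _]; lra.
Qed.

Let expectation_close I f g d : expectation_on I -> right_bounded f -> right_bounded g ->
  (forall x, -1 <= x -> `|f x - g x| <= d) -> `|I f - I g| <= d.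
Proof.
move=> [I1 lin mono] rf rg fg.
have r1 := right_bounded_cst 1.
have up f' g' : right_bounded f' -> right_bounded g' ->
    (forall x, -1 <= x -> `|f' x - g' x| <= d) -> I f' <= I g' + d.
  move=> rf' rg' h; have -> : I g' + d = I (fun x => 1 * g' x + d * 1).
    by rewrite lin // I1; ring.
  apply: mono => //; first exact: right_bounded_comb.
  by move=> x /h; rewrite ler_norml => /andP[_]; lra.
have := up f g rf rg fg.
have := up g f rg rf (fun x hx => eq_ind _ (fun z => z <= d) (fg x hx) _ (distrC _ _)).
by rewrite ler_norml; lra.
Qed.

(** For small [e] replacing [f] by [lap e * f] changes expectations
    little, uniformly in [n], since [1 - lap e] has small expectation; this is the
    tightness argument.  The function [lap e * f] is a continuous function of
    [lap e] on the unit interval, vanishing at 0, hence uniformly close to a polynomial in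
    [lap e], and expectations of such polynomials converge by hypothesis. *)
Lemma laplace_weak f : right_bounded f -> I_ n f @[n --> \oo] --> J f.
Proof.
move=> rf; have [cf [M fM]] := rf.
have M0 : 0 <= M by apply: le_trans (fM 0 _); rewrite ?normr_ge0 //; lra.
apply/cvgrPdist_le => eta eta0.
(* Five error terms are collected at the end: two tilts, two polynomial
   approximations and the convergence of the polynomial. *)
pose q := eta / (8 * (M + 1)).
have q0 : 0 < q by rewrite divr_gt0 // mulr_gt0 // ltr_pwDr.
have Mq : M * q <= eta / 8.
  by rewrite /q mulrA ler_pdivrMr ?mulr_gt0 ?ltr_pwDr //; nra.
have [e e0 Je] := J_lap _ q0.
(* The function lap e * f in the variable u = lap e, extended by zero; the
   factor u makes it continuous at 0, which corresponds to x = +oo. *)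
pose h (u : R) : R := if u <= 0 then 0 else u * f (- ln u / e - 1).
have hu x : h (lap e x) = lap e x * f x.
  rewrite /h leNgt lap_gt0 /= /lap expRK; congr (_ * f _).
  by field; rewrite gt_eqF.
have lt1 (u : R) : 0 < u <= 1 -> -1 <= - ln u / e - 1.
  move=> /andP[u0 u1]; rewrite -[leLHS]add0r lerD2r divr_ge0 ?(ltW e0) //.
  by rewrite oppr_ge0 ln_le0.
have hb u : 0 <= u <= 1 -> `|h u| <= M.
  move=> /andP[]; rewrite le_eqVlt => /orP[/eqP <-|u0] u1.
    by rewrite /h lexx normr0.
  rewrite /h (leNgt u) u0 /= normrM gtr0_norm // -[leRHS]mul1r ler_pM ?(ltW u0) //.
  by rewrite fM // lt1 // u0.
have ch : continuous h.
  move=> u; have [u0|u0|u0] := ltgtP u 0.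
  - apply: (@near_cst_continuous _ _ 0).
    near=> y; rewrite /h ifT //; apply: ltW; near: y; exact: lt_nbhsl.
  - have : {for u, continuous (fun w : R => w * f (- ln w / e - 1))}.
      apply: cvgM; first exact: cvg_id.
      apply: (@continuous_comp _ _ _ (fun w : R => - ln w / e - 1) f); last exact: cf.
      apply: cvgB; last exact: cvg_cst.
      apply: cvgM; last exact: cvg_cst.
      by apply: cvgN; apply: continuous_ln.
    rewrite /continuous_at /prop_for /= => H.
    have -> : h u = u * f (- ln u / e - 1) by rewrite /h leNgt u0.
    apply: cvg_trans H; apply: near_eq_cvg; near=> y.
    rewrite /h leNgt ifF //; apply/negbTE; rewrite negbK; near: y; exact: lt_nbhsr.
  - apply/cvgrPdist_le => d d0; rewrite u0; near=> y.
    rewrite {1}/h lexx sub0r normrN /h; case: ifPn => [_|]; first by rewrite normr0 ltW.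
    rewrite -ltNge => y0; rewrite normrM gtr0_norm //.
    have y1 : y <= 1 by apply: ltW; near: y; exact: lt_nbhsl.
    apply: (@le_trans _ _ (y * (M + 1))).
      rewrite ler_wpM2l ?(ltW y0) // (@le_trans _ _ M) ?lerDl // fM // lt1 //.
      by rewrite y0.
    rewrite -ler_pdivlMr ?ltr_pwDr //; apply: ltW; near: y; apply: lt_nbhsl.
    by rewrite divr_gt0 // ltr_pwDr.
have [p hp] := bernstein_approx h M (eta / 8) ch hb (divr_gt0 eta0 (ltr0Sn _ 7)).
have rl := right_bounded_lap _ e0.
have rlf := right_bounded_mul _ _ rl rf.
have rp := right_bounded_poly _ p e0.
have pf I : expectation_on I ->
    `|I (fun x => p.[lap e x]) - I (fun x => lap e x * f x)| <= eta / 8.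
  move=> I0; apply: expectation_close => // x x1; rewrite -hu; apply: hp.
  by rewrite ltW ?lap_gt0 // lap_le1.
have P : I_ n (fun x => p.[lap e x]) @[n --> \oo] --> J (fun x => p.[lap e x]).
  have E : (fun x => p.[lap e x]) = (fun x => lap e x ^+ 0 * p.[lap e x]).
    by apply/funext => x; rewrite expr0 mul1r.
  by rewrite E; exact: poly_cvg.
have eta8 : 0 < eta / 8 by rewrite divr_gt0.
near=> n.
have h1 : `|J (fun x => p.[lap e x]) - I_ n (fun x => p.[lap e x])| <= eta / 8.
  by near: n; move/cvgrPdist_le : P => /(_ _ eta8).
have h2 : `|J (lap e) - I_ n (lap e)| <= q.
  by near: n; move/cvgrPdist_le : (lap_cvg _ e0) => /(_ _ q0).
have tI := tilt_error _ _ _ _ e0 (I_exp n) rf fM.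
have tJ := tilt_error _ _ _ _ e0 J_exp rf fM.
have pI := pf _ (I_exp n).
have pJ := pf _ J_exp.
have bJ : M * (1 - J (lap e)) <= M * q by rewrite ler_wpM2l //; lra.
have bI : M * (1 - I_ n (lap e)) <= M * (2 * q).
  by rewrite ler_wpM2l //; move: h2; rewrite ler_norml; lra.
move: h1 tI tJ pI pJ; rewrite !ler_norml; lra.
Unshelve. all: end_near. Qed.
End LaplaceWeak.

(** * The Gamma integral *)

Section GammaIntegral.
Context {R : realType}.
Implicit Types (v c a x : R).
Local Notation mu := (@lebesgue_measure R).

Definition gamma_kernel v c x : R := x `^ (v - 1) * expR (- (c * x)).

Lemma gamma_kernel_ge0 v c x : 0 <= gamma_kernel v c x.
Proof. by rewrite mulr_ge0 ?powR_ge0 ?expR_ge0. Qed.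

Lemma gamma_kernel_cont v c x : 0 < x -> {for x, continuous (gamma_kernel v c)}.
Proof.
move=> x0; apply: cvgM.
  have [dP _] := is_derive1_powR (v - 1) x0.
  exact: (differentiable_continuous ((derivable1_diffP _ _).1 dP)).
apply: continuous_comp; last exact: continuous_expR.
by apply: cvgN; apply: cvgM; [exact: cvg_cst|exact: cvg_id].
Qed.

Lemma measurable_gamma_kernel v c : measurable_fun [set: R] (gamma_kernel v c).
Proof.
apply: measurable_funM; first exact: measurable_powR.
apply: measurableT_comp => //; apply: measurableT_comp => //.
Qed.

(** Linear substitution.  The half-line starts away from 0
    because the kernel is singular there when [v < 1]. *)
Lemma gamma_kernel_scale v c a : 0 < c -> 0 < a ->
  (\int[mu]_(x in `[(c * a)%R, +oo[) (gamma_kernel v 1 x)%:E =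
   (c `^ v)%:E * \int[mu]_(x in `[a, +oo[) (gamma_kernel v c x)%:E)%E.
Proof.
move=> c0 a0.
pose F (x : R) : R := c * x.
have F' : F^`()%classic = cst c.
  by apply/funext => x; rewrite derive1E derive_val /GRing.scale /= mulr1.
rewrite (@increasing_ge0_integration_by_substitutiony _ F _ a) //; first last.
- by move=> x _; exact: gamma_kernel_ge0.
- apply: continuous_in_subspaceT => x /set_mem /=; rewrite in_itv /= andbT => xa.
  by apply: gamma_kernel_cont; rewrite (lt_le_trans _ xa) // mulr_gt0.
- exact: gt0_cvgMry.
- split.
    by move=> x _; exact: ex_derive.
  apply: cvg_at_right_filter; apply: cvgM; [exact: cvg_cst|exact: cvg_id].
- by rewrite F'; exact: is_cvg_cst.
- by rewrite F'; exact: is_cvg_cst.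
- by rewrite F' => x _; exact: cvg_cst.
- by move=> x y _ _ xy; rewrite /F ltr_pM2l.
rewrite -ge0_integralZl //=; first last.
- by rewrite lee_fin powR_ge0.
- by move=> x _; rewrite lee_fin gamma_kernel_ge0.
- apply/measurable_EFinP/measurable_funTS; exact: measurable_gamma_kernel.
apply: eq_integral => x; rewrite inE /= in_itv /= andbT => xa.
have x0 : 0 < x by exact: lt_le_trans xa.
rewrite -EFinM; congr EFin; rewrite F' /gamma_kernel /F.
transitivity ((c * x) `^ (v - 1) * expR (- (1 * (c * x))) * c); first by [].
rewrite mul1r.
rewrite powRM ?(ltW c0) ?(ltW x0) //.
have -> : c `^ v = c * c `^ (v - 1).
  have [v0|v0] := eqVneq v 0; first by rewrite v0 sub0r powRr0 powR_inv1 ?mulfV ?gt_eqF // ltW.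
  by rewrite -{2}[c](powRr1 (ltW c0)) -powRD ?(gt_eqF c0) ?implybT // addrC subrK.
by ring.
Qed.

Lemma gamma_integral_cvg v c b : 0 < b ->
  (\int[mu]_(x in `[(b / k.+1%:R)%R, +oo[) (gamma_kernel v c x)%:E @[k --> \oo] -->
   \int[mu]_(x in `[0%R, +oo[) (gamma_kernel v c x)%:E)%E.
Proof.
move=> b0.
have mk : measurable_fun [set: R] (EFin \o gamma_kernel v c).
  by apply/measurable_EFinP; exact: measurable_gamma_kernel.
rewrite -integral_itv_obnd_cbnd; last exact: measurable_funTS.
have -> : `]0%R, +oo[%classic = \bigcup_k `[(b / k.+1%:R)%R, +oo[%classic :> set R.
  apply/seteqP; split => x /=; rewrite in_itv /= andbT.
    move=> x0; exists (Num.truncn (b / x)) => //=; rewrite in_itv /= andbT.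
    have := truncnS_gt (b / x); rewrite ltr_pdivrMr // => h.
    by rewrite ler_pdivrMr // mulrC ltW.
  by move=> [k _] /=; rewrite in_itv /= andbT; apply: lt_le_trans; rewrite divr_gt0.
apply: ge0_nondecreasing_set_cvg_integral => //.
- apply/nondecreasing_seqP => k; rewrite subsetEset => x /=; rewrite !in_itv /= !andbT.
  apply: le_trans; rewrite ler_pM2l // lef_pV2 ?posrE //.
  by rewrite ler_nat.
- by move=> k; exact: measurable_funTS.
- by move=> k x _; rewrite lee_fin gamma_kernel_ge0.
Qed.

Definition gamma_integral v c : \bar R := (\int[mu]_(x in `[0%R, +oo[) (gamma_kernel v c x)%:E)%E.

Lemma gamma_integral_scale v c : 0 < c ->
  gamma_integral v 1 = ((c `^ v)%:E * gamma_integral v c)%E.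
Proof.
move=> c0.
have h1 := gamma_integral_cvg v 1 c c0.
have h2 := gamma_integral_cvg v c 1 ltr01.
have h3 : ((c `^ v)%:E * (\int[mu]_(x in `[(1 / k.+1%:R)%R, +oo[) (gamma_kernel v c x)%:E) @[k --> \oo]
   --> (c `^ v)%:E * gamma_integral v c)%E.
  by apply: cvgeZl => //.
have E : (fun k : nat => \int[mu]_(x in `[(c / k.+1%:R)%R, +oo[) (gamma_kernel v 1 x)%:E)%E =
  (fun k : nat => (c `^ v)%:E * (\int[mu]_(x in `[(1 / k.+1%:R)%R, +oo[) (gamma_kernel v c x)%:E))%E.
  by apply/funext => k; rewrite -gamma_kernel_scale // mul1r.
rewrite -E in h3.
exact: (cvg_unique _ h1 h3).
Qed.

(** A power is dominated by [exp (x / 2)], through a linear bound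
    on the logarithm with small slope. *)
Lemma gamma_kernel_tail v : exists2 C : R, 0 < C &
  forall x, 1 <= x -> gamma_kernel v 1 x <= C * exponential_pdf (1 / 2) x.
Proof.
(* The slope 1 / q is small enough for p / q <= 1 / 2. *)
pose p := `|v - 1|; pose q := 2 * p + 1.
have p0 : 0 <= p by exact: normr_ge0.
have q0 : 0 < q by rewrite /q; lra.
exists (2 * expR (p * ln q)); first by rewrite mulr_gt0 ?expR_gt0.
move=> x x1; have x0 : 0 < x by exact: lt_le_trans x1.
rewrite exponential_pdfE ?(ltW x0) // /gamma_kernel /powR (gt_eqF x0).
have -> : 2 * expR (p * ln q) * (1 / 2 * expR (- (1 / 2) * x)) =
   expR (p * ln q + - (1 / 2) * x) by rewrite expRD; field.
rewrite -expRD ler_expR mul1r.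
have lx : 0 <= ln x by exact: ln_ge0.
have h1 : (v - 1) * ln x <= p * ln x by rewrite ler_wpM2r // ler_norm.
have h2 : ln x <= x / q + ln q.
  rewrite -lerBlDr -ln_div ?posrE //; apply/ltW/ln_sublinear.
  by rewrite divr_gt0.
have h3 : p * ln x <= p * (x / q + ln q) by rewrite ler_wpM2l.
have h4 : p * (x / q) <= x / 2.
  rewrite mulrA ler_pdivrMr // /q; nra.
rewrite mulrDr in h3; lra.
Qed.

Lemma integral_powR_le v a : 0 < v -> 0 < a < 1 ->
  (\int[mu]_(x in `[a, 1%R]) (x `^ (v - 1))%:E <= (v^-1)%:E)%E.
Proof.
move=> v0 /andP[a0 a1].
have cp x : 0 < x -> forall w, {for x, continuous (fun y : R => y `^ w)}.
  move=> x0 w; have [dP _] := is_derive1_powR w x0.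
  exact: (differentiable_continuous ((derivable1_diffP _ _).1 dP)).
pose F x : R := v^-1 * x `^ v.
have dF x : 0 < x -> is_derive x (1 : R) F (x `^ (v - 1)).
  move=> x0; have dP := is_derive1_powR v x0.
  rewrite (_ : F = v^-1 \*: (@powR R ^~ v)) //.
  by apply: is_derive_eq; rewrite /GRing.scale /= mulrA mulVf ?mul1r // gt_eqF.
have cF x : 0 < x -> F y @[y --> x] --> F x.
  by move=> x0; apply: cvgM; [exact: cvg_cst|exact: cp].
rewrite (@continuous_FTC2 _ _ F) //.
- rewrite /F powR1 mulr1 -EFinB lee_fin gerBl mulr_ge0 ?powR_ge0 //.
  by rewrite invr_ge0 ltW.
- apply: continuous_in_subspaceT => x /set_mem /=; rewrite in_itv /= => /andP[ax _].
  by apply: cp; exact: lt_le_trans ax.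
- split.
  + move=> x; rewrite in_itv /= => /andP[ax _].
    exact: (@ex_derive _ _ _ _ _ _ _ (dF x (lt_trans a0 ax))).
  + by apply: cvg_at_right_filter; exact: cF.
  + by apply: cvg_at_left_filter; apply: cF.
- move=> x; rewrite in_itv /= => /andP[ax _].
  by rewrite derive1E; apply: (@derive_val _ _ _ _ _ _ _ (dF x (lt_trans a0 ax))).
Qed.

(** Near 0 the kernel is below an integrable power, beyond 1 it is
    below a multiple of the exponential density of rate 1/2. *)
Lemma gamma_integral_fin v : 0 < v -> (gamma_integral v 1 < +oo)%E.
Proof.
move=> v0; have [C C0 hC] := gamma_kernel_tail v.
apply: (@le_lt_trans _ _ (v^-1 + C)%:E); last exact: ltry.
have half0 : (0 : R) < 1 / 2 by lra.
apply: cvge_to_le (gamma_integral_cvg v 1 (1 / 2) half0) _.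
near=> k; set a := (1 / 2 / k.+1%:R).
have a0 : 0 < a by rewrite divr_gt0.
have a1 : a < 1.
  rewrite ltr_pdivrMr // mul1r.
  have : 1 <= k.+1%:R :> R by rewrite ler1n.
  lra.
have mk D : measurable_fun D (EFin \o gamma_kernel v 1).
  by apply/measurable_EFinP/measurable_funTS; exact: measurable_gamma_kernel.
have -> : `[a, +oo[%classic = `[a, 1%R] `|` `]1%R, +oo[ :> set R.
  apply/seteqP; split => x /=; rewrite !in_itv /= !andbT.
    by move=> ax; case: (leP x 1) => x1; [left; rewrite ax|right].
  by case=> [/andP[]//|x1]; rewrite (le_trans (ltW a1)) // ltW.
rewrite ge0_integral_setU //=; last 3 first.
- exact: mk.
- by move=> x _; rewrite lee_fin gamma_kernel_ge0.
- apply/disj_setPS => x [] /=; rewrite !in_itv /= andbT => /andP[_ x1].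
  by rewrite ltNge x1.
rewrite EFinD; apply: leeD.
  apply: le_trans (integral_powR_le _ a v0 _); last by rewrite a0.
  apply: ge0_le_integral => //.
  - by move=> x _; rewrite lee_fin gamma_kernel_ge0.
  - exact: mk.
  - by apply/measurable_EFinP/measurable_funTS; exact: measurable_powR.
  - move=> x /=; rewrite in_itv /= => /andP[ax _].
    rewrite lee_fin /gamma_kernel mul1r ler_piMr ?powR_ge0 // -expR0 ler_expR.
    by rewrite oppr_le0 (le_trans _ ax) // ltW.
have half1 : (0 : R) <= 1 / 2 by lra.
have me D : measurable_fun D (EFin \o exponential_pdf (1 / 2 : R)).
  by apply/measurable_EFinP/measurable_funTS; exact: measurable_exponential_pdf.
apply: (@le_trans _ _ (C%:E * \int[mu]_x (exponential_pdf (1 / 2) x)%:E)%E); last first.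
  by rewrite integral_exponential_pdf // mule1.
rewrite -ge0_integralZl //=; last 3 first.
- exact: me.
- by move=> x _; rewrite lee_fin exponential_pdf_ge0.
- by rewrite lee_fin ltW.
apply: (@le_trans _ _ (\int[mu]_(x in `]1%R, +oo[) (C%:E * (exponential_pdf (1 / 2) x)%:E)%E)%E).
  apply: ge0_le_integral => //.
  - by move=> x _; rewrite lee_fin gamma_kernel_ge0.
  - exact: mk.
  - by apply: measurable_funeM; exact: me.
  - move=> x /=; rewrite in_itv /= andbT => x1.
    by rewrite -EFinM lee_fin hC // ltW.
apply: ge0_subset_integral => //=.
- by apply: measurable_funeM; exact: me.
- by move=> x _; rewrite mule_ge0 ?lee_fin ?exponential_pdf_ge0 // ltW.
Unshelve. all: end_near. Qed.

Lemma gamma_integral_gt0 v : (0 < gamma_integral v 1)%E.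
Proof.
pose q : R := expR (- (`|v - 1| * ln 2 + 2)).
have q0 : 0 < q by exact: expR_gt0.
apply: (@lt_le_trans _ _ (\int[mu]_(x in `[1%R, 2%R]) (cst q%:E) x)%E).
  rewrite integral_cst //= lebesgue_measure_itv /= lte_fin ltr1n.
  by rewrite -EFinB mule_gt0 // lte_fin //; lra.
have mk D : measurable_fun D (EFin \o gamma_kernel v 1).
  by apply/measurable_EFinP/measurable_funTS; exact: measurable_gamma_kernel.
apply: (@le_trans _ _ (\int[mu]_(x in `[1%R, 2%R]) (gamma_kernel v 1 x)%:E)%E).
  apply: ge0_le_integral => //.
  - by move=> x _; rewrite lee_fin ltW.
  - exact: mk.
  move=> x /=; rewrite in_itv /= => /andP[x1 x2]; rewrite lee_fin.
  have x0 : 0 < x by exact: lt_le_trans x1.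
  rewrite /gamma_kernel /powR (gt_eqF x0) -expRD ler_expR mul1r.
  have l0 : 0 <= ln x by exact: ln_ge0.
  have l2 : ln x <= ln 2 by rewrite ler_ln ?posrE.
  have h1 : - (`|v - 1| * ln x) <= (v - 1) * ln x.
    by rewrite -mulNr ler_wpM2r // lerNl -normrN ler_norm.
  have h2 : `|v - 1| * ln x <= `|v - 1| * ln 2 by rewrite ler_wpM2l.
  lra.
apply: ge0_subset_integral => //.
- exact: mk.
- by move=> x _; rewrite lee_fin gamma_kernel_ge0.
- by move=> x /=; rewrite !in_itv /= andbT => /andP[x1 _]; rewrite (le_trans _ x1).
Qed.

End GammaIntegral.

(** * Finite measures with a density *)

Section Density.
Context {R : realType} (g : R -> R).
Local Notation mu := (@lebesgue_measure R).
Hypotheses (g0 : forall x, 0 <= g x) (mg : measurable_fun [set: R] g)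
  (gi : (\int[mu]_x (g x)%:E < +oo)%E).

(** The three arguments serve to make this a finite measure for every
    admissible [g]. *)
Definition density of (forall x, 0 <= g x) & measurable_fun [set: R] g
    & (\int[mu]_x (g x)%:E < +oo)%E : set (measurableTypeR R) -> \bar R :=
  fun A => (\int[mu]_(x in A) (g x)%:E)%E.

Local Notation nu := (density g0 mg gi).

Let nu_0 : nu set0 = 0%E. Proof. by rewrite /density integral_set0. Qed.

Let nu_ge0 A : (0 <= nu A)%E.
Proof. by apply: integral_ge0 => x _; rewrite lee_fin. Qed.

Let nu_additive : semi_sigma_additive nu.
Proof.
move=> /= F mF tF mUF; rewrite /density; apply: cvg_toP.
  apply: ereal_nondecreasing_is_cvgn => a b ab.
  apply: lee_sum_nneg_natr => // k _ _; apply: integral_ge0 => /= x _.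
  by rewrite lee_fin.
rewrite ge0_integral_bigcup //=; last by move=> x _; rewrite lee_fin.
by apply/measurable_funTS/measurableT_comp.
Qed.

HB.instance Definition _ := isMeasure.Build _ _ _ nu nu_0 nu_ge0 nu_additive.

Let nu_fin : fin_num_fun nu.
Proof.
move=> A mA; rewrite ge0_fin_numE ?nu_ge0 //; apply: le_lt_trans gi.
apply: ge0_subset_integral => //; first exact/measurable_EFinP.
by move=> x _; rewrite lee_fin.
Qed.

HB.instance Definition _ := @Measure_isFinite.Build _ _ _ nu nu_fin.

Let mgE : measurable_fun [set: R] (EFin \o g).
Proof. exact/measurable_EFinP. Qed.

Lemma density_integrable : mu.-integrable [set: R] (EFin \o g).
Proof.
apply/integrableP; split => //.
by under eq_integral do rewrite /= ger0_norm //.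
Qed.

Lemma density_dominates : nu `<< mu.
Proof.
apply/null_content_dominatesP => A mA A0.
by rewrite /= /density null_set_integral //; exact: measurable_funTS.
Qed.

(** By Radon-Nikodym: [g] is a version of the derivative. *)
Lemma integral_density (f : R -> \bar R) : nu.-integrable [set: R] f ->
  (\int[nu]_x f x = \int[mu]_x (f x * (g x)%:E))%E.
Proof.
move=> fi; rewrite -(Radon_Nikodym_change_of_variables density_dominates) //=.
have mf := measurable_int _ fi.
apply: ae_eq_integral => //.
- apply: emeasurable_funM => //; apply: (measurable_int mu).
  by apply: Radon_Nikodym_integrable; exact: density_dominates.
- exact: emeasurable_funM.
apply: ae_eqe_mul2l => /=.
rewrite Radon_NikodymE //=; first exact: density_dominates.
move=> dom; case: cid => /= h [h1 h2 h3].
by apply: integral_ae_eq => //= E _ mE; rewrite -h3.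
Qed.

End Density.

(** * The Gamma law *)

Section GammaLaw.
Context {R : realType} (v s : R).
Hypotheses (v_gt0 : 0 < v) (s_gt0 : 0 < s).
Local Notation mu := (@lebesgue_measure R).
Local Notation pdf := (gamma_pdf v s).

Let Z : R := Gamma v * s `^ v.

Lemma Gamma_gamma_integral : (Gamma v)%:E = gamma_integral v 1.
Proof.
rewrite /Gamma /Rintegral fineK.
  by apply: eq_integral => x _; rewrite /gamma_kernel mul1r.
rewrite ge0_fin_numE; last first.
  by apply: integral_ge0 => x _; rewrite lee_fin mulr_ge0 ?powR_ge0 ?expR_ge0.
apply: le_lt_trans (gamma_integral_fin v v_gt0).
by rewrite le_eqVlt; apply/orP; left; apply/eqP; apply: eq_integral => x _; rewrite /gamma_kernel mul1r.
Qed.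

Lemma Gamma_gt0 : 0 < Gamma v.
Proof. by rewrite -lte_fin Gamma_gamma_integral gamma_integral_gt0. Qed.

Lemma gamma_normalizer_gt0 : 0 < Z.
Proof. by rewrite mulr_gt0 ?Gamma_gt0 ?powR_gt0. Qed.

Lemma gamma_pdfE x : 0 <= x -> pdf x = Z^-1 * gamma_kernel v s^-1 x.
Proof.
move=> x0; rewrite /gamma_pdf patchE ifT ?inE /= ?in_itv /= ?x0 //.
by rewrite -mulrA /gamma_kernel mulNr (mulrC x).
Qed.

Lemma gamma_pdf_lt0 x : x < 0 -> pdf x = 0.
Proof.
move=> x0; rewrite /gamma_pdf patchE ifF //; apply/negP.
by rewrite inE /= in_itv /= andbT leNgt x0.
Qed.

Lemma gamma_pdf_ge0 x : 0 <= pdf x.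
Proof.
have [x0|x0] := leP 0 x; last by rewrite gamma_pdf_lt0.
by rewrite gamma_pdfE // mulr_ge0 ?gamma_kernel_ge0 // invr_ge0 ltW // gamma_normalizer_gt0.
Qed.

Lemma measurable_gamma_pdf : measurable_fun [set: R] pdf.
Proof.
rewrite /gamma_pdf; apply/measurable_restrict => //; apply: measurable_funTS.
apply: measurable_funM.
  by apply: measurable_funM => //; exact: measurable_powR.
apply: measurableT_comp => //; apply: measurable_funM => //.
Qed.

(** Tilting the density by [exp (- e x)] only changes the rate of the
    kernel, so the scaling of the Gamma integral gives the value. *)
Lemma gamma_laplaceE e : 0 <= e ->
  (\int[mu]_x (expR (- (e * x)) * pdf x)%:E = ((1 + s * e) `^ (- v))%:E)%E.
Proof.
move=> e0; have se0 : 0 < s^-1 + e by rewrite ltr_pwDl // invr_gt0.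
have pos : 0 < 1 + s * e by rewrite ltr_pwDl // mulr_ge0 // ltW.
rewrite (_ : (fun x => _) = (fun x => (Z^-1)%:E * (gamma_kernel v (s^-1 + e) x)%:E)%E \_ `[0%R, +oo[); last first.
  apply/funext => x; rewrite patchE; case: ifPn => [|].
    rewrite inE /= in_itv /= andbT => x0; rewrite -EFinM; congr EFin.
    rewrite gamma_pdfE // mulrCA; congr (_ * _); rewrite /gamma_kernel mulrCA; congr (_ * _).
    by rewrite -expRD; congr expR; ring.
  rewrite notin_setE /= in_itv /= andbT => /negP; rewrite -ltNge => x0.
  by rewrite gamma_pdf_lt0 // mulr0.
rewrite -integral_mkcond ge0_integralZl //=; last 3 first.
- apply/measurable_EFinP/measurable_funTS; exact: measurable_gamma_kernel.
- by move=> x _; rewrite lee_fin gamma_kernel_ge0.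
- by rewrite lee_fin invr_ge0 ltW // gamma_normalizer_gt0.
rewrite -/(gamma_integral v (s^-1 + e)).
have := gamma_integral_scale v _ se0; rewrite -Gamma_gamma_integral => G.
have p0 : 0 < (s^-1 + e) `^ v by exact: powR_gt0.
have -> : gamma_integral v (s^-1 + e) = (Gamma v / (s^-1 + e) `^ v)%:E.
  have -> : (Gamma v / (s^-1 + e) `^ v)%:E = ((((s^-1 + e) `^ v)^-1)%:E * (Gamma v)%:E)%E.
    by rewrite -EFinM mulrC.
  by rewrite G muleA -EFinM mulVf ?gt_eqF // mul1e.
rewrite -EFinM; congr EFin.
have -> : 1 + s * e = s * (s^-1 + e) by field; rewrite gt_eqF.
rewrite powRN powRM ?(ltW s_gt0) ?(ltW se0) // /Z.
have sv : 0 < s `^ v by exact: powR_gt0.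
by field; rewrite !gt_eqF // Gamma_gt0.
Qed.

Lemma integral_gamma_pdf : (\int[mu]_x (pdf x)%:E = 1)%E.
Proof.
have := gamma_laplaceE 0 (lexx 0); rewrite mulr0 addr0 powR1 => <-.
by apply: eq_integral => x _; rewrite mul0r oppr0 expR0 mul1r.
Qed.

Definition gamma_mean (f : R -> R) : R := \int[mu]_x (f x * pdf x).

Lemma gamma_integrable f : right_bounded f ->
  mu.-integrable [set: R] (EFin \o (fun x => f x * pdf x)).
Proof.
move=> [cf [M fM]].
have mf : measurable_fun [set: R] f by exact: continuous_measurable_fun.
have mpdf := measurable_gamma_pdf.
apply: (@le_integrable _ _ _ mu _ measurableT _ (EFin \o (fun x => M * pdf x))).
- by apply/measurable_EFinP; exact: measurable_funM.
- move=> x _ /=; rewrite lee_fin !normrM.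
  have [x0|x0] := leP 0 x; last by rewrite gamma_pdf_lt0 // normr0 !mulr0.
  rewrite ler_wpM2r // (le_trans (fM x _)) ?ler_norm //; lra.
- have : mu.-integrable [set: R] (fun x => M%:E * (pdf x)%:E)%E.
    apply: integrableZl => //; apply: density_integrable => //.
    + exact: gamma_pdf_ge0.
    + by rewrite integral_gamma_pdf ltry.
  by apply: eq_integrable => // x _; rewrite /= EFinM.
Qed.

Lemma gamma_mean_expectation : expectation_on gamma_mean.
Proof.
split.
- rewrite /gamma_mean /Rintegral (_ : (fun x => _) = (fun x => (pdf x)%:E)).
    by rewrite integral_gamma_pdf.
  by apply/funext => x; rewrite mul1r.
- move=> a b f g rf rg; rewrite /gamma_mean.
  rewrite -RintegralZl //; last exact: gamma_integrable.
  rewrite -RintegralZl //; last exact: gamma_integrable.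
  rewrite -RintegralD //=.
  + by apply: eq_Rintegral => x _; ring.
  + apply: (@eq_integrable _ _ _ mu _ measurableT (fun x => a%:E * (f x * pdf x)%:E)%E).
      by move=> x _; rewrite -EFinM.
    by apply: integrableZl => //; exact: gamma_integrable.
  + apply: (@eq_integrable _ _ _ mu _ measurableT (fun x => b%:E * (g x * pdf x)%:E)%E).
      by move=> x _; rewrite -EFinM.
    by apply: integrableZl => //; exact: gamma_integrable.
- move=> f g rf rg fg; apply: le_Rintegral => //; try exact: gamma_integrable.
  move=> x _; have [x0|x0] := leP 0 x; last by rewrite gamma_pdf_lt0 // !mulr0.
  by rewrite ler_wpM2r ?gamma_pdf_ge0 // fg //; lra.
Qed.

Lemma gamma_mean_lap e : 0 < e -> gamma_mean (lap e) = expR (- e) * (1 + s * e) `^ (- v).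
Proof.
move=> e0; rewrite /gamma_mean.
rewrite (@eq_Rintegral _ _ _ mu [set: R] (fun x => expR (- e) * (expR (- (e * x)) * pdf x))); last first.
  by move=> x _; rewrite mulrA -expRD; congr (expR _ * _); ring.
rewrite RintegralZl //; last first.
  apply: gamma_integrable; split; last exists (expR e) => x x1.
    move=> x; apply: continuous_comp; last exact: continuous_expR.
    by apply: cvgN; apply: cvgM; [exact: cvg_cst|exact: cvg_id].
  by rewrite ger0_norm ?expR_ge0 // ler_expR; nra.
by congr (_ * _); rewrite /Rintegral gamma_laplaceE // ltW.
Qed.

Lemma integral_gamma_prob f : right_bounded f -> bounded_fun f ->
  (\int[gamma_prob v s]_x (f x)%:E = (gamma_mean f)%:E)%E.
Proof.
move=> rf bf; have [cf _] := rf.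
have gi : (\int[mu]_x (pdf x)%:E < +oo)%E by rewrite integral_gamma_pdf ltry.
transitivity (\int[density _ gamma_pdf_ge0 measurable_gamma_pdf gi]_x (f x)%:E)%E.
  by [].
rewrite integral_density.
  rewrite /gamma_mean /Rintegral fineK; first by apply: eq_integral => x _; rewrite EFinM.
  by apply: integrable_fin_num => //; exact: gamma_integrable.
apply: measurable_bounded_integrable => //.
- exact: continuous_measurable_fun.
Qed.

End GammaLaw.

(** * Integrals against a finitely supported law *)

Section LawIntegral.
Context {R : realType} (T : finType) (p X : T -> R).
Hypothesis p_ge0 : forall t, 0 <= p t.

Let atom (t : T) : {measure set (measurableTypeR R) -> \bar R} :=
  mscale (NngNum (p_ge0 t)) (\d_(X t : measurableTypeR R)).

Let atoms (k : nat) : {measure set (measurableTypeR R) -> \bar R} :=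
  if insub k is Some i then atom (@enum_val T predT i) else mzero.

Let lawE : law p X = msum atoms #|T|.
Proof.
apply/funext => A; rewrite /law /msum big_enum_val /=.
by apply: eq_bigr => i _; rewrite /atoms valK.
Qed.

Lemma ge0_integral_law (f : R -> \bar R) : measurable_fun [set: R] f ->
  (forall x, (0 <= f x)%E) ->
  (\int[law p X]_x f x = \sum_t (p t)%:E * f (X t))%E.
Proof.
move=> mf f0; rewrite lawE ge0_integral_measure_sum // [RHS]big_enum_val /=.
apply: eq_bigr => i _; rewrite /atoms valK /atom.
rewrite ge0_integral_mscale //= integral_dirac //= diracT mul1e //.
Qed.

(** A finite sum of scaled Dirac masses, indexed by an enumeration of
    the finite type; the nonnegative case is applied to both parts of [f]. *)
Lemma integral_law (f : R -> R) : measurable_fun [set: R] f ->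
  (\int[law p X]_x (f x)%:E = (\sum_t p t * f (X t))%:E)%E.
Proof.
move=> mf.
transitivity (\int[law p X]_x ((EFin \o f)^\+ x) - \int[law p X]_x ((EFin \o f)^\- x))%E.
  by rewrite lawE integralE.
have mE : measurable_fun [set: R] (EFin \o f) by exact/measurable_EFinP.
rewrite !ge0_integral_law //; [|exact: measurable_funeneg|exact: measurable_funepos].
transitivity ((\sum_t p t * Num.max (f (X t)) 0)%:E - (\sum_t p t * Num.max (- f (X t)) 0)%:E)%E.
  by rewrite -!sumEFin; congr (_ - _)%E; apply: eq_bigr => t _;
    rewrite EFinM ?funeposE ?funenegE /= -?EFinN EFin_max.
rewrite -EFinB; congr EFin; rewrite -sumrB; apply: eq_bigr => t _.
by rewrite -mulrBr; congr (_ * _); rewrite !maxEle; do 2 case: ifPn; lra.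
Qed.
End LawIntegral.

(** * The limit theorem *)

Section Assembly.
Context {R : realType} (alpha : R) (m : nat).
Hypothesis alpha_gt0 : 0 < alpha.
Hypothesis m_ge2 : (2 <= m)%N.
Local Notation Ex := (expect alpha m).
Local Notation W := (scaled_spread alpha m).
Local Notation v := (gamma_shape alpha m).
Implicit Types (f : R -> R) (n : nat).

Let m_gt0 : (0 < m)%N. Proof. exact: leq_trans m_ge2. Qed.

Lemma gamma_shape_gt0 : 0 < v.
Proof.
have a0 := alpha_gt0.
have : 2 <= m%:R :> R by rewrite ler_nat.
by move=> m2; rewrite divr_gt0 ?mulr_gt0 //; lra.
Qed.

(** The deterministic difference between the scaled spread and the statistic;
    it tends to 0. *)
Definition offset n : R := m%:R / (alpha * n%:R) * row_spread alpha m (fun=> 0%N).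

(** The expectation of [f] at the statistic under the first measure. *)
Definition Pmean n f : R := Ex n (fun K => f (W n K - offset n)).

Lemma cvg_inv_n (C : R) : C / n%:R @[n --> \oo] --> 0.
Proof.
apply: (@cvg_of_sqrt_bound _ (fun n => C / n%:R) 0 `|C| 1) => // n n1.
have nr : 1 <= n%:R :> R by rewrite ler1n.
rewrite subr0 normrM ler_wpM2l // normfV ger0_norm // lef_pV2 ?posrE ?sqrtr_gt0 ?ltr0n //.
rewrite -[leRHS]ger0_norm // -sqrtr_sqr ler_sqrt ?exprn_ge0 //.
by rewrite expr2 ler_peMl.
Qed.

Lemma offset_cvg : offset n @[n --> \oo] --> 0.
Proof.
rewrite (_ : offset = fun n => (m%:R * row_spread alpha m (fun=> 0%N) / alpha) / n%:R); first exact: cvg_inv_n.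
by apply/funext => n; rewrite /offset invfM; ring.
Qed.

Lemma Pmean_expectation n : offset n <= 1 -> expectation_on (Pmean n).
Proof.
move=> off; have bd K : -1 <= W n K - offset n.
  by have := scaled_spread_ge0 alpha m alpha_gt0 n K; lra.
split.
- exact: Ex1.
- by move=> a b f g _ _; rewrite /Pmean ExD !ExZ.
- by move=> f g _ _ fg; apply: Ex_le => // K _ _; exact: fg.
Qed.

Lemma Pmean_lap n e : Pmean n (lap e) = expR (- e) * expR (e * offset n) * laplace_mean alpha m n e.
Proof.
rewrite /laplace_mean -ExZ; apply: Ex_eq => K _ _.
by rewrite -!expRD /lap; congr expR; ring.
Qed.

(** Since [ln (1 + x) <= x], the Laplace transform is at least
    [exp (- (1 + v alpha) e)]. *)
Lemma gamma_lap_near1 (eta : R) : 0 < eta ->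
  exists2 e : R, 0 < e & 1 - eta <= gamma_mean v alpha (lap e).
Proof.
move=> eta0; have v0 := gamma_shape_gt0; have a0 := alpha_gt0.
have c0 : 0 < 1 + v * alpha by rewrite ltr_pwDl // mulr_ge0 // ltW.
exists (eta / (1 + v * alpha)); first by rewrite divr_gt0.
set e := _ / _; have e0 : 0 < e by rewrite divr_gt0.
rewrite gamma_mean_lap // /powR gt_eqF; last by rewrite ltr_pwDl // mulr_ge0 // ltW.
rewrite -expRD; apply: le_trans (expR_ge1Dx _).
have h : ln (1 + alpha * e) <= alpha * e.
  apply: le_ln1Dx; have : 0 < alpha * e by rewrite mulr_gt0.
  lra.
have h2 := ler_wpM2l (ltW v0) h.
have h3 : eta = (1 + v * alpha) * e by rewrite /e mulrC divfK // gt_eqF.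
by rewrite [in leLHS]h3; lra.
Qed.

Lemma Pmean_lap_cvg e : 0 < e ->
  Pmean n (lap e) @[n --> \oo] --> gamma_mean v alpha (lap e).
Proof.
move=> e0; rewrite gamma_mean_lap ?gamma_shape_gt0 //.
under eq_fun do rewrite Pmean_lap.
apply: cvgM; last by apply: laplace_mean_cvg => //; exact: ltW.
rewrite -[X in _ --> X]mulr1; apply: cvgM; first exact: cvg_cst.
rewrite -expR0 -(mulr0 e); apply: continuous_cvg; first exact: continuous_expR.
by apply: cvgM; [exact: cvg_cst|exact: offset_cvg].
Qed.

Lemma Pmean_cvg f : right_bounded f -> Pmean n f @[n --> \oo] --> gamma_mean v alpha f.
Proof.
move=> rf.
(* For finitely many n the statistic may take values below -1; any
   expectation can stand in for those terms. *)
pose I_ n := if offset n <= 1 then Pmean n else gamma_mean v alpha.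
have off1 : \forall n \near \oo, offset n <= 1.
  have /cvgrPdist_le/(_ _ ltr01) := offset_cvg.
  by apply: filterS => n; rewrite sub0r normrN; apply: le_trans; exact: ler_norm.
have I_P g : \forall n \near \oo, I_ n g = Pmean n g.
  by apply: filterS off1 => n; rewrite /I_ => ->.
have Jexp := gamma_mean_expectation v alpha gamma_shape_gt0 alpha_gt0.
have : I_ n f @[n --> \oo] --> gamma_mean v alpha f.
  apply: laplace_weak => //.
  - move=> n; rewrite /I_; case: ifPn => [off|_] //; exact: Pmean_expectation.
  - move=> e e0; apply: cvg_trans (Pmean_lap_cvg e e0); apply: near_eq_cvg.
    by apply: filterS (I_P (lap e)) => n ->.
  - exact: gamma_lap_near1.
by apply: cvg_trans; apply: near_eq_cvg; apply: filterS (I_P f) => n ->.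
Qed.

(** If some row is empty, so is the last one, whose deviation is then
    minus the mean, of order [n]. *)
Lemma last_row_zero n K : (0 < n)%N -> is_part m K -> (\sum_i K i = n)%N ->
  (exists i, K i = 0%N) -> (alpha / m%:R * n%:R) ^+ 2 <= row_spread alpha m K.
Proof.
move=> n0 p s [i Ki].
have jm : (m.-1 < m)%N by rewrite prednK.
pose j := Ordinal jm.
have Kj : K j = 0%N.
  by apply/eqP; rewrite -leqn0 -Ki; apply: p; rewrite -ltnS prednK.
have Lj : shifted alpha m K j = 0.
  rewrite /shifted Kj mulr0 add0r /=.
  have -> : (m%:R : R) = m.-1%:R + 1 by rewrite natr1 prednK.
  by ring.
have a0 := alpha_gt0.
have e0 : 0 <= (m%:R - 1) / 2 :> R by rewrite divr_ge0 // subr_ge0 ler1n.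
have an0 : 0 <= alpha / m%:R * n%:R by rewrite mulr_ge0 // divr_ge0 // ltW.
apply: (@le_trans _ _ (deviation alpha m K j ^+ 2)).
  rewrite /deviation Lj sub0r sqrrN (meanE alpha m m_gt0 n K s).
  by rewrite lerXn2r ?nnegrE ?addr_ge0 // lerDl.
rewrite -sum_dev2 (bigD1 j) //= lerDl sumr_ge0 // => r _; exact: sqr_ge0.
Qed.

Lemma partitions_eqP n (k : padded n m) :
  reflect (k \in partitions_le n m /\ forall i, (0 < rows m n k i)%N)
          (k \in partitions_eq n m).
Proof.
rewrite [k \in partitions_eq n m]finset.in_set; apply: (iffP andP) => -[kS]; rewrite /plength.
  have -> : (count (ltn 0) (parts k) == m) = all (ltn 0) (parts k).
    by rewrite all_count size_map size_tuple.
  move=> /(all_nthP 0%N); rewrite size_map size_tuple => h; split=> // i.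
  by rewrite -nth_parts; exact: h.
move=> h; split=> //; have -> : (count (ltn 0) (parts k) == m) = all (ltn 0) (parts k).
  by rewrite all_count size_map size_tuple.
apply/(all_nthP 0%N); rewrite size_map size_tuple => i im.
by have := h (Ordinal im); rewrite -nth_parts.
Qed.

Lemma jack_pmf_ge0 n (S : {set padded n m}) k : S \subset partitions_le n m ->
  0 <= jack_pmf alpha S k.
Proof.
move=> /fintype.subsetP sub; have w0 l : l \in S -> 0 <= jack_weight alpha (parts l).
  by move=> /sub /partitions_leP[p _]; rewrite jack_weightE // ltW // partition_weight_gt0.
rewrite /jack_pmf; case: ifPn => // kS.
by rewrite divr_ge0 ?w0 // sumr_ge0.
Qed.

Lemma sum_jackP n f (X : padded n m -> R) :
  \sum_k jackP alpha k * f (X k) =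
  \sum_(k in partitions_le n m)
     partition_weight alpha m (rows m n k) / partition_fun alpha m n * f (X k).
Proof.
rewrite /jackP /jack_pmf [RHS]big_mkcond; apply: eq_bigr => k _.
case: ifPn => [kS|_]; last by rewrite mul0r.
have E : \sum_(mu in partitions_le n m) jack_weight alpha (parts mu) = partition_fun alpha m n.
  by apply: eq_bigr => l /partitions_leP[p _]; rewrite jack_weightE.
by rewrite E jack_weightE //; have /partitions_leP[] := kS.
Qed.

(** The second measure is the first one conditioned on having [m]
    nonzero rows; conditioning changes the mean of a bounded function by at most
    twice its bound times the probability of the complement, which Markov's
    inequality and [last_row_zero] control. *)
Lemma jackP_jackQ_close n f M (X : padded n m -> R) : (0 < n)%N -> 0 <= M ->
  (forall x, `|f x| <= M) ->
  `|\sum_k jackP alpha k * f (X k) - \sum_k jackQ alpha k * f (X k)| <=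
  2 * M * (Ex n (row_spread alpha m) / (alpha / m%:R * n%:R) ^+ 2).
Proof.
move=> n0 M0 fM; have a0 := alpha_gt0.
rewrite sum_jackP.
pose w (k : padded n m) := partition_weight alpha m (rows m n k) / partition_fun alpha m n.
have Z0 := partition_fun_gt0 alpha m alpha_gt0 m_gt0 n.
pose q := \sum_(k in partitions_eq n m) w k.
pose del := \sum_(k in partitions_le n m | k \notin partitions_eq n m) w k.
have w0 k : k \in partitions_le n m -> 0 <= w k by exact: prob_ge0.
have sub k : k \in partitions_eq n m -> k \in partitions_le n m by case/partitions_eqP.
have split_sum (g : padded n m -> R) : \sum_(k in partitions_le n m) g k =
    \sum_(k in partitions_eq n m) g k +
    \sum_(k in partitions_le n m | k \notin partitions_eq n m) g k.
  rewrite (bigID (fun k => k \in partitions_eq n m)) /=; congr (_ + _).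
  by apply: eq_bigl => k; case: (boolP (k \in partitions_eq n m)) => [/sub ->|]; rewrite ?andbF.
have qd : q + del = 1.
  rewrite /q /del -split_sum -(Ex1 alpha m alpha_gt0 m_gt0 n 1).
  by apply: eq_bigr => k _; rewrite mulr1.
have q0 : 0 <= q by apply: sumr_ge0 => k /sub /w0.
have del0 : 0 <= del by apply: sumr_ge0 => k /andP[/w0].
have QE : \sum_k jackQ alpha k * f (X k) =
    (\sum_(k in partitions_eq n m) w k * f (X k)) / q.
  have Eq : \sum_(mu in partitions_eq n m) jack_weight alpha (parts mu) = q * partition_fun alpha m n.
    rewrite /q mulr_suml; apply: eq_bigr => l /sub /partitions_leP[p _].
    by rewrite jack_weightE // divfK // gt_eqF.
  rewrite /jackQ /jack_pmf mulr_suml [RHS]big_mkcond; apply: eq_bigr => k _.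
  case: ifPn => [kS|_]; last by rewrite mul0r.
  have /partitions_leP[p _] := sub _ kS.
  by rewrite Eq jack_weightE // /w invfM; ring.
have bnd (P : pred (padded n m)) : (forall k, P k -> k \in partitions_le n m) ->
    `|\sum_(k | P k) w k * f (X k)| <= M * \sum_(k | P k) w k.
  move=> sP; apply: le_trans (ler_norm_sum _ _ _) _; rewrite mulr_sumr.
  apply: ler_sum => k /sP /w0 wk; rewrite normrM ger0_norm // mulrC ler_wpM2r //.
have bq := bnd _ sub.
have bd := bnd (fun k => (k \in partitions_le n m) && (k \notin partitions_eq n m)) (fun k h => proj1 (andP h)).
rewrite QE split_sum.
move: bq bd; set S1 := \sum_(k in partitions_eq n m) _ * _; set S2 := \sum_(k | _ && _) w k * _.
rewrite -/q -/del => bq bd.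
have close : `|S1 + S2 - S1 / q| <= 2 * M * del.
  have -> : S1 + S2 - S1 / q = - (S1 / q) * del + S2.
    have [q00|q00] := eqVneq q 0.
      move: bq; rewrite q00 mulr0 normr_le0 => /eqP ->.
      by rewrite !mul0r; ring.
    have -> : del = 1 - q by rewrite -qd; ring.
    by field.
  have Sq : `|S1 / q| <= M.
    have [q00|q00] := eqVneq q 0; first by rewrite q00 invr0 mulr0 normr0.
    by rewrite normrM normfV (ger0_norm q0) ler_pdivrMr // lt_def q00.
  apply: le_trans (ler_normD _ _) _; rewrite normrM normrN (ger0_norm del0).
  have := ler_wpM2r del0 Sq; lra.
apply: le_trans close _; rewrite ler_wpM2l ?mulr_ge0 //.
have b0 : 0 < (alpha / m%:R * n%:R) ^+ 2.
  by rewrite exprn_gt0 // mulr_gt0 ?divr_gt0 ?ltr0n.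
rewrite ler_pdivlMr // /del mulr_suml /expect split_sum -[leLHS]add0r lerD //.
  apply: sumr_ge0 => k /sub kS; rewrite mulr_ge0 ?row_spread_ge0 //; exact: w0.
apply: ler_sum => k /andP[kS kN]; rewrite ler_wpM2l ?w0 //.
have /partitions_leP[p s] := kS.
apply: last_row_zero => //; apply: contrapT => ne.
move/negP: kN; apply; apply/partitions_eqP; split=> // i; rewrite lt0n.
by apply/eqP => ki; apply: ne; exists i.
Qed.

Definition statistic n (k : padded n m) : R :=
  (jack_eigenvalue alpha n m (parts k) -
    ((m%:R - alpha - 1) / 2 * n%:R + alpha / (2 * m%:R) * n%:R ^+ 2)) /
  (n%:R / (2 * m%:R)).

Lemma jackP_sum_cvg f : right_bounded f ->
  (\sum_(k : padded n m) jackP alpha k * f (statistic n k)) @[n --> \oo] -->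
  gamma_mean v alpha f.
Proof.
move=> rf; apply: cvg_trans (Pmean_cvg f rf); apply: near_eq_cvg; near=> n.
have n0 : (0 < n)%N by near: n; exists 1%N.
rewrite sum_jackP /Pmean; apply: eq_bigr => k kS.
by rewrite /statistic eigenvalueE.
Unshelve. all: end_near. Qed.

Lemma jackQ_sum_cvg f : right_bounded f -> bounded_fun f ->
  (\sum_(k : padded n m) jackQ alpha k * f (statistic n k)) @[n --> \oo] -->
  gamma_mean v alpha f.
Proof.
move=> rf [M0 [_ hM]]; pose M := `|M0| + 1.
have fM x : `|f x| <= M by apply: hM => //; rewrite /M ltr_pwDr // ler_norm.
have M_ge0 : 0 <= M by rewrite addr_ge0.
have [C [N [C0 N0 mom]]] := moment_bounds alpha m alpha_gt0 m_gt0.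
pose P n := \sum_(k : padded n m) jackP alpha k * f (statistic n k).
pose Q n := \sum_(k : padded n m) jackQ alpha k * f (statistic n k).
have a0 := alpha_gt0.
have mr : 0 < m%:R :> R by rewrite ltr0n.
have c0 : 0 <= C * (m%:R / alpha) ^+ 2.
  by apply: mulr_ge0 => //; apply: exprn_ge0; apply: divr_ge0 => //; exact: ltW.
have PQ : (P n - Q n) @[n --> \oo] --> 0.
  apply: (@cvg_of_sqrt_bound _ _ 0 (2 * M * (C * (m%:R / alpha) ^+ 2)) N).
    by rewrite mulr_ge0 // mulr_ge0.
  move=> n Nn; have n0 : (0 < n)%N by exact: leq_trans Nn.
  have nr : 1 <= n%:R :> R by rewrite ler1n.
  rewrite subr0 (le_trans (jackP_jackQ_close n f M _ n0 M_ge0 fM)) //.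
  rewrite -[leRHS]mulrA ler_wpM2l ?mulr_ge0 //.
  have an0 : 0 < (alpha / m%:R * n%:R) ^+ 2 by rewrite exprn_gt0 // !mulr_gt0 ?invr_gt0 ?ltr0n.
  apply: (@le_trans _ _ (C * (m%:R / alpha) ^+ 2 / n%:R)).
    rewrite ler_pdivrMr // (le_trans (proj1 (mom n Nn))) // le_eqVlt.
    apply/orP; left; apply/eqP; field.
    by rewrite !gt_eqF // ltr0n.
  rewrite ler_wpM2l //.
  rewrite lef_pV2 ?posrE ?sqrtr_gt0 ?ltr0n //.
  by rewrite -[leRHS]ger0_norm // -sqrtr_sqr ler_sqrt ?exprn_ge0 // expr2 ler_peMl.
rewrite -[gamma_mean _ _ _]subr0 (_ : (fun n => _) = fun n => P n - (P n - Q n)).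
  by apply: cvgB => //; exact: jackP_sum_cvg.
by apply/funext => n; rewrite /P /Q opprB addrC subrK.
Qed.

Lemma weak_cvg_of_sums (p : forall n, padded n m -> R) (X : forall n, padded n m -> R) :
  (forall n k, 0 <= p n k) ->
  (forall f, right_bounded f -> bounded_fun f ->
    (\sum_k p n k * f (X n k)) @[n --> \oo] --> gamma_mean v alpha f) ->
  weak_cvg (fun n => law (p n) (X n)) (gamma_prob v alpha).
Proof.
move=> p0 h f cf bf.
have rf : right_bounded f.
  split=> //; have [M0 [_ hM]] := bf; exists (`|M0| + 1) => x _.
  by apply: hM => //; rewrite ltr_pwDr // ler_norm.
rewrite integral_gamma_prob ?gamma_shape_gt0 //.
rewrite (_ : (fun n => _) = (fun n => (\sum_k p n k * f (X n k))%:E)); last first.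
  apply/funext => n; apply: integral_law => //; exact: continuous_measurable_fun.
by apply: cvg_EFin; [exact: nearW|exact: h].
Qed.

End Assembly.

Theorem theorem2 (R : realType) (alpha : R) (m : nat)
    (alpha_gt0 : 0 < alpha) (m_ge2 : (2 <= m)%N) :
  let beta : R := 2 / alpha in
  let a (n : nat) : R :=
    (m%:R - alpha - 1) / 2 * n%:R + alpha / (2 * m%:R) * n%:R ^+ 2 in
  let b (n : nat) : R := n%:R / (2 * m%:R) in
  let v : R := 4^-1 * (m%:R - 1) * (m%:R * beta + 2) in
  let X (n : nat) (k : padded n m) : R :=
    (jack_eigenvalue alpha n m (parts k) - a n) / b n in
  weak_cvg (fun n => law (jackP alpha (n := n) (m := m)) (X n))
           (gamma_prob v (2 / beta)) /\
  weak_cvg (fun n => law (jackQ alpha (n := n) (m := m)) (X n))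
           (gamma_prob v (2 / beta)).
Proof.
move=> beta a b v X.
have -> : v = gamma_shape alpha m by rewrite /v /beta /gamma_shape; field; rewrite gt_eqF.
have -> : 2 / beta = alpha by rewrite /beta; field; rewrite gt_eqF.
split; apply: weak_cvg_of_sums => //.
- by move=> n k; apply: jack_pmf_ge0.
- by move=> f rf _; exact: jackP_sum_cvg.
- move=> n k; apply: jack_pmf_ge0 => //; apply/fintype.subsetP => l.
  by case/partitions_eqP.
- by move=> f rf bf; exact: jackQ_sum_cvg.
Qed.
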